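(* Let $p$ and $q$ be distinct primes. Let $f(x)\in\mathbb{Z}[x]$ be a monic divisor of $x^{p^2q}-1$. Then there exists an integer $0\le k\le 63$ such that $$f(x)=f_k(x)=\Phi_1^{k_0}\Phi_p^{k_1}\Phi_q^{k_2}\Phi_{pq}^{k_3}\Phi_{p^2}^{k_4}\Phi_{p^2q}^{k_5},$$ with $0\le k_j\le 1$ and $k=\sum_{j=0}^5 k_j2^j$ the binary expansion of $k$. The coefficient set $\mathcal{C}(f_k)$ is given as follows, apart from the exceptions listed afterwards: - $\{1\}$ for $k\in\{0,2,4,14,18,62\}$; - $\{-1,1\}$ for $k=1$; - $[0,1]$ for $k\in\{10,12,16,26,44,46,48,50,52,58,60\}$; - $[-1,1]$ for $k\in\{3,5,7,8,11,13,15,17,19,21,23,27,31,32,33,34,36,37,40,42,45,47,49,51,53,55,56,59,61,63\}$; - $[-2,2]$ for $k\in\{9,35,39,41,43,57\}$; - $[1,\min(p,q)]$ for $k\in\{6,30\}$; - $[0,\min(p,q)]$ for $k\in\{28,54\}$; - $[\min(\lfloor q/p\rfloor,1),\,\alpha(p,q)]$ for $k=20$; - $[1,\min(p^2,q)]$ for $k=22$; - $[-\min(p,q-p^* ),\,\min(p,p^* )]$ for $k=24$; - $[-\gamma(p,q),\gamma(p,q)]$ for $k=25$; - $[-\min(p,q),\min(p,q)]$ for $k=29$; - $[-\beta(p,q),\min(p,q)]$ for $k=38$. The exceptions, in which $\mathcal{C}(f_k)$ is instead as stated here, are: - if $\min(p,q)=2$: $\mathcal{C}(f_8)=\{-1,1\}$,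 $\mathcal{C}(f_{24})=[-\min(p,q-p^* ),\min(p,p^* )]\setminus\{0\}$, $\mathcal{C}(f_{34})=\{-1,1\}$; - if $\min(p,q)\le 3$: $\mathcal{C}(f_9)=\{-2,-1,1,2\}$; - if $q=2$: $\mathcal{C}(f_{11})=\{-1,1\}$, $\mathcal{C}(f_{38})=\{-2,0,1,2\}$, $\mathcal{C}(f_{40})=\{-1,1\}$, $\mathcal{C}(f_{43})=\{-2,-1,1,2\}$, $\mathcal{C}(f_{59})=\{-1,1\}$; - if $p=2$: $\mathcal{C}(f_{13})=\{-1,1\}$, $\mathcal{C}(f_{17})=\{-1,1\}$, $\mathcal{C}(f_{29})=\{-2,-1,1,2\}$, $\mathcal{C}(f_{33})=\{-1,1\}$, $\mathcal{C}(f_{61})=\{-1,1\}$; - if $p\le 3$ and $q\ne 2$: $\mathcal{C}(f_{25})=[-\gamma(p,q),\gamma(p,q)]\setminus\{0\}$; - if $p=2$ and $q=3$: $\mathcal{C}(f_{38})=\{-1,1,2\}$; - if $q\le 3$: $\mathcal{C}(f_{41})=\{-2,-1,1,2\}$.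
   Context: $\Phi_n=\Phi_n(x)$ denotes the $n$th cyclotomic polynomial. For a nonzero polynomial $f(x)=\sum_{j} c_jx^j\in\mathbb{Z}[x]$, $\mathcal{C}(f)=\{c_j : 0\le j\le \deg f\}$ denotes its set of coefficients. For integers $a\le b$, $[a,b]$ denotes the set of integers $\{a,a+1,\ldots,b\}$. For distinct primes $p,q$: $p^*$ is the unique integer with $1\le p^*<q$ and $pp^*\equiv 1\pmod q$; $\alpha(p,q)=\min(\lfloor (q-1)/p\rfloor+1,\,p)$; $\gamma(p,q)=\min(p,p^* )+\min(p,q-p^* )$; $\beta(p,q)=\min(p,\,q,\,r,\,p^2-r)$, where $r$ is the remainder of $q$ on division by $p^2$ (so $0<r<p^2$). *)

(* Defs.v *)
From mathcomp Require Import all_boot all_order all_algebra all_field.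

Set Implicit Arguments.
Unset Strict Implicit.
Unset Printing Implicit Defensive.

Import Order.TTheory GRing.Theory Num.Theory.
Local Open Scope ring_scope.

(* A polynomial is stored as its coefficients of degrees 0, ..., deg f, so for
   f != 0 this is {c_j : 0 <= j <= deg f}; zeros above the degree are not
   counted, but inner zeros are. *)
Definition coef_set (f : {poly int}) : {pred int} := [pred c in polyseq f].

Definition zitv (a b : int) : {pred int} := [pred c in `[a, b]].

Definition zset (s : seq int) : {pred int} := [pred c in s].

Definition zitv_neq0 (a b : int) : {pred int} := [predD1 zitv a b & 0].

Section Quantities.
Local Open Scope nat_scope.

(* The inverse of p modulo q; pstarP and pstar_uniq show that for distinct
   primes this is the unique s in [1, q - 1] with p * s = 1 modulo q. *)
Definition pstar (p q : nat) : nat :=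
  find (fun s => p * s == 1 %[mod q]) (iota 0 q).

Lemma pstarP p q : prime p -> prime q -> p != q ->
  (0 < pstar p q < q) /\ p * pstar p q = 1 %[mod q].
Proof.
move=> pp pq npq; have q1 := prime_gt1 pq; have q0 := ltnW q1.
have hasP : has (fun s => p * s == 1 %[mod q]) (iota 0 q).
  have cpq : coprime p q by rewrite prime_coprime // dvdn_prime2.
  case: (egcdnP q (prime_gt0 pp)) => km kn Ekm _.
  apply/hasP; exists (km %% q); first by rewrite mem_iota ltn_pmod.
  by rewrite modnMmr mulnC Ekm (eqP cpq) modnMDl.
have lt_q : pstar p q < q by rewrite -[ltnRHS](size_iota 0) -has_find.
have /= /eqP E := nth_find 0 hasP.
have {}E : p * pstar p q = 1 %[mod q].
  by rewrite -[RHS]E -/(pstar p q) nth_iota.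
split=> //; rewrite lt_q andbT lt0n; apply/eqP => s0.
by move: E; rewrite s0 muln0 mod0n modn_small.
Qed.

Lemma pstar_uniq p q s : prime p -> prime q -> p != q ->
  0 < s < q -> p * s = 1 %[mod q] -> s = pstar p q.
Proof.
move=> pp pq npq /andP[_ lt_sq] Es.
have [/andP[_ lt_q] E] := pstarP pp pq npq.
have cqp : coprime q p by rewrite prime_coprime // dvdn_prime2 // eq_sym.
rewrite -(modn_small lt_sq) -(modn_small lt_q); apply/eqP.
have : p * s == p * pstar p q %[mod q] by rewrite Es E.
wlog le_s : s {Es lt_sq} / s <= pstar p q => [IH|].
  case: (leqP s (pstar p q)) => [/IH//|/ltnW le].
  rewrite eqn_mod_dvd ?leq_mul2l ?le ?orbT // -mulnBr Gauss_dvdr //.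
  by rewrite -eqn_mod_dvd.
rewrite eq_sym eqn_mod_dvd ?leq_mul2l ?le_s ?orbT // -mulnBr Gauss_dvdr //.
by rewrite -eqn_mod_dvd // eq_sym.
Qed.

Definition alpha (p q : nat) : nat := minn ((q - 1) %/ p + 1) p.

Definition gamma (p q : nat) : nat :=
  minn p (pstar p q) + minn p (q - pstar p q).

Definition beta (p q : nat) : nat :=
  let r := q %% p ^ 2 in minn (minn (minn p q) r) (p ^ 2 - r).

Definition bit (k j : nat) : nat := (k %/ 2 ^ j) %% 2.

Lemma bit_expansion k : k < 64 -> k = \sum_(j < 6) bit k j * 2 ^ j.
Proof.
rewrite !big_ord_recr big_ord0 /=.
by do 64 (case: k => [//|k]).
Qed.

End Quantities.

Definition fdiv (p q k : nat) : {poly int} :=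
  'Phi_1 ^+ bit k 0 * 'Phi_p ^+ bit k 1 * 'Phi_q ^+ bit k 2
  * 'Phi_(p * q) ^+ bit k 3 * 'Phi_(p ^ 2) ^+ bit k 4
  * 'Phi_(p ^ 2 * q) ^+ bit k 5.

(* The index lists partition 0, ..., 63, so the final branch is never reached
   for k < 64. *)
Definition generic_coefs (p q k : nat) : {pred int} :=
  if k \in [:: 0; 2; 4; 14; 18; 62]%N then zset [:: 1]
  else if k == 1%N then zset [:: -1; 1]
  else if k \in [:: 10; 12; 16; 26; 44; 46; 48; 50; 52; 58; 60]%N
  then zitv 0 1
  else if k \in [:: 3; 5; 7; 8; 11; 13; 15; 17; 19; 21; 23; 27; 31; 32; 33;
                    34; 36; 37; 40; 42; 45; 47; 49; 51; 53; 55; 56; 59; 61;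
                    63]%N
  then zitv (-1) 1
  else if k \in [:: 9; 35; 39; 41; 43; 57]%N then zitv (-2) 2
  else if k \in [:: 6; 30]%N then zitv 1 (minn p q)%:Z
  else if k \in [:: 28; 54]%N then zitv 0 (minn p q)%:Z
  else if k == 20%N then zitv (minn (q %/ p)%N 1)%:Z (alpha p q)%:Z
  else if k == 22%N then zitv 1 (minn (p ^ 2)%N q)%:Z
  else if k == 24%N
  then zitv (- (minn p (q - pstar p q)%N)%:Z) (minn p (pstar p q))%:Z
  else if k == 25%N then zitv (- (gamma p q)%:Z) (gamma p q)%:Z
  else if k == 29%N then zitv (- (minn p q)%:Z) (minn p q)%:Z
  else if k == 38%N then zitv (- (beta p q)%:Z) (minn p q)%:Z
  else pred0.

(* For fixed p, q and k at most one of the exceptional conditions holds, so the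
   order of the tests is immaterial. *)
Definition expected_coefs (p q k : nat) : {pred int} :=
  if (minn p q == 2%N) && (k \in [:: 8; 34]%N) then zset [:: -1; 1]
  else if (minn p q == 2%N) && (k == 24%N)
  then zitv_neq0 (- (minn p (q - pstar p q)%N)%:Z) (minn p (pstar p q))%:Z
  else if (minn p q <= 3)%N && (k == 9%N) then zset [:: -2; -1; 1; 2]
  else if (q == 2%N) && (k \in [:: 11; 40; 59]%N) then zset [:: -1; 1]
  else if (q == 2%N) && (k == 38%N) then zset [:: -2; 0; 1; 2]
  else if (q == 2%N) && (k == 43%N) then zset [:: -2; -1; 1; 2]
  else if (p == 2%N) && (k \in [:: 13; 17; 33; 61]%N) then zset [:: -1; 1]
  else if (p == 2%N) && (k == 29%N) then zset [:: -2; -1; 1; 2]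
  else if [&& (p <= 3)%N, q != 2%N & k == 25%N]
  then zitv_neq0 (- (gamma p q)%:Z) (gamma p q)%:Z
  else if [&& p == 2%N, q == 3%N & k == 38%N] then zset [:: -1; 1; 2]
  else if (q <= 3)%N && (k == 41%N) then zset [:: -2; -1; 1; 2]
  else generic_coefs p q k.

(* Main.v *)
Require Import Defs.
From mathcomp Require Import all_boot all_order all_algebra all_field.
From mathcomp Require Import zify ring.
Import Order.TTheory GRing.Theory Num.Theory.
Local Open Scope ring_scope.

Set Implicit Arguments.
Unset Strict Implicit.
Unset Printing Implicit Defensive.

(* The divisors of x^n - 1 are products of distinct cyclotomic polynomials, since
   a polynomial over the rationals vanishes at either all or none of the primitive
   d-th roots of unity. The quotient
   (x^e - 1) (x^(MB) - 1) / ((x^M - 1) (x^B - 1)) for coprime M, B has as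
   coefficients s(z) - s(z - e), where s is the indicator of the numerical
   semigroup <M, B>. With (M, B) = (p, q) this describes Phi_(pq) = Phi_(p^2q)(x^(1/p)),
   and with (M, B) = (q, p^2) it describes Phi_(pq) Phi_(p^2q). Every f_k is the
   product of such a quotient (possibly evaluated at x^p) with polynomials x^a - 1
   and (x^(ab) - 1) / (x^a - 1), so its coefficients are short alternating sums of
   values of s, and each claim becomes a statement about membership in <p, q> or
   <q, p^2>. Coefficients are indexed by integers, being 0 at negative indices. *)

(** The delicate value is 0. Inner zeros count and zeros beyond the degree do not, so including 0
    requires a vanishing coefficient together with a nonzero one above it, often the leading one,
    while excluding 0 requires control of every index up to the degree. Most exceptions for small p
    and q concern exactly this: either a generator 2 or 3 makes the semigroup too regular for the
    relevant difference of values of [s] to vanish, or a product f(x) g(x^M) has deg f = M - 1 and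
    leaves no gap between the copies of f. Half of the 64 cases are products f(x) g(x^M) with deg f
    < M, where coefficients simply multiply. The overlapping products that remain need explicit
    indices realising each value; where a quotient is antipalindromic, one sign is enough. *)

(** * Coefficients at integer indices *)

Definition cz (f : {poly int}) (z : int) : int :=
  if z is Posz n then f`_n else 0.

Lemma cz_neg f (z : int) : z < 0 -> cz f z = 0.
Proof. by case: z. Qed.

Lemma cz_ge_size (f : {poly int}) (z : int) : (size f)%:Z <= z -> cz f z = 0.
Proof. by case: z => // n; rewrite lez_nat /=; exact: nth_default. Qed.

Lemma czN f z : cz (- f) z = - cz f z.
Proof. by case: z => n /=; rewrite ?coefN ?oppr0. Qed.

Lemma czD f g z : cz (f + g) z = cz f z + cz g z.
Proof. by case: z => n /=; rewrite ?coefD ?addr0. Qed.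

Lemma czB f g z : cz (f - g) z = cz f z - cz g z.
Proof. by rewrite czD czN. Qed.

Lemma czXnM a f z : cz ('X^a * f) z = cz f (z - a%:Z).
Proof.
case: z => n; last by rewrite [RHS]cz_neg //; lia.
rewrite /= coefXnM; case: ltnP => h; first by rewrite cz_neg //; lia.
by rewrite subzn.
Qed.

Lemma czXn1M a f z : cz (('X^a - 1) * f) z = cz f (z - a%:Z) - cz f z.
Proof. by rewrite mulrBl mul1r czB czXnM. Qed.

Lemma czX1M f z : cz (('X - 1) * f) z = cz f (z - 1) - cz f z.
Proof. by rewrite -['X]expr1 czXn1M. Qed.

(** As a power series x^a - 1 is invertible, so the coefficients of [f] follow recursively from
    those of [('X^a - 1) * f], starting with 0 at negative indices. A closed formula [h] is thus
    verified by multiplying instead of dividing. *)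
Lemma cz_uniq a f (h : int -> int) : (0 < a)%N ->
  (forall z : int, z < 0 -> h z = 0) ->
  (forall z : int, h (z - a%:Z) - h z = cz (('X^a - 1) * f) z) ->
  forall z : int, cz f z = h z.
Proof.
move=> a0 h0 hE; case=> n; last by rewrite h0.
elim/ltn_ind: n => n IH.
have := hE n; rewrite czXn1M.
suff -> : cz f (n%:Z - a%:Z) = h (n%:Z - a%:Z) by move=> /addrI/oppr_inj.
case E: (n%:Z - a%:Z) => [m|m]; last by rewrite h0.
by apply: IH; lia.
Qed.

Lemma cz_compXn M g z : (0 < M)%N ->
  cz (g \Po 'X^M) z = if (M%:Z %| z)%Z then cz g (z %/ M%:Z)%Z else 0.
Proof.
move=> M0; case: z => n; last first.
  have z0 : Negz n < 0 by [].
  by rewrite cz_neg //; case: ifP => // /divzK E; rewrite cz_neg //; nia.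
by rewrite /= coef_comp_poly_Xn // divz_nat.
Qed.

Lemma coef_setP (f : {poly int}) c :
  reflect (exists2 n, (n < size f)%N & f`_n = c) (c \in coef_set f).
Proof. exact: nthP. Qed.

Lemma coef_set_cz (f : {poly int}) c : c \in coef_set f -> exists2 z : int, 0 <= z & cz f z = c.
Proof. by case/coef_setP => n _ E; exists n%:Z. Qed.

(** The zeros at and beyond [K] lie above the degree and are not stored. This is what makes it
    possible to exclude 0 from a coefficient set. *)
Lemma coef_set_cz_lt (f : {poly int}) c (K : int) : (forall z : int, K <= z -> cz f z = 0) ->
  c \in coef_set f -> exists2 z : int, 0 <= z < K & cz f z = c.
Proof.
move=> hK /coef_setP[n ltn E]; exists n%:Z => //.
rewrite lez_nat leq0n /= ltNge; apply/negP => leK.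
suff : (size f <= n)%N by rewrite leqNgt ltn.
by apply/leq_sizeP => j lej; apply: (hK j%:Z); lia.
Qed.

Lemma mem_coef_set {f : {poly int}} z {c} : cz f z = c -> c != 0 -> c \in coef_set f.
Proof.
case: z => n /= <- => [n0|/eqP//]; apply/coef_setP; exists n => //.
by rewrite ltnNge; apply: contra n0 => /leq_sizeP/(_ n (leqnn n))->.
Qed.

Arguments mem_coef_set {f} z {c}.

(** The nonzero coefficient at [z'] certifies that the zero at [z] lies below the degree. *)
Lemma mem0_coef_set {f : {poly int}} (z z' : int) : cz f z = 0 -> 0 <= z < z' -> cz f z' != 0 ->
  0 \in coef_set f.
Proof.
case: z z' => [n|n] [m|m] //= n0 lt_nm m0; apply/coef_setP; exists n => //.
rewrite (leq_trans lt_nm) // leqNgt; apply: contra m0 => lem.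
by have /leq_sizeP/(_ m (leqnn m))-> : (size f <= m)%N by exact: ltnW.
Qed.

Arguments mem0_coef_set {f} z z'.

(** * Palindromic and antipalindromic quotients *)

Definition czsym (f : {poly int}) (e n : int) :=
  forall z : int, cz f (n - z) = e * cz f z.

Lemma czsymMl a (f : {poly int}) (e n : int) :
  czsym f e n -> czsym (('X^a - 1) * f) (- e) (n + a%:Z).
Proof.
move=> H z; rewrite !czXn1M.
have -> : n + a%:Z - z - a%:Z = n - z by ring.
have -> : n + a%:Z - z = n - (z - a%:Z) by ring.
by rewrite !H; ring.
Qed.

(** By symmetry the product vanishes above [n], so above [n - a] the coefficients of [f] have period
    [a]; a polynomial being finite, they are 0 there. The reflected sequence is then 0 at negative
    indices, and [cz_uniq] identifies it with [f]. *)
Lemma czsymMl_inv a (f : {poly int}) (e n : int) : (0 < a)%N -> e * e = 1 ->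
  czsym (('X^a - 1) * f) e n -> czsym f (- e) (n - a%:Z).
Proof.
move=> a0 ee H.
have big : forall k (w : int), w > n - a%:Z -> cz f w = cz f (w + (k * a)%N%:Z).
  elim=> [|k IH] w hw; first by rewrite addr0.
  rewrite IH //; have := H (n - (w + (k.+1 * a)%N%:Z)); rewrite [in RHS]cz_neg; last by lia.
  rewrite mulr0 subKr czXn1M => /eqP; rewrite subr_eq0 => /eqP <-.
  by congr (cz f _); lia.
have vanish (w : int) : w > n - a%:Z -> cz f w = 0.
  move=> hw; rewrite (big (size f + `|w|)%N) //; apply: cz_ge_size.
  by have := leq_pmulr (size f + `|w|)%N a0; lia.
have E : forall z : int, cz f z = - e * cz f (n - a%:Z - z).
  apply: (cz_uniq a0) => [z hz|z]; first by rewrite vanish ?mulr0 //; lia.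
  have := H (n - z); rewrite subKr => ->; rewrite czXn1M.
  have -> : n - z - a%:Z = n - a%:Z - z by ring.
  have -> : n - a%:Z - (z - a%:Z) = n - z by ring.
  ring.
move=> z; rewrite [in RHS]E; have -> : - e * (- e * cz f (n - a%:Z - z)) = e * e * cz f (n - a%:Z - z) by ring.
by rewrite ee mul1r.
Qed.

Lemma czsym_prod (l : seq nat) : exists2 n, czsym (\prod_(a <- l) ('X^a - 1)) ((-1) ^+ size l) n & true.
Proof.
elim: l => [|a l [n IH _]].
  exists 0 => // z; rewrite big_nil expr0 mul1r sub0r.
  by case: z => [[|n]|n] /=; rewrite ?coef1 ?oppr0.
exists (n + a%:Z) => //; rewrite big_cons /= exprS mulN1r; exact: czsymMl.
Qed.

Lemma czsym_quotient (l1 l2 : seq nat) (f : {poly int}) :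
  all (leq 1) l1 ->
  f * \prod_(a <- l1) ('X^a - 1) = \prod_(a <- l2) ('X^a - 1) ->
  exists n, czsym f ((-1) ^+ (size l1 + size l2)) n.
Proof.
elim: l1 f => [|a l1 IH] f /=.
  by rewrite big_nil mulr1 => _ ->; have [n H _] := czsym_prod l2; exists n.
case/andP=> a0 al1; rewrite big_cons mulrA => /(IH _ al1)[n H].
exists (n - a%:Z); rewrite addSn exprS mulN1r; apply: czsymMl_inv => //.
  by rewrite -expr2 sqrr_sign.
by rewrite mulrC.
Qed.

(** Each factor x^a - 1 changes the sign of the symmetry, whether it multiplies or divides. An odd
    total makes [f] antipalindromic, so only one of each pair of opposite values has to be
    realised. *)
Lemma coef_set_opp (l1 l2 : seq nat) (f : {poly int}) c :
  all (leq 1) l1 -> odd (size l1 + size l2) ->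
  f * \prod_(a <- l1) ('X^a - 1) = \prod_(a <- l2) ('X^a - 1) ->
  c \in coef_set f -> - c \in coef_set f.
Proof.
move=> hl1 hodd E; have [n H] := czsym_quotient hl1 E.
case: (eqVneq c 0) => [->|c0]; first by rewrite oppr0.
case/coef_set_cz => z _ Ez.
apply: (mem_coef_set (n - z)); last by rewrite oppr_eq0.
by rewrite H Ez -signr_odd hodd mulN1r.
Qed.

(** * Geometric sums and substitution of powers of x *)

Definition geo (l : nat) : {poly int} := \poly_(i < l) 1.

Lemma mul_geo l : ('X - 1) * geo l = 'X^l - 1.
Proof.
rewrite subrX1 /geo poly_def; congr (_ * _).
by apply: eq_bigr => i _; rewrite scale1r.
Qed.

Lemma size_geo l : size (geo l) = l.
Proof. by case: l => [|l]; [rewrite /geo poly_def big_ord0 size_poly0 | apply: size_poly_eq]. Qed.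

Lemma cz_geo l z : cz (geo l) z = (nat_of_bool (0 <= z < l%:Z))%:Z.
Proof. by case: z => n //=; rewrite coef_poly; case: ifP => //=; lia. Qed.

Lemma X1_neq0 : 'X - 1 != 0 :> {poly int}.
Proof. by rewrite -size_poly_gt0 -polyC1 size_XsubC. Qed.

Lemma Xn1_neq0 n : (0 < n)%N -> 'X^n - 1 != 0 :> {poly int}.
Proof. by move=> n0; rewrite -size_poly_gt0 size_XnsubC. Qed.

Lemma geoP f l : ('X - 1) * f = 'X^l - 1 -> f = geo l.
Proof. by rewrite -mul_geo => /(mulfI X1_neq0). Qed.

Lemma Xn1_comp n M : ('X^n - 1 : {poly int}) \Po 'X^M = 'X^(n * M) - 1.
Proof. by rewrite rmorphB rmorph1 /= comp_Xn_poly mulnC exprM. Qed.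

Lemma X1_comp M : ('X - 1 : {poly int}) \Po 'X^M = 'X^M - 1.
Proof. by rewrite -['X]expr1 Xn1_comp mul1n. Qed.

Lemma mul_geo_comp l M : ('X^M - 1) * (geo l \Po 'X^M) = 'X^(l * M) - 1.
Proof. by rewrite -X1_comp -comp_polyM mul_geo Xn1_comp. Qed.

(** * Products without carries *)

(** Since [f] has degree below [M], an index splits in only one way into an exponent of [f] and a
    multiple of [M], so a single term of the convolution survives. *)
Lemma coef_kron (f g : {poly int}) M n : (0 < M)%N -> (size f <= M)%N ->
  (f * (g \Po 'X^M))`_n = f`_(n %% M) * g`_(n %/ M).
Proof.
move=> M0 hf; rewrite coefM.
have lt : (n %% M < n.+1)%N by rewrite ltnS leq_mod.
rewrite (bigD1 (Ordinal lt)) //= big1 ?addr0 => [|i ne].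
  by rewrite coef_comp_poly_Xn // {2 4}(divn_eq n M) addnK dvdn_mull // mulnK.
rewrite coef_comp_poly_Xn //; case: ifP => // dv; last by rewrite mulr0.
rewrite nth_default ?mul0r // leqNgt; apply/negP => lti; case/negP: ne.
apply/eqP/val_inj => /=; have ltM := leq_trans lti hf.
have lei : (i <= n)%N by rewrite -ltnS.
move: ltM lei dv; move: (nat_of_ord i) => j ltM lei dv.
by rewrite -(subnK lei) -modnDml (eqP dv) add0n modn_small.
Qed.

(** The second alternative is a gap: for [size f < M] consecutive copies of [f] do not touch, and
    [1 < size g] puts a later copy above the gap. *)
Lemma kronP (f g : {poly int}) M c : f != 0 -> g != 0 -> (0 < M)%N -> (size f <= M)%N ->
  c \in coef_set (f * (g \Po 'X^M)) <->
  (exists u v, [/\ u \in coef_set f, v \in coef_set g & c = u * v]) \/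
  [/\ c = 0, (size f < M)%N & (1 < size g)%N].
Proof.
move=> f0 g0 M0 hf.
have gM : size (g \Po 'X^M) = ((size g).-1 * M).+1.
  have := size_comp_poly g 'X^M; rewrite size_polyXn /=.
  have : (0 < size (g \Po 'X^M))%N.
    by rewrite size_poly_gt0 comp_poly_eq0 ?size_polyXn.
  by case: (size _) => // m _ /= ->.
have sf : (0 < size f)%N by rewrite size_poly_gt0.
have sg : (0 < size g)%N by rewrite size_poly_gt0.
have sh : size (f * (g \Po 'X^M)) = (size f + (size g).-1 * M)%N.
  by rewrite size_mul // -?size_poly_gt0 gM // addnS.
split.
  case/coef_setP => n; rewrite sh => hn E.
  have := divn_eq n M; have := ltn_pmod n M0; set i := (n %% M)%N => iM nE.
  case: (ltnP i (size f)) => hi; last first.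
    right; split; [|lia|].
      by rewrite -E coef_kron // nth_default ?mul0r.
    case: (size g) sg hn => [|[|m]] //= _; rewrite mul0n addn0 => hn.
    by move: hn; rewrite ltnNge (leq_trans hi (leq_mod n M)).
  left; exists f`_i, g`_(n %/ M); split; rewrite -?coef_kron //.
    by apply/coef_setP; exists i.
  apply/coef_setP; exists (n %/ M)%N => //; rewrite ltn_divLR //.
  case: (size g) sg hn => //= m _ hn; rewrite mulSn.
  by apply: leq_trans hn _; rewrite leq_add2r.
case=> [[u [v [/coef_setP[i hi <-] /coef_setP[j hj <-] ->]]]|[-> ltf ltg]]; apply/coef_setP.
  have iM := leq_trans hi hf.
  exists (j * M + i)%N.
    rewrite sh; have : (j * M <= (size g).-1 * M)%N by rewrite leq_mul2r; lia.
    lia.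
  by rewrite coef_kron // modnMDl divnMDl // modn_small // divn_small // addn0.
exists (size f).
  rewrite sh -[X in (X < _)%N]addn0 ltn_add2l muln_gt0 M0 andbT; lia.
by rewrite coef_kron // modn_small // nth_default ?mul0r.
Qed.

Lemma coef_set_neq0 (f : {poly int}) c : c \in coef_set f -> f != 0.
Proof. by case/coef_setP => n; rewrite -size_poly_gt0; case: size. Qed.

Lemma kron1 (f g : {poly int}) M c : (0 < M)%N -> (size f <= M)%N -> g != 0 ->
  coef_set f =i zset [:: 1] ->
  (c \in coef_set (f * (g \Po 'X^M))) =
  (c \in coef_set g) || [&& c == 0, size f < M & 1 < size g]%N.
Proof.
move=> M0 hf g0 Ef.
have f1 : 1 \in coef_set f by rewrite Ef inE.
have f0 := coef_set_neq0 f1.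
apply/idP/orP => [/kronP[]//|H].
- move=> [u [v [+ hv ->]]]; rewrite Ef !inE => /eqP->; left; by rewrite mul1r.
- by case=> -> -> ->; right; rewrite eqxx.
apply/kronP => //; case: H => [h|/and3P[/eqP-> -> ->]]; [left|by right].
by exists 1, c; rewrite mul1r.
Qed.

Lemma kron_pm (f g : {poly int}) M c : (0 < M)%N -> (size f <= M)%N -> g != 0 ->
  coef_set f =i zset [:: -1; 1] ->
  (c \in coef_set (f * (g \Po 'X^M))) =
  [|| c \in coef_set g, - c \in coef_set g | [&& c == 0, size f < M & 1 < size g]%N].
Proof.
move=> M0 hf g0 Ef.
have f1 : 1 \in coef_set f by rewrite Ef !inE.
have fN1 : -1 \in coef_set f by rewrite Ef !inE.
have f0 := coef_set_neq0 f1.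
apply/idP/or3P => [/kronP[]//|H].
- move=> [u [v [+ hv ->]]]; rewrite Ef !inE => /orP[]/eqP->.
    by apply: Or32; rewrite mulN1r opprK.
  by apply: Or31; rewrite mul1r.
- by case=> -> -> ->; apply: Or33; rewrite eqxx.
apply/kronP => //; case: H => [h|h|/and3P[/eqP-> -> ->]]; [left|left|by right].
  by exists 1, c; rewrite mul1r.
by exists (-1), (- c); rewrite mulN1r opprK.
Qed.

Lemma kron_pm0 (f g : {poly int}) M c : (0 < M)%N -> (size f <= M)%N -> g != 0 ->
  coef_set f =i zitv (-1) 1 ->
  (c \in coef_set (f * (g \Po 'X^M))) =
  [|| c \in coef_set g, - c \in coef_set g | c == 0].
Proof.
move=> M0 hf g0 Ef.
have f1 : 1 \in coef_set f by rewrite Ef !inE.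
have fN1 : -1 \in coef_set f by rewrite Ef !inE.
have f00 : 0 \in coef_set f by rewrite Ef !inE.
have f0 := coef_set_neq0 f1.
have gl : lead_coef g \in coef_set g.
  by apply/coef_setP; exists (size g).-1 => //; rewrite ltn_predL size_poly_gt0.
apply/idP/or3P => [/kronP[]//|H].
- move=> [u [v [+ hv ->]]]; rewrite Ef inE in_itv /= => hu.
  have : u = -1 \/ u = 0 \/ u = 1 by lia.
  case=> [|[]] ->; [apply: Or32 | apply: Or33 | apply: Or31].
  + by rewrite mulN1r opprK.
  + by rewrite mul0r.
  + by rewrite mul1r.
- by case=> -> _ _; apply: Or33; rewrite eqxx.
apply/kronP => //; case: H => [h|h|/eqP->]; left.
- by exists 1, c; rewrite mul1r.
- by exists (-1), (- c); rewrite mulN1r opprK.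
- by exists 0, (lead_coef g); rewrite mul0r.
Qed.

(** * The numerical semigroup generated by two coprime numbers *)

(** [rho] is the inverse of [M] modulo [B], and [sigma] that of [B] modulo [M]. In these ranges the
    two products always add up to MB + 1. *)
Definition bezout_pair (M B rho sigma : nat) :=
  [&& (0 < rho < B)%N, (0 < sigma < M)%N & (M * rho + B * sigma == M * B + 1)%N].

Section Semigroup.

Variables M B rho sigma : nat.
Hypothesis bez : bezout_pair M B rho sigma.

Let rho_bnd : (0 < rho < B)%N. Proof. by case/and3P: bez. Qed.
Let sigma_bnd : (0 < sigma < M)%N. Proof. by case/and3P: bez. Qed.
Let bezout : (M * rho + B * sigma = M * B + 1)%N.
Proof. by case/and3P: bez => _ _ /eqP. Qed.

(* z lies in the numerical semigroup generated by M and B: z * sigma %% M is the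
   least number of copies of B that leaves a multiple of M. *)
Definition sg (z : int) : bool := ((z * sigma%:Z) %% M%:Z)%Z * B%:Z <= z.

Let bezoutZ : B%:Z * sigma%:Z = 1 + M%:Z * (B%:Z - rho%:Z).
Proof. by rewrite mulrBr -!PoszM; lia. Qed.

(** Normal form: [sigma] inverts [B] modulo [M], so [k] is recovered from the residue of the
    argument, and membership is the sign of [h]. With [sg_rep], every question about the semigroup
    reduces to this. *)
Lemma sgE (k h : int) : 0 <= k < M%:Z -> sg (k * B%:Z + h * M%:Z) = (0 <= h).
Proof.
move=> hk; rewrite /sg.
have -> : (k * B%:Z + h * M%:Z) * sigma%:Z = (k * (B%:Z - rho%:Z) + h * sigma%:Z) * M%:Z + k.
  transitivity (k * (B%:Z * sigma%:Z) + h * M%:Z * sigma%:Z); [ring|rewrite bezoutZ; ring].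
rewrite modzMDl modz_small; last by lia.
by rewrite lerDl pmulr_lge0 //; lia.
Qed.

Lemma sg_rep (z : int) : exists k h : int, 0 <= k < M%:Z /\ z = k * B%:Z + h * M%:Z.
Proof.
pose k := ((z * sigma%:Z) %% M%:Z)%Z; pose t := ((z * sigma%:Z) %/ M%:Z)%Z.
exists k, (z * (rho%:Z - B%:Z) + t * B%:Z); split.
  by rewrite /k modz_ge0 ?ltz_pmod //; lia.
have E : z * sigma%:Z = t * M%:Z + k by exact: divz_eq.
have -> : k * B%:Z + (z * (rho%:Z - B%:Z) + t * B%:Z) * M%:Z =
  (t * M%:Z + k) * B%:Z - z * (M%:Z * (B%:Z - rho%:Z)) by ring.
rewrite -E; have -> : z * sigma%:Z * B%:Z = z * (B%:Z * sigma%:Z) by ring.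
by rewrite bezoutZ; ring.
Qed.

Lemma sg_neg (z : int) : z < 0 -> sg z = false.
Proof.
move=> z0; apply/negbTE; rewrite /sg -ltNge (lt_le_trans z0) // mulr_ge0 //.
by rewrite modz_ge0 //; lia.
Qed.

Lemma sg_lt_B (z : int) : 0 <= z < B%:Z -> sg z = (M%:Z %| z)%Z.
Proof.
have [k [h [hk ->]]] := sg_rep z; move=> hz; rewrite sgE //.
apply/idP/idP => [h0|/dvdzP[t E]].
  have -> : k = 0 by nia.
  by rewrite mul0r add0r dvdz_mull.
rewrite E in hz; have t0 : 0 <= t by nia.
have := sgE h hk; rewrite E -[t * _]add0r -(mul0r B%:Z) sgE ?t0 //; lia.
Qed.

Lemma sg_lt_M (z : int) : 0 <= z < M%:Z -> sg z = (B%:Z %| z)%Z.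
Proof.
have [k [h [hk ->]]] := sg_rep z; move=> hz; rewrite sgE //.
apply/idP/idP => [h0|/dvdzP[t E]].
  have -> : h = 0 by nia.
  by rewrite mul0r addr0 dvdz_mull.
rewrite E in hz; have t0 : 0 <= t < M%:Z by nia.
have := sgE h hk; rewrite E -[t * _]addr0 -(mul0r M%:Z) sgE //; lia.
Qed.

Lemma sg0 : sg 0.
Proof. by rewrite sg_lt_B //; lia. Qed.

Lemma sg_gt0_small (z : int) : 0 < z -> z < M%:Z -> z < B%:Z -> sg z = false.
Proof. move=> z0 zM zB; rewrite sg_lt_B; last by lia.
apply/negbTE/negP => /dvdzP[t E].
have [t0|t0] : 1 <= t \/ t <= 0 by lia.
  nia.
nia.
Qed.

Lemma sg_large (z : int) : (M%:Z - 1) * (B%:Z - 1) <= z -> sg z.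
Proof. by have [k [h [hk ->]]] := sg_rep z; rewrite sgE //; nia. Qed.

Lemma sg_frobenius : sg (M%:Z * B%:Z - M%:Z - B%:Z) = false.
Proof.
have -> : M%:Z * B%:Z - M%:Z - B%:Z = (M%:Z - 1) * B%:Z + (-1) * M%:Z by ring.
by rewrite sgE //; lia.
Qed.

(** In normal form, subtracting [M] lowers [h] by 1, so the two values differ only for h = 0, that
    is, at [k * B] with 0 <= k < M. This is the coefficientwise form of (1 - x^M) times the
    generating series of the semigroup. *)
Lemma sg_sub_M (z : int) : (sg z)%:Z - (sg (z - M%:Z))%:Z =
  (nat_of_bool ((B%:Z %| z)%Z && (0 <= z < M%:Z * B%:Z)))%:Z.
Proof.
have [k [h [hk ->]]] := sg_rep z.
have -> : k * B%:Z + h * M%:Z - M%:Z = k * B%:Z + (h - 1) * M%:Z by ring.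
rewrite !sgE //.
case: (eqVneq h 0) => [->|h0].
  have -> : k * B%:Z + 0 * M%:Z = k * B%:Z by ring.
  rewrite (_ : (B%:Z %| k * B%:Z)%Z); last exact: dvdz_mull.
  rewrite mulr_ge0 ?ltr_pM2r //; lia.
suff -> : ((B%:Z %| k * B%:Z + h * M%:Z)%Z && (0 <= k * B%:Z + h * M%:Z < M%:Z * B%:Z)) = false by lia.
apply/negbTE/negP => /andP[/dvdzP[t E] bd]; rewrite E in bd.
have tM : 0 <= t < M%:Z by nia.
have E1 := sgE h hk; have E2 := sgE (h-1) hk; have F1 := sgE 0 tM; have F2 := sgE (-1) tM.
have EE : k * B%:Z + (h - 1) * M%:Z = t * B%:Z + (-1) * M%:Z by rewrite -[in RHS]E; ring.
move: E1 E2 F1 F2; rewrite EE E mul0r addr0 => -> -> ; lia.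
Qed.

(* W is the polynomial (x^e - 1) (x^{MB} - 1) / ((x^M - 1) (x^B - 1)). *)
Lemma cz_sg_quotient (W : {poly int}) e :
  W * ('X^M - 1) * ('X^B - 1) = ('X^e - 1) * ('X^(M * B) - 1) ->
  forall z : int, cz W z = (sg z)%:Z - (sg (z - e%:Z))%:Z.
Proof.
move=> EW.
have E : ('X^M - 1) * W = ('X^e - 1) * (geo M \Po 'X^B).
  apply: (@mulfI _ ('X^B - 1)); first by rewrite Xn1_neq0 //; lia.
  rewrite [RHS]mulrCA mul_geo_comp -EW; ring.
apply: (@cz_uniq M) => [|z z0|z]; first by lia.
  by rewrite !sg_neg //; lia.
rewrite E czXn1M !cz_compXn; try by lia.
have key (w : int) : (if (B%:Z %| w)%Z then cz (geo M) (w %/ B%:Z)%Z else 0) =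
    (sg w)%:Z - (sg (w - M%:Z))%:Z.
  rewrite sg_sub_M; case: dvdzP => [[t ->]|//]; rewrite mulzK; last by lia.
  by rewrite cz_geo; have -> : (0 <= t < M%:Z) = (0 <= t * B%:Z < M%:Z * B%:Z) by nia.
by rewrite !key [z - M%:Z - e%:Z]addrAC; ring.
Qed.

End Semigroup.

Lemma exists_bezout M B : coprime M B -> (1 < M)%N -> (1 < B)%N ->
  exists rho sigma, bezout_pair M B rho sigma.
Proof.
move=> co M1 B1; case: (egcdnP B (ltnW M1)) => km kn E _.
rewrite (eqP co) in E.
pose r := (km %% B)%N.
have Er : (r * M = 1 %[mod B])%N by rewrite /r modnMml E modnMDl.
have rB : (r < B)%N by rewrite ltn_pmod // ltnW.
have r0 : (0 < r)%N.
  by rewrite lt0n; apply/eqP => r0; move: Er; rewrite r0 mul0n mod0n modn_small.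
have rM1 : (1 <= r * M)%N by nia.
move/eqP: Er; rewrite eqn_mod_dvd // => /dvdnP[t Et].
have tM : (t < M)%N by nia.
exists r, (M - t)%N; apply/and3P; split; [by rewrite r0| |apply/eqP; nia].
rewrite subn_gt0 tM ltn_subrL (ltnW M1) andbT; case: t Et {tM} => //; nia.
Qed.

(** * Cyclotomic polynomials *)

Lemma dvdn_prime_powM p q k d : prime p -> prime q -> p != q ->
  (d %| p ^ k * q)%N -> exists2 m, (m <= k)%N & d = (p ^ m)%N \/ d = (p ^ m * q)%N.
Proof.
move=> pp pq npq hd.
have [qd|nqd] := boolP (q %| d)%N.
  case/dvdnP: qd => e Ee; move: hd; rewrite Ee dvdn_pmul2r ?prime_gt0 //.
  by case/(dvdn_pfactor _ _ pp) => m lem ->; exists m => //; right.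
have co : coprime d q by rewrite coprime_sym prime_coprime.
by move: hd; rewrite Gauss_dvdl // => /(dvdn_pfactor _ _ pp)[m lem ->]; exists m => //; left.
Qed.

Lemma Phi1 : 'Phi_1 = 'X - 1.
Proof. by have := @prod_Cyclotomic 1 isT; rewrite big_seq1. Qed.

Lemma Phi_prime p : prime p -> 'Phi_p = geo p.
Proof.
move=> pp; apply: geoP; rewrite -prod_Cyclotomic ?prime_gt0 //.
have -> : divisors p = [:: 1; p]%N.
  apply: (irr_sorted_eq ltn_trans ltnn (sorted_divisors_ltn _)) => /=.
    by rewrite prime_gt1.
  move=> d; rewrite -dvdn_divisors ?prime_gt0 // !inE; apply/idP/orP.
    by case/primeP: pp => _ h /h/orP.
  by case=> /eqP->; rewrite ?dvd1n.
by rewrite big_cons big_seq1 Phi1.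
Qed.

Lemma Phi_pp p : prime p -> 'Phi_(p ^ 2) = geo p \Po 'X^p.
Proof.
move=> p_prime; have p1 := prime_gt1 p_prime.
apply: (@mulfI _ ('X^p - 1)); first by rewrite Xn1_neq0 //; lia.
rewrite mul_geo_comp mulnn -[in RHS]prod_Cyclotomic ?expn_gt0; last by rewrite ltnW.
have -> : divisors (p ^ 2) = [:: 1; p; p ^ 2]%N.
  apply: (irr_sorted_eq ltn_trans ltnn (sorted_divisors_ltn _)) => /=.
    by rewrite p1 -mulnn ltn_Pmull // ltnW.
  move=> d; rewrite -dvdn_divisors ?expn_gt0 ?prime_gt0 // !inE; apply/idP/or3P.
    case/(dvdn_pfactor _ _ p_prime) => -[|[|[|m]]] // _ ->; rewrite ?expn0 ?expn1 eqxx.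
    - exact: Or31.
    - exact: Or32.
    - exact: Or33.
  by case=> /eqP->; rewrite ?dvd1n // -{1}[p]expn1 dvdn_exp2l.
rewrite !big_cons big_nil mulr1 Phi1 mulrA; congr (_ * _).
by rewrite (Phi_prime p_prime) mul_geo.
Qed.

Section Cyclotomic.
Variables p q : nat.
Hypotheses (p_prime : prime p) (q_prime : prime q) (p_neq_q : p != q).

Let p1 : (1 < p)%N := prime_gt1 p_prime.
Let q1 : (1 < q)%N := prime_gt1 q_prime.

Lemma perm_divisors_p2q :
  perm_eq (divisors (p ^ 2 * q)) [:: 1; p; q; p * q; p ^ 2; p ^ 2 * q]%N.
Proof.
have p0 : (0 < p)%N by lia. have q0 : (0 < q)%N by lia.
apply: uniq_perm; first exact: divisors_uniq.
  have qpp : q != (p * p)%N.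
    by apply: contra p_neq_q => /eqP E; have := dvdnn q; rewrite {2}E Euclid_dvdM // orbb dvdn_prime2 // eq_sym.
  have pqpp : (p * q)%N != (p * p)%N by rewrite eqn_pmul2l // eq_sym.
  rewrite /= !inE !negb_or -!andbA -mulnn.
  by do !(apply/andP; split) => //; apply/eqP; nia.
move=> d; rewrite -dvdn_divisors; last by rewrite muln_gt0 expn_gt0 p0.
apply/idP/idP => [/dvdn_prime_powM[]// m lem [] ->|].
- by case: m lem => [|[|[|m]]] // _; rewrite ?expn1 !inE eqxx ?orbT.
- by case: m lem => [|[|[|m]]] // _; rewrite ?expn1 ?mul1n !inE eqxx ?orbT.
rewrite !inE => /orP[/eqP->|]; first by rewrite dvd1n.
case/orP=> [/eqP->|]; first by rewrite dvdn_mulr // -{1}[p]expn1 dvdn_exp2l.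
case/orP=> [/eqP->|]; first by rewrite dvdn_mull.
case/orP=> [/eqP->|]; first by rewrite dvdn_pmul2r // -{1}[p]expn1 dvdn_exp2l.
by case/orP=> /eqP->; rewrite // dvdn_mulr.
Qed.

Lemma Phi_pq : 'Phi_(p * q) * ('X^p - 1) * ('X^q - 1) = ('X - 1) * ('X^(p * q) - 1).
Proof.
rewrite -[in RHS]prod_Cyclotomic ?muln_gt0 ?prime_gt0 //.
have /(perm_big _) -> : perm_eq (divisors (p * q)) [:: 1; p; q; p * q]%N.
  have p0 : (0 < p)%N by lia. have q0 : (0 < q)%N by lia.
  apply: uniq_perm; first exact: divisors_uniq.
    rewrite /= !inE !negb_or -!andbA.
    by do !(apply/andP; split) => //; apply/eqP; nia.
  move=> d; rewrite -dvdn_divisors ?muln_gt0 ?p0 // !inE; apply/idP/idP.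
    rewrite -{1}[p]expn1 => /(dvdn_prime_powM p_prime q_prime p_neq_q)[[|[|m]]] // _ [] ->;
    by rewrite ?expn1 ?mul1n eqxx ?orbT.
  case/or4P=> /eqP->; rewrite ?dvd1n //; [exact: dvdn_mulr|exact: dvdn_mull].
rewrite /= !big_cons big_nil mulr1 Phi1 (Phi_prime p_prime) (Phi_prime q_prime).
rewrite -(mul_geo p) -(mul_geo q); ring.
Qed.

(** Multiplied by (x^(p^2) - 1)(x^(pq) - 1), both sides become (x^p - 1)(x^(p^2 q) - 1): the left
    one by the factorisation over divisors, the right one by substituting x^p in [Phi_pq]. *)
Lemma Phi_ppq : 'Phi_(p ^ 2 * q) = 'Phi_(p * q) \Po 'X^p.
Proof.
have E : 'Phi_(p ^ 2 * q) * ('X^(p ^ 2) - 1) * ('X^(p * q) - 1) = ('X^p - 1) * ('X^(p ^ 2 * q) - 1).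
  rewrite -(@prod_Cyclotomic (p ^ 2 * q)) ?muln_gt0 ?expn_gt0 ?prime_gt0 //.
  rewrite (perm_big _ perm_divisors_p2q) /= !big_cons big_nil mulr1 Phi1 (Phi_pp p_prime).
  rewrite (Phi_prime p_prime) (Phi_prime q_prime) -mulnn -(mul_geo_comp p p).
  have D : ('X - 1) * (geo p * (geo q * 'Phi_(p * q))) = 'X^(p * q) - 1.
    apply: (@mulfI _ ('X - 1)); first exact: X1_neq0.
    rewrite -Phi_pq -(mul_geo p) -(mul_geo q); ring.
  rewrite -D -(mul_geo p); ring.
have := congr1 (fun f => f \Po 'X^p) Phi_pq.
rewrite !comp_polyM !Xn1_comp X1_comp mulnn => F.
apply: (@mulIf _ (('X^(p ^ 2) - 1) * ('X^(p * q) - 1))).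
  by rewrite mulf_neq0 // Xn1_neq0 // ?expn_gt0 ?muln_gt0 ?prime_gt0.
rewrite [(q * p)%N]mulnC in F; rewrite !mulrA E F; congr (_ * ('X^_ - 1)).
by rewrite -mulnn mulnAC.
Qed.
End Cyclotomic.

(** Both [f] and the candidate product [h] divide x^n - 1, which is separable, so over [algC] they
    are products of distinct linear factors and it suffices to compare their roots. [P d] tests [f]
    at one representative primitive d-th root, [w d]. *)
Lemma Cyclotomic_divisor (n : nat) (f g : {poly int}) : (0 < n)%N -> f \is monic ->
  'X^n - 1 = g * f ->
  exists P : pred nat, f = \prod_(d <- divisors n | P d) 'Phi_d.
Proof.
move=> n0 fmon Efg.
have [z zP] := C_prim_root_exists n0.
pose w d := z ^+ (n %/ d).
have wP d : (d %| n)%N -> d.-primitive_root (w d) by move=> dn; apply: (dvdn_prim_root zP).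
pose toC : {poly int} -> {poly algC} := map_poly intr.
pose P d := root (toC f) (w d).
exists P; set h := \prod_(d <- _ | _) _.
have injC : injective toC by apply: map_inj_poly => //; exact: intr_inj.
have rootPhi d x : (d %| n)%N -> root (toC 'Phi_d) x = d.-primitive_root x.
  by move=> dn; rewrite /toC (Cintr_Cyclotomic (wP d dn)) root_cyclotomic // wP.
have sep_div u v : 'X^n - 1 = v * u -> u \is monic ->
    exists2 r, uniq r & toC u = \prod_(x <- r) ('X - x%:P).
  move=> E um; have [r Er] := closed_field_poly_normal (toC u).
  have lc : lead_coef (toC u) = 1.
    by rewrite lead_coef_map_inj ?(monicP um) ?rmorph1 //; exact: intr_inj.
  rewrite lc scale1r in Er; exists r => //.
  rewrite -separable_prod_XsubC -Er.
  have : separable_poly (toC ('X^n - 1)).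
    rewrite /toC rmorphB rmorph1 /= map_polyXn separable_Xn_sub_1 //.
    by rewrite pnatr_eq0 -lt0n.
  rewrite E /toC rmorphM /=; apply: dvdp_separable; exact: dvdp_mulIr.
have hmon : h \is monic by apply: monic_prod => d _; exact: Cyclotomic_monic.
have hdiv : 'X^n - 1 = (\prod_(d <- divisors n | ~~ P d) 'Phi_d) * h.
  by rewrite -prod_Cyclotomic // (bigID P) /= mulrC.
have [r ur Er] := sep_div f g Efg fmon.
have [r' ur' Er'] := sep_div h _ hdiv hmon.
have same : r =i r'.
  move=> x; rewrite -root_prod_XsubC -Er -[RHS]root_prod_XsubC -Er'.
  have xroot u v : 'X^n - 1 = v * u -> root (toC u) x -> exists2 d, (d %| n)%N & d.-primitive_root x.
    move=> E ux; have : root (toC ('X^n - 1)) x by rewrite E /toC rmorphM rootM ux orbT.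
    rewrite /toC rmorphB rmorph1 /= map_polyXn => xn.
    move: xn; rewrite /root !hornerE subr_eq0 => /eqP xn.
    by have [m mP mn] := prim_order_exists n0 xn; exists m.
  have conj d : (d %| n)%N -> d.-primitive_root x -> root (toC f) x = P d.
    move=> dn xP; rewrite /P.
    have e : toC f = map_poly ratr (map_poly intr f : {poly rat}).
      by rewrite -map_poly_comp; apply: eq_map_poly => c /=; rewrite ratr_int.
    have [px [Ex _] dx] := minCpolyP x; have [pw [Ew _] dw] := minCpolyP (w d).
    have exw : px = pw.
      have := minCpoly_cyclotomic xP; rewrite -(Cintr_Cyclotomic xP) (Cintr_Cyclotomic (wP _ dn)).
      rewrite -(minCpoly_cyclotomic (wP _ dn)) Ex Ew.
      exact: map_poly_inj.
    by rewrite e dx dw exw.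
  have hroot d : (d %| n)%N -> d.-primitive_root x -> root (toC h) x = P d.
    move=> dn xP; rewrite /h /toC rmorph_prod /=.
    rewrite -big_filter.
    have -> s : root (\prod_(e <- s) toC 'Phi_e) x = has (fun e => root (toC 'Phi_e) x) s.
      by elim: s => [|e s IH]; rewrite ?big_nil ?rootC ?oner_eq0 // big_cons rootM IH.
    apply/hasP/idP => [[e]|Pd]; last first.
      by exists d; rewrite ?mem_filter ?Pd -?dvdn_divisors // rootPhi.
    rewrite mem_filter -dvdn_divisors // => /andP[Pe en].
    rewrite rootPhi // => eP; suff -> : d = e by [].
    by apply/eqP; rewrite eqn_dvd (prim_order_dvd xP) (prim_expr_order eP) (prim_order_dvd eP) (prim_expr_order xP) !eqxx.
  apply/idP/idP => rx.
    have [d dn xP] := xroot _ _ Efg rx; by rewrite (hroot d) // -(conj d).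
  have [d dn xP] := xroot _ _ hdiv rx; by rewrite (conj d) // -(hroot d).
apply: injC; rewrite Er Er'; apply: perm_big; exact: uniq_perm.
Qed.

(** * Coefficient sets of standard products *)

Ltac expand_fdiv :=
  rewrite /fdiv; repeat match goal with |- context [bit ?k ?j] =>
    let b := eval vm_compute in (bit k j) in change (bit k j) with b end;
  rewrite ?expr0 ?expr1 ?mulr1 ?mul1r.

Lemma in_zset1 (c : int) : (c \in zset [:: 1]) = (c == 1).
Proof. by rewrite !inE. Qed.
Lemma in_zset2 (a b c : int) : (c \in zset [:: a; b]) = (c == a) || (c == b).
Proof. by rewrite !inE. Qed.
Lemma in_zset3 (a b d c : int) : (c \in zset [:: a; b; d]) = [|| c == a, c == b | c == d].
Proof. by rewrite !inE. Qed.
Lemma in_zset4 (a b d e c : int) : (c \in zset [:: a; b; d; e]) = [|| c == a, c == b, c == d | c == e].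
Proof. by rewrite !inE. Qed.
Lemma in_zitv (a b c : int) : (c \in zitv a b) = (a <= c <= b).
Proof. by rewrite /zitv_neq0 /zitv !inE /= ?in_itv. Qed.
Lemma in_zitv_neq0 (a b c : int) : (c \in zitv_neq0 a b) = (c != 0) && (a <= c <= b).
Proof. by rewrite /zitv_neq0 /zitv !inE /= ?in_itv. Qed.
Definition in_zs := (in_zset1, in_zset2, in_zset3, in_zset4, in_zitv, in_zitv_neq0).

Lemma coef_set_1 : coef_set 1 =i zset [:: 1].
Proof. by move=> c; rewrite inE polyseq1 !inE. Qed.

Lemma coef_set_geo l : (0 < l)%N -> coef_set (geo l) =i zset [:: 1].
Proof.
move=> l0 c; rewrite in_zs; apply/idP/eqP => [|->].
  case/coef_setP => n; rewrite size_geo coef_poly => ->; by move=> <-.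
by apply: (mem_coef_set 0) => //; rewrite cz_geo; lia.
Qed.

Lemma coef_set_X1 : coef_set ('X - 1) =i zset [:: -1; 1].
Proof. by move=> c; rewrite inE polyseqXsubC !inE. Qed.

Lemma cz_Xn1 n (z : int) : (0 < n)%N ->
  cz ('X^n - 1) z = (nat_of_bool (z == n%:Z))%:Z - (nat_of_bool (z == 0))%:Z.
Proof.
move=> n0; rewrite czB; case: z => m /=; last by lia.
rewrite coefXn coef1; lia.
Qed.

Lemma coef_set_Xn1 n : (1 < n)%N -> coef_set ('X^n - 1) =i zitv (-1) 1.
Proof.
move=> n1 c; have n0 := ltnW n1; rewrite in_zs; apply/idP/idP => [|hc].
  by case/coef_set_cz => z _ <-; rewrite cz_Xn1 //; lia.
have : c = 0 \/ c = 1 \/ c = -1 by lia.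
case=> [->|[->|->]].
- by apply: (mem0_coef_set 1 n); rewrite ?cz_Xn1 //; lia.
- by apply: (mem_coef_set n) => //; rewrite cz_Xn1 //; lia.
- by apply: (mem_coef_set 0) => //; rewrite cz_Xn1 //; lia.
Qed.

(** A trapezoid: slope 1 up to the plateau min(a, b), then slope -1 down to 0. *)
Lemma cz_mul_geo a b (z : int) : (0 < a)%N -> (0 < b)%N ->
  cz (geo a * geo b) z =
  Num.max 0 (Num.min (Num.min (z + 1) a%:Z) (Num.min b%:Z (a%:Z + b%:Z - 1 - z))).
Proof.
move=> a0 b0; move: z; apply: (@cz_uniq 1) => // [z z0|z]; first by lia.
rewrite expr1 mulrA mul_geo czXn1M !cz_geo; lia.
Qed.

Lemma coef_set_mul_geo a b : (0 < a)%N -> (0 < b)%N ->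
  coef_set (geo a * geo b) =i zitv 1 (minn a b)%:Z.
Proof.
move=> a0 b0 c; rewrite in_zs; apply/idP/idP => [|hc].
  case/(@coef_set_cz_lt _ _ (a + b - 1)%N%:Z) => [z hz|z hz <-]; rewrite cz_mul_geo //; lia.
apply: (mem_coef_set (c - 1)); last by lia.
rewrite cz_mul_geo //; lia.
Qed.

Lemma coef_set_Xn1_geo a b : (1 < a)%N -> (1 < b)%N -> a != b ->
  coef_set (('X^a - 1) * geo b) =i zitv (-1) 1.
Proof.
move=> a1 b1 ab c; rewrite in_zs; apply/idP/idP => [|hc].
  by case/coef_set_cz => z _ <-; rewrite czXn1M !cz_geo; lia.
have : c = 0 \/ c = 1 \/ c = -1 by lia.
case=> [->|[->|->]].
(* For b < a this index lies in the gap between the two copies of the geometric sum; for a < b it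
   lies in their overlap, where they cancel. *)
- by apply: (mem0_coef_set (minn a b) (a + b - 1)%N); rewrite ?czXn1M ?cz_geo //; lia.
- by apply: (mem_coef_set (a + b - 1)%N) => //; rewrite czXn1M !cz_geo; lia.
- by apply: (mem_coef_set 0) => //; rewrite czXn1M !cz_geo; lia.
Qed.

(** The two copies of [g], with opposite signs, occupy different residue classes modulo [p], because
    [p] does not divide [q], and so never interact. The coefficient at index 1 is always 0. *)
Lemma coef_set_Xn1_comp (g : {poly int}) p q c : (1 < p)%N -> (1 < q)%N -> ~~ (p %| q)%N -> g != 0 ->
  (c \in coef_set (('X^q - 1) * (g \Po 'X^p))) =
  [|| c \in coef_set g, - c \in coef_set g | c == 0].
Proof.
move=> p1 q1 npq g0; have p0 := ltnW p1.
pose L (z : int) := if (p%:Z %| z)%Z then cz g (z %/ p%:Z)%Z else 0.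
have E z : cz (('X^q - 1) * (g \Po 'X^p)) z = L (z - q%:Z) - L z.
  by rewrite czXn1M !cz_compXn.
have L1 (z : int) : ~~ (p%:Z %| z)%Z -> L z = 0 by rewrite /L => /negPf->.
have dvdD (z : int) : (p%:Z %| z)%Z -> ~~ (p%:Z %| z - q%:Z)%Z /\ ~~ (p%:Z %| z + q%:Z)%Z.
  by move=> h; rewrite rpredBl // rpredDl.
have pos (z : int) : cz g z != 0 ->
    cz (('X^q - 1) * (g \Po 'X^p)) (z * p%:Z + q%:Z) = cz g z.
  move=> _; rewrite E addrK [L (_ + q%:Z)]L1 ?subr0; last by case: (dvdD (z * p%:Z)); rewrite ?dvdz_mull.
  by rewrite /L dvdz_mull // mulzK //; lia.
have neg (z : int) : cz (('X^q - 1) * (g \Po 'X^p)) (z * p%:Z) = - cz g z.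
  rewrite E [L (_ - q%:Z)]L1 ?sub0r; last by case: (dvdD (z * p%:Z)); rewrite ?dvdz_mull.
  by rewrite /L dvdz_mull // mulzK //; lia.
have [n gn] : exists n : int, cz g n != 0.
  by exists (size g).-1%:Z; rewrite /= -/(lead_coef g) lead_coef_eq0.
have n0 : 0 <= n by rewrite leNgt; apply: contra gn => /cz_neg->.
have zero : 0 \in coef_set (('X^q - 1) * (g \Po 'X^p)).
  apply: (@mem0_coef_set _ 1 (n * p%:Z + q%:Z)).
  - rewrite E /L; rewrite (_ : (p%:Z %| 1)%Z = false) ?subr0; last by rewrite dvdz1; lia.
    case: ifP => // /dvdzP[t Et]; rewrite Et mulzK; last by lia.
    by rewrite cz_neg //; nia.
  - by have := mulr_ge0 n0 (ler0n int p); lia.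
  - by rewrite pos.
case: (eqVneq c 0) => [->|c0]; first by rewrite zero !orbT.
rewrite orbF; apply/idP/orP => [|[]/coef_set_cz[z _ Ez]].
- case/coef_set_cz => z _; rewrite E /L.
  case: (boolP (p%:Z %| z)%Z) => [h|h].
    have [/negPf-> _] := dvdD _ h; rewrite sub0r => Ec; right.
    apply: (mem_coef_set (z %/ p%:Z)%Z); last by rewrite oppr_eq0.
    by rewrite -Ec opprK.
  case: ifP => _; rewrite subr0 => Ec; last by rewrite -Ec eqxx in c0.
  by left; exact: mem_coef_set Ec c0.
- by apply: (mem_coef_set (z * p%:Z + q%:Z)) => //; rewrite pos // Ez.
- by apply: (mem_coef_set (z * p%:Z)) => //; rewrite neg Ez opprK.
Qed.

(** * The quotient for e = 1 and its product with x - 1 *)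

Section SgQuotient.
Variables M B rho sigma : nat.
Hypothesis bez : bezout_pair M B rho sigma.
Let M1 : (1 < M)%N. Proof. by case/and3P: bez => *; lia. Qed.
Let B1 : (1 < B)%N. Proof. by case/and3P: bez => *; lia. Qed.
Local Notation s := (sg M B sigma).

Lemma sg_mulM (h : int) : s (h * M%:Z) = (0 <= h).
Proof. by have := @sgE _ _ _ _ bez 0 h; rewrite mul0r add0r => -> //; lia. Qed.

Lemma sg_addM (w h : int) : s w -> 0 <= h -> s (w + h * M%:Z).
Proof.
have [k [l [hk ->]]] := sg_rep bez w; rewrite (sgE bez) // => l0 h0.
by rewrite -addrA -mulrDl (sgE bez) // addr_ge0.
Qed.

Lemma sg_addB (w h : int) : s w -> 0 <= h -> s (w + h * B%:Z).
Proof.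
have [k [l [hk ->]]] := sg_rep bez w; rewrite (sgE bez) // => l0 h0.
have Ekh := divz_eq (k + h) M%:Z.
have -> : k * B%:Z + l * M%:Z + h * B%:Z = (k + h) * B%:Z + l * M%:Z by ring.
rewrite Ekh.
have -> : (((k + h) %/ M%:Z)%Z * M%:Z + ((k + h) %% M%:Z)%Z) * B%:Z + l * M%:Z =
  ((k + h) %% M%:Z)%Z * B%:Z + (l + ((k + h) %/ M%:Z)%Z * B%:Z) * M%:Z by ring.
rewrite (sgE bez); last by rewrite modz_ge0 ?ltz_pmod //; lia.
by rewrite addr_ge0 // mulr_ge0 // divz_ge0; lia.
Qed.

Lemma sg_mulB (h : int) : 0 <= h -> s (h * B%:Z).
Proof. by move=> h0; rewrite -[h * _]add0r sg_addB // (sg0 bez). Qed.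

(** Three consecutive elements meet every residue class modulo a generator that is at most 3, so
    everything from [w] on is in the semigroup; the Frobenius number must then be below [w]. *)
Lemma sg_frobenius_lt (w : int) : s w -> s (w + 1) -> s (w + 2) -> (minn M B <= 3)%N ->
  (M%:Z - 1) * (B%:Z - 1) <= w.
Proof.
move=> s0 s1 s2 min3; rewrite leNgt; apply/negP => lt.
suff : s (M%:Z * B%:Z - M%:Z - B%:Z) by rewrite (sg_frobenius bez).
set F := M%:Z * B%:Z - M%:Z - B%:Z; have ltF : w <= F by rewrite /F; lia.
have [d [d2 d3 dclosed]] : exists d : int, [/\ 2 <= d, d <= 3 & forall u h, s u -> 0 <= h -> s (u + h * d)].
  have [le|le] : (M <= 3)%N \/ (B <= 3)%N by lia.
    by exists M%:Z; split; [lia|lia|exact: sg_addM].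
  by exists B%:Z; split; [lia|lia|exact: sg_addB].
have Ediv := divz_eq (F - w) d; have m0 := modz_ge0 (F - w) (_ : d != 0); have m1 := @ltz_pmod (F - w) d.
have q0 : 0 <= ((F - w) %/ d)%Z by rewrite divz_ge0; lia.
have -> : F = w + ((F - w) %% d)%Z + ((F - w) %/ d)%Z * d.
  by rewrite -addrA [_ + (_ * d)]addrC -Ediv; ring.
apply: dclosed => //.
have : ((F - w) %% d)%Z = 0 \/ ((F - w) %% d)%Z = 1 \/ ((F - w) %% d)%Z = 2.
  move: m0 m1; lia.
by case=> [->|[->|->]]; rewrite ?addr0.
Qed.

(** One of three consecutive integers is a multiple of a generator d <= 3 (d = 2 or 3). The
    coefficient 2 s(z - 1) - s(z - 2) - s(z) vanishes only if three consecutive values of [s] agree;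
    this lemma excludes three zeros, and [sg_frobenius_lt] three ones below the degree. *)
Lemma sg_three (w : int) : 0 <= w -> (minn M B <= 3)%N -> [|| s w, s (w + 1) | s (w + 2)].
Proof.
move=> w0 min3.
have [d [d2 d3 dmul]] : exists d : int, [/\ 2 <= d, d <= 3 & forall h, 0 <= h -> s (h * d)].
  have [le|le] : (M <= 3)%N \/ (B <= 3)%N by lia.
    by exists M%:Z; split; [lia|lia|move=> h; rewrite sg_mulM].
  by exists B%:Z; split; [lia|lia|exact: sg_mulB].
have Ediv := divz_eq (w + 2) d; have m0 := modz_ge0 (w + 2) (_ : d != 0); have m1 := @ltz_pmod (w + 2) d.
have q0 : 0 <= ((w + 2) %/ d)%Z by rewrite divz_ge0; lia.
have := dmul _ q0; have -> : ((w + 2) %/ d)%Z * d = w + 2 - ((w + 2) %% d)%Z.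
  by apply/eqP; rewrite eq_sym subr_eq; apply/eqP.
have : ((w + 2) %% d)%Z = 0 \/ ((w + 2) %% d)%Z = 1 \/ ((w + 2) %% d)%Z = 2.
  move: m0 m1; lia.
case=> [->|[->|->]].
- by rewrite subr0 => ->; rewrite !orbT.
- by rewrite (_ : w + 2 - 1 = w + 1); [move=> ->; rewrite !orbT | ring].
- by rewrite addrK => ->.
Qed.

(* Multiplication by B turns the indices 0, ..., M - 1 of the residue classes
   into the classes themselves; x lies in class i and x + d - 1 in class
   i + delta - sigma, and x is the least element of its class for which both are
   in the semigroup. *)
Lemma sg_start_end (d : int) : 0 < d < B%:Z -> ~~ (M%:Z %| d)%Z ->
  exists2 x : int, 0 <= x & [/\ s x, ~~ s (x - 1), s (x + d - 1) & ~~ s (x + d)].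
Proof.
move=> hd ndvd; have [rhoB [sM E]] : (0 < rho < B)%N /\ (0 < sigma < M)%N /\ (M * rho + B * sigma = M * B + 1)%N.
  by case/and3P: bez => ? ? /eqP.
pose l : int := B%:Z - rho%:Z.
have El : sigma%:Z * B%:Z = 1 + M%:Z * l by rewrite /l mulrBr -!PoszM; lia.
pose delta := ((d * sigma%:Z) %% M%:Z)%Z; pose t := ((d * sigma%:Z) %/ M%:Z)%Z.
have Ed : d * sigma%:Z = t * M%:Z + delta by exact: divz_eq.
pose k : int := d * l - t * B%:Z.
have Ek : delta * B%:Z = d + M%:Z * k.
  have -> : delta * B%:Z = d * (sigma%:Z * B%:Z) - t * M%:Z * B%:Z by rewrite mulrA Ed; ring.
  by rewrite El /k; ring.
have delta_bnd : 0 < delta < M%:Z.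
  have d1 : delta < M%:Z by rewrite ltz_pmod //; lia.
  have d0 : 0 <= delta by rewrite modz_ge0 //; lia.
  rewrite d1 andbT lt_def d0 andbT; apply: contra ndvd => /eqP d00.
  by apply/dvdzP; exists (- k); rewrite d00 mul0r in Ek; lia.
have l0 : 0 < l < B%:Z by rewrite /l; lia.
have Mk : M%:Z * k = delta * B%:Z - d by rewrite Ek; ring.
have dB1 : B%:Z <= delta * B%:Z by rewrite ler_peMl //; lia.
have dB2 : delta * B%:Z <= M%:Z * B%:Z by rewrite ler_wpM2r //; lia.
have M_gt0 : 0 < M%:Z by lia.
have k0 : 0 < k by rewrite -(pmulr_rgt0 k M_gt0) Mk; lia.
have kB : k < B%:Z by rewrite -(ltr_pM2l M_gt0) Mk; lia.
(* The bounds [i < sigma], [i + delta < M] and [sigma <= i + delta] decide which of the four class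
   indices wrap around modulo [M]. The four membership conditions then read max(0, k - l) <= h <
   min(k, B - l), and [h] is the least solution. *)
pose i : int := Num.min (M%:Z - 1 - delta) (sigma%:Z - 1); pose h : int := Num.max 0 (k - l).
have [hi1 [hi2 [hi3 hi4]]] : 0 <= i /\ i < sigma%:Z /\ 0 <= i + delta - sigma%:Z /\ i + delta < M%:Z.
  by rewrite /i; lia.
have ex : s (i * B%:Z + h * M%:Z) by rewrite (sgE bez) /h; lia.
exists (i * B%:Z + h * M%:Z).
  by rewrite leNgt; apply/negP => /(sg_neg bez); rewrite ex.
split=> //.
- have -> : i * B%:Z + h * M%:Z - 1 = (i - sigma%:Z + M%:Z) * B%:Z + (h + l - B%:Z) * M%:Z.
    have -> : (i - sigma%:Z + M%:Z) * B%:Z = i * B%:Z - sigma%:Z * B%:Z + M%:Z * B%:Z by ring.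
    by rewrite El; ring.
  by rewrite (sgE bez) /h; lia.
- have -> : i * B%:Z + h * M%:Z + d - 1 = (i + delta - sigma%:Z) * B%:Z + (h - k + l) * M%:Z.
    have -> : (i + delta - sigma%:Z) * B%:Z = i * B%:Z + delta * B%:Z - sigma%:Z * B%:Z by ring.
    by rewrite El Ek; ring.
  by rewrite (sgE bez) /h; lia.
have -> : i * B%:Z + h * M%:Z + d = (i + delta) * B%:Z + (h - k) * M%:Z.
  by rewrite mulrDl Ek; ring.
by rewrite (sgE bez) /h; lia.
Qed.

Variable Q : {poly int}.
Hypothesis QE : Q * ('X^M - 1) * ('X^B - 1) = ('X - 1) * ('X^(M * B) - 1).

Lemma cz_binary (z : int) : cz Q z = (s z)%:Z - (s (z - 1))%:Z.
Proof. by rewrite (@cz_sg_quotient _ _ _ _ bez Q 1) // expr1. Qed.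

Let top : (M%:Z - 1) * (B%:Z - 1) - 1 = M%:Z * B%:Z - M%:Z - B%:Z. Proof. by ring. Qed.

Let cz_top : cz Q ((M%:Z - 1) * (B%:Z - 1)) = 1.
Proof. by rewrite cz_binary top (sg_frobenius bez) (sg_large bez). Qed.

Lemma coef_set_binary :
  coef_set Q =i (if minn M B == 2 then zset [:: -1; 1] else zitv (-1) 1).
Proof.
move=> c.
have s0 := sg0 bez.
have one : 1 \in coef_set Q by apply: (mem_coef_set 0) => //; rewrite cz_binary s0 (sg_neg bez).
have mone : -1 \in coef_set Q.
  by apply: (mem_coef_set 1) => //; rewrite cz_binary subrr s0 (sg_gt0_small bez) //; lia.
have bnd : c \in coef_set Q -> -1 <= c <= 1.
  by case/coef_set_cz => z _ <-; rewrite cz_binary; lia.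
case: ifP => min2; rewrite in_zs; last first.
  apply/idP/idP => // hc.
  have : c = 0 \/ c = 1 \/ c = -1 by lia.
  case=> [->|[->|->]] //.
  apply: (mem0_coef_set 2 ((M%:Z - 1) * (B%:Z - 1))); rewrite ?cz_top //; last by nia.
  by rewrite cz_binary !(sg_gt0_small bez) //; lia.
apply/idP/orP => [hc|[]/eqP->//].
suff : c != 0 by have := bnd hc; lia.
move: hc; case/(@coef_set_cz_lt _ _ ((M%:Z - 1) * (B%:Z - 1) + 1)) => [z hz|z hz <-].
  by rewrite cz_binary !(sg_large bez) //; lia.
rewrite cz_binary.
case: (eqVneq z 0) => [->|z0]; first by rewrite s0 (sg_neg bez).
(* With one generator equal to 2, membership below the other is parity, and all remaining indices
   are below it. Hence consecutive values of [s] differ. *)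
have [E2|E2] : M = 2 \/ B = 2 by lia.
  rewrite !(sg_lt_B bez); rewrite ?E2 /= in hz *; lia.
rewrite !(sg_lt_M bez); rewrite ?E2 /= in hz *; lia.
Qed.

Lemma coef_set_X1_binary :
  coef_set (('X - 1) * Q) =i (if (minn M B <= 3)%N then zset [:: -2; -1; 1; 2] else zitv (-2) 2).
Proof.
move=> c.
have E z : cz (('X - 1) * Q) z = (s (z - 1))%:Z - (s (z - 2))%:Z - (s z)%:Z + (s (z - 1))%:Z.
  rewrite czX1M !cz_binary; have -> : z - 1 - 1 = z - 2 by ring. lia.
have s0 := sg0 bez.
have sym c' : c' \in coef_set (('X - 1) * Q) -> - c' \in coef_set (('X - 1) * Q).
  apply: (@coef_set_opp [:: M; B] [:: 1; 1; M * B]%N); rewrite //= ?(ltnW M1) ?(ltnW B1) //.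
  by rewrite !big_cons big_nil !mulr1 expr1 -QE; ring.
have mone : -1 \in coef_set (('X - 1) * Q).
  by apply: (mem_coef_set 0) => //; rewrite E s0 !(sg_neg bez).
have two : 2 \in coef_set (('X - 1) * Q).
  apply: (mem_coef_set 1) => //; rewrite E subrr s0 (sg_neg bez) // (sg_gt0_small bez) //; lia.
have bnd : c \in coef_set (('X - 1) * Q) -> -2 <= c <= 2.
  by case/coef_set_cz => z _ <-; rewrite E; lia.
have one := sym _ mone; have mtwo := sym _ two; rewrite opprK in one.
case: ifP => min3; rewrite in_zs; last first.
  apply/idP/idP => // hc.
  have : c = 0 \/ c = 1 \/ c = -1 \/ c = 2 \/ c = -2 by lia.
  case=> [->|[->|[->|[->|->]]]] //.
  apply: (@mem0_coef_set _ 3 ((M%:Z - 1) * (B%:Z - 1) + 1)).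
  - by rewrite E !(sg_gt0_small bez) //; lia.
  - by nia.
  - by rewrite czX1M addrK cz_top cz_binary !(sg_large bez) //; lia.
apply/idP/or4P => [hc|[]/eqP->//].
suff : c != 0 by have := bnd hc; move=> h1 h2; apply/or4P; lia.
move: hc; case/(@coef_set_cz_lt _ _ ((M%:Z - 1) * (B%:Z - 1) + 2)) => [z hz|z hz <-].
  by rewrite E !(sg_large bez) //; lia.
rewrite E.
case: (eqVneq z 0) => [->|z0]; first by rewrite s0 !(sg_neg bez).
case: (eqVneq z 1) => [->|z1].
  by rewrite subrr s0 (sg_neg bez (_ : 1 - 2 < 0)) // (sg_gt0_small bez) //; lia.
have h1 := @sg_three (z - 2); have h2 := @sg_frobenius_lt (z - 2).
have e1 : z - 2 + 1 = z - 1 by ring.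
have e2 : z - 2 + 2 = z by ring.
rewrite e1 e2 in h1 h2.
case: (s z) h1 h2; case: (s (z - 1)); case: (s (z - 2)) => //= h1 h2.
  have := h2 isT isT isT min3; lia.
have := h1 _ min3; lia.
Qed.

End SgQuotient.

(** * Auxiliary products, integer quotients and sign bounds *)

Lemma geo_mul_comp a b : geo a * (geo b \Po 'X^a) = geo (b * a).
Proof. by apply: geoP; rewrite mulrA mul_geo mul_geo_comp. Qed.

Lemma comp_compXn (f : {poly int}) a b : (f \Po 'X^a) \Po 'X^b = f \Po 'X^(a * b).
Proof. by rewrite -comp_polyA comp_Xn_poly mulnC exprM. Qed.

Lemma geo_neq0 l : (0 < l)%N -> geo l != 0.
Proof. by move=> l0; rewrite -size_poly_gt0 size_geo. Qed.

Lemma kron_geo (f : {poly int}) l M c : (0 < M)%N -> (size f <= M)%N -> f != 0 -> (0 < l)%N ->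
  (c \in coef_set (f * (geo l \Po 'X^M))) =
  (c \in coef_set f) || [&& c == 0, size f < M & 1 < l]%N.
Proof.
move=> M0 hf f0 l0.
apply/idP/orP => [/kronP[]//|H]; rewrite ?geo_neq0 //.
- move=> [u [v [hu + ->]]]; rewrite coef_set_geo // in_zset1 => /eqP->.
  by left; rewrite mulr1.
- by case=> -> ->; rewrite size_geo => ->; right; rewrite eqxx.
apply/kronP; rewrite ?geo_neq0 //; case: H => [h|/and3P[/eqP-> hM hl]]; [left|right].
  by exists c, 1; rewrite mulr1 coef_set_geo // in_zset1.
by rewrite size_geo.
Qed.

Lemma size_X1 : size ('X - 1 : {poly int}) = 2.
Proof. by rewrite -polyC1 size_XsubC. Qed.

Lemma size_mul_geo a b : (0 < a)%N -> (0 < b)%N -> size (geo a * geo b) = (a + b).-1.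
Proof. by move=> a0 b0; rewrite size_mul ?geo_neq0 // !size_geo. Qed.

Lemma size_Xn1_geo a b : (0 < a)%N -> (0 < b)%N -> size (('X^a - 1) * geo b) = (a + b)%N.
Proof. by move=> a0 b0; rewrite size_mul ?geo_neq0 ?Xn1_neq0 // size_XnsubC // size_geo. Qed.

(** [t] is the semigroup generated by 2 and the odd number [P]; for P = p^2 the expression is a
    coefficient of f_43 in the case q = 2. For even z it equals [P < z] - [p < z] - 1, which is
    negative; for odd z it equals 1 - [P <= z] + [p <= z], which is positive. *)
Lemma second_difference_parity (P p z : int) : ~~ (2 %| P)%Z -> ~~ (2 %| p)%Z -> 0 < p -> p < P ->
  let t z := (0 <= z) && ((2 %| z)%Z || (P <= z)) in
  0 <= z < P + p ->
  (t (z - 1) : nat)%:Z - (t (z - 1 - p) : nat)%:Z - (t z : nat)%:Z + (t (z - p) : nat)%:Z != 0 :> int.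
Proof.
move=> P2 p2 p0 ltp t hz; rewrite /t.
have -> : (2 %| z - 1)%Z = ~~ (2 %| z)%Z by lia.
have -> : (2 %| z - p)%Z = ~~ (2 %| z)%Z by lia.
have -> : (2 %| z - 1 - p)%Z = (2 %| z)%Z by lia.
have -> : (P <= z - p) = false by lia.
have -> : (P <= z - 1 - p) = false by lia.
have -> : (0 <= z) = true by lia.
case: (boolP (2 %| z)%Z) => z2; rewrite ?andbT ?orbT ?orbF ?andbF /=.
- have -> : (0 <= z - 1) && (P <= z - 1) = (P < z) by lia.
  have -> : (0 <= z - 1 - p) = (p < z) by lia.
  have zp : z != p by apply: contra p2 => /eqP <-.
  have zP : z != P by apply: contra P2 => /eqP <-.
  clear t; lia.
have -> : (0 <= z - 1) = true by lia.
clear t; lia.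
Qed.
Lemma between2 (c : int) : -2 <= c <= 2 -> c != 0 -> [|| c == -2, c == -1, c == 1 | c == 2].
Proof. lia. Qed.
Lemma bounded1P (c : int) : -1 <= c <= 1 -> c = 0 \/ c = 1 \/ c = -1.
Proof. lia. Qed.

Lemma bounded2P (c : int) : -2 <= c <= 2 -> c = 0 \/ c = 1 \/ c = -1 \/ c = 2 \/ c = -2.
Proof. lia. Qed.

Lemma divz_unique (M z m : int) : 0 < M -> m * M <= z < m * M + M -> (z %/ M)%Z = m.
Proof.
move=> M0 hz; rewrite -[z](subrK (m * M)) addrC divzMDl ?gt_eqF // divz_small ?addr0 //.
by lia.
Qed.

Lemma divz_subn (M n : nat) (z : int) : (0 < M)%N ->
  ((z - n%:Z) %/ M%:Z)%Z =
  (z %/ M%:Z)%Z - (n %/ M)%N%:Z - (nat_of_bool ((z %% M%:Z)%Z < (n %% M)%N%:Z))%:Z.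
Proof.
move=> M0; have Ez := divz_eq z M%:Z; have e0 : 0 <= (z %% M%:Z)%Z by rewrite modz_ge0 //; lia.
have e1 : (z %% M%:Z)%Z < M%:Z by rewrite ltz_pmod //; lia.
have En : n%:Z = (n %/ M)%N%:Z * M%:Z + (n %% M)%N%:Z by rewrite -PoszM -PoszD -divn_eq.
have r1 : (n %% M)%N%:Z < M%:Z by rewrite ltz_nat ltn_pmod.
apply: divz_unique; first by lia.
move: (z %/ M%:Z)%Z (z %% M%:Z)%Z Ez e0 e1 => m e -> e0 e1.
move: (n %/ M)%N (n %% M)%N En r1 => c r -> r1.
by case: ltP => h; rewrite !mulrBl ?mul1r ?mul0r; lia.
Qed.

(** The coefficient sums [g] over the m with z - l < mM <= z. As [S] is the summatory function of
    [g], this telescopes to a difference at the two floors. *)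
Lemma cz_geo_mul_comp (g : {poly int}) (S : int -> int) l M : (0 < M)%N ->
  (forall m : int, m < 0 -> S m = 0) -> (forall m, cz g m = S m - S (m - 1)) ->
  forall z : int, cz (geo l * (g \Po 'X^M)) z = S (z %/ M%:Z)%Z - S ((z - l%:Z) %/ M%:Z)%Z.
Proof.
move=> M0 Sneg gS; have M0' : 0 < M%:Z by lia.
have key (z : int) : cz (g \Po 'X^M) z = S (z %/ M%:Z)%Z - S ((z - 1) %/ M%:Z)%Z.
  rewrite cz_compXn // [((z - 1) %/ _)%Z](divz_subn 1) //.
  case: ifP => [/dvdzP[t ->]|ndv].
    rewrite mulzK ?gt_eqF // gS modzMl; congr (_ - S _).
    have [M1|M1] : (M = 1)%N \/ (1 < M)%N by lia.
      by rewrite M1 divn1 modn1; lia.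
    by rewrite divn_small // modn_small //=; lia.
  have M1 : (1 < M)%N by case: (M) M0 ndv => [|[|M']] //; rewrite dvd1z.
  have e0 : 0 < (z %% M%:Z)%Z.
    rewrite lt_def modz_ge0 ?andbT; last by lia.
    by apply: contraFneq ndv => h; apply/dvdz_mod0P.
  by rewrite divn_small // modn_small // (_ : (_ < 1%:Z) = false) ?subr0 ?subrr //; lia.
apply: (@cz_uniq 1) => // [z z0|z].
  have neg (w : int) : w < 0 -> (w %/ M%:Z)%Z < 0 by move=> w0; rewrite ltz_divLR // mul0r.
  by rewrite !Sneg ?subrr // neg //; lia.
rewrite expr1 mulrA mul_geo czXn1M !key.
rewrite (_ : z - 1%:Z - l%:Z = z - l%:Z - 1); last by ring.
ring.
Qed.

Lemma geo_add a b : geo (a + b) = geo a + 'X^a * geo b.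
Proof.
apply/esym/geoP; rewrite mulrDr mul_geo mulrCA mul_geo exprD; ring.
Qed.

Lemma cz_geo_mul_bound (f : {poly int}) (lo hi : int) l :
  (forall z : int, lo <= cz f z <= hi) ->
  forall z : int, l%:Z * lo <= cz (geo l * f) z <= l%:Z * hi.
Proof.
move=> bnd z; elim: l => [|l /andP[IH1 IH2]].
  by rewrite /geo poly_def big_ord0 mul0r !mul0r; case: (z) => n; rewrite /= ?coef0.
rewrite -addn1 geo_add mulrDl czD -mulrA czXnM.
rewrite (_ : geo 1 = 1) ?mul1r; last by apply/esym/geoP; rewrite mulr1.
case/andP: (bnd (z - l%:Z)) => h1 h2.
by rewrite PoszD !mulrDl !mul1r !lerD.
Qed.

Definition nonneg_coefs (f : {poly int}) := forall n, 0 <= f`_n.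

Lemma nonneg_coefs_cz f (z : int) : nonneg_coefs f -> 0 <= cz f z.
Proof. by move=> hf; case: z => n //=; exact: hf. Qed.

Lemma nonneg_geo l : nonneg_coefs (geo l).
Proof. by move=> n; rewrite coef_poly; case: ifP. Qed.

Lemma nonneg_mul f g : nonneg_coefs f -> nonneg_coefs g -> nonneg_coefs (f * g).
Proof. by move=> hf hg n; rewrite coefM sumr_ge0 // => i _; rewrite mulr_ge0. Qed.

Lemma nonneg_comp f M : (0 < M)%N -> nonneg_coefs f -> nonneg_coefs (f \Po 'X^M).
Proof. by move=> M0 hf n; rewrite coef_comp_poly_Xn //; case: ifP. Qed.

Ltac arith :=
  repeat match goal with
  | H : ?T |- _ => is_var H; match T with
      | nat => fail 1
      | int => fail 1
      | is_true (_ <= _)%N => fail 1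
      | is_true (_ <= _ < _)%N => fail 1
      | is_true (_ < _ < _)%N => fail 1
      | is_true (_ <= _)%R => fail 1
      | is_true (_ < _)%R => fail 1
      | is_true (_ <= _ <= _)%R => fail 1
      | is_true (_ <= _ < _)%R => fail 1
      | is_true (_ < _ < _)%R => fail 1
      | is_true (_ != _ :> nat) => fail 1
      | is_true (_ != _ :> int) => fail 1
      | (_ = _ :> nat) => fail 1
      | (_ = _ :> int) => fail 1
      | _ => clear H
      end
  end; lia.

(** * The 64 divisors *)

Section Coefficients.

Variables p q sigma : nat.
Hypotheses (p_prime : prime p) (q_prime : prime q) (p_neq_q : p != q).
Hypothesis bez : bezout_pair p q (pstar p q) sigma.

Let p1 : (1 < p)%N := prime_gt1 p_prime.
Let q1 : (1 < q)%N := prime_gt1 q_prime.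
Let p0 : (0 < p)%N := ltnW p1.
Let q0 : (0 < q)%N := ltnW q1.
Let npq : ~~ (p %| q)%N. Proof. by rewrite dvdn_prime2. Qed.
Local Notation D := ('Phi_(p * q)).

Let Phi_pq := Phi_pq p_prime q_prime p_neq_q.

(** * Geometric sums and their substitutions as products of cyclotomic factors *)

Lemma size_D : size D = (p.-1 * q.-1).+1.
Proof.
by rewrite size_Cyclotomic totient_coprime ?totient_prime // prime_coprime.
Qed.

Lemma D_neq0 : D != 0.
Proof. by rewrite -size_poly_gt0 size_D. Qed.

Lemma size_X1_D : size (('X - 1) * D) = (p.-1 * q.-1).+2.
Proof. by rewrite size_mul ?X1_neq0 ?D_neq0 // size_X1 size_D. Qed.

Let Xn1 n : 'X^n - 1 = ('X - 1) * geo n := esym (mul_geo n).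

Lemma geo_p_comp_q : geo p \Po 'X^q = geo p * D.
Proof.
apply: (@mulfI _ (('X - 1) * ('X^q - 1))); first by rewrite mulf_neq0 ?X1_neq0 ?Xn1_neq0.
rewrite -mulrA mul_geo_comp -Phi_pq (Xn1 p); ring.
Qed.

Lemma geo_q_comp_p : geo q \Po 'X^p = geo q * D.
Proof.
apply: (@mulfI _ (('X - 1) * ('X^p - 1))); first by rewrite mulf_neq0 ?X1_neq0 ?Xn1_neq0.
rewrite -mulrA mul_geo_comp [(q * p)%N]mulnC -Phi_pq (Xn1 q); ring.
Qed.

Lemma geo_q_comp_pp : geo q \Po 'X^(p ^ 2) = geo q * D * (D \Po 'X^p).
Proof. by rewrite -mulnn -comp_compXn geo_q_comp_p comp_polyM geo_q_comp_p. Qed.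

Lemma geo_p_comp_pq : geo p \Po 'X^(p * q) = (geo p \Po 'X^p) * (D \Po 'X^p).
Proof. by rewrite -comp_polyM -geo_p_comp_q comp_compXn mulnC. Qed.

Lemma geo_pp : geo (p ^ 2) = geo p * (geo p \Po 'X^p).
Proof. by rewrite geo_mul_comp mulnn. Qed.

Lemma geo_pq : geo (p * q) = geo p * geo q * D.
Proof. by rewrite -mulrA -geo_q_comp_p geo_mul_comp mulnC. Qed.

Lemma geo_pp_comp_q : geo (p ^ 2) \Po 'X^q = geo p * D * (geo p \Po 'X^p) * (D \Po 'X^p).
Proof. by rewrite geo_pp comp_polyM comp_compXn geo_p_comp_pq geo_p_comp_q; ring. Qed.

Lemma geo_pq_comp_p : geo (p * q) \Po 'X^p = (geo p \Po 'X^p) * (geo q * D) * (D \Po 'X^p).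
Proof. by rewrite geo_pq !comp_polyM geo_q_comp_p. Qed.

Lemma geo_ppq : geo (p ^ 2 * q) = geo p * geo q * D * (geo p \Po 'X^p) * (D \Po 'X^p).
Proof. by rewrite -mulnn -mulnA mulnC -geo_mul_comp geo_pq_comp_p; ring. Qed.

Definition PhiE := (Phi1, Phi_prime p_prime, Phi_prime q_prime, Phi_pp p_prime,
  Phi_ppq p_prime q_prime p_neq_q).

Ltac fdiv_ring := expand_fdiv; rewrite ?PhiE
  ?comp_polyM ?X1_comp ?Xn1_comp ?mulnn
  ?(geo_p_comp_q, geo_q_comp_p, geo_q_comp_pp, geo_p_comp_pq, geo_pp_comp_q, geo_pq_comp_p)
  ?(Xn1 p, Xn1 q, Xn1 (p * q)%N, Xn1 (p ^ 2)%N, Xn1 (p ^ 2 * q)%N)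
  ?(geo_ppq, geo_pq, geo_pp); ring.

Ltac expect := rewrite /expected_coefs /generic_coefs /= ?andbF ?andbT /=.

Let coef_set_D := coef_set_binary bez Phi_pq.
Let coef_set_AD := coef_set_X1_binary bez Phi_pq.

Ltac side := first [ done | exact: coef_set_1 | exact: coef_set_X1
  | apply: coef_set_Xn1; lia | apply: coef_set_geo; nia
  | exact: D_neq0 | apply: geo_neq0; nia
  | by rewrite mulf_neq0 ?X1_neq0 ?D_neq0 ?Xn1_neq0 ?geo_neq0
  | rewrite ?size_poly1 ?size_X1 ?size_XnsubC ?size_geo ?size_mul_geo ?size_Xn1_geo ?size_D ?size_X1_D //; nia ].

Ltac finish := rewrite ?in_zs; repeat (case: ifP => ?); rewrite ?in_zs
  ?size_poly1 ?size_X1 ?size_XnsubC ?size_geo ?size_mul_geo ?size_Xn1_geo ?size_D ?size_X1_D //; try lia; try nia.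

Local Notation s := (sg p q sigma).

(** * Divisors given by a direct formula *)

Lemma coef_set_fdiv_0 : coef_set (fdiv p q 0) =i expected_coefs p q 0.
Proof.
move=> c; expect; have -> : fdiv p q 0 = 1 by fdiv_ring.
by rewrite coef_set_1; finish.
Qed.

Lemma coef_set_fdiv_1 : coef_set (fdiv p q 1) =i expected_coefs p q 1.
Proof.
move=> c; expect; have -> : fdiv p q 1 = 'X - 1 by fdiv_ring.
by rewrite coef_set_X1; finish.
Qed.

Lemma coef_set_fdiv_2 : coef_set (fdiv p q 2) =i expected_coefs p q 2.
Proof.
move=> c; expect; have -> : fdiv p q 2 = geo p by fdiv_ring.
by rewrite coef_set_geo; finish.
Qed.

Lemma coef_set_fdiv_4 : coef_set (fdiv p q 4) =i expected_coefs p q 4.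
Proof.
move=> c; expect; have -> : fdiv p q 4 = geo q by fdiv_ring.
by rewrite coef_set_geo; finish.
Qed.

Lemma coef_set_fdiv_14 : coef_set (fdiv p q 14) =i expected_coefs p q 14.
Proof.
move=> c; expect; have -> : fdiv p q 14 = geo (p * q) by fdiv_ring.
by rewrite coef_set_geo; finish.
Qed.

Lemma coef_set_fdiv_18 : coef_set (fdiv p q 18) =i expected_coefs p q 18.
Proof.
move=> c; expect; have -> : fdiv p q 18 = geo (p ^ 2) by fdiv_ring.
by rewrite coef_set_geo; finish.
Qed.

Lemma coef_set_fdiv_62 : coef_set (fdiv p q 62) =i expected_coefs p q 62.
Proof.
move=> c; expect; have -> : fdiv p q 62 = geo (p ^ 2 * q) by fdiv_ring.
by rewrite coef_set_geo; finish.
Qed.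

Lemma coef_set_fdiv_3 : coef_set (fdiv p q 3) =i expected_coefs p q 3.
Proof.
move=> c; expect; have -> : fdiv p q 3 = 'X^p - 1 by fdiv_ring.
by rewrite coef_set_Xn1; finish.
Qed.

Lemma coef_set_fdiv_5 : coef_set (fdiv p q 5) =i expected_coefs p q 5.
Proof.
move=> c; expect; have -> : fdiv p q 5 = 'X^q - 1 by fdiv_ring.
by rewrite coef_set_Xn1; finish.
Qed.

Lemma coef_set_fdiv_15 : coef_set (fdiv p q 15) =i expected_coefs p q 15.
Proof.
move=> c; expect; have -> : fdiv p q 15 = 'X^(p * q) - 1 by fdiv_ring.
by rewrite coef_set_Xn1; finish.
Qed.

Lemma coef_set_fdiv_19 : coef_set (fdiv p q 19) =i expected_coefs p q 19.
Proof.
move=> c; expect; have -> : fdiv p q 19 = 'X^(p ^ 2) - 1 by fdiv_ring.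
by rewrite coef_set_Xn1; finish.
Qed.

Lemma coef_set_fdiv_63 : coef_set (fdiv p q 63) =i expected_coefs p q 63.
Proof.
move=> c; expect; have -> : fdiv p q 63 = 'X^(p ^ 2 * q) - 1 by fdiv_ring.
by rewrite coef_set_Xn1; finish.
Qed.

Lemma coef_set_fdiv_6 : coef_set (fdiv p q 6) =i expected_coefs p q 6.
Proof.
move=> c; expect; have -> : fdiv p q 6 = geo p * geo q by fdiv_ring.
by rewrite coef_set_mul_geo; finish.
Qed.

Lemma coef_set_fdiv_22 : coef_set (fdiv p q 22) =i expected_coefs p q 22.
Proof.
move=> c; expect; have -> : fdiv p q 22 = geo (p ^ 2) * geo q by fdiv_ring.
by rewrite coef_set_mul_geo; finish.
Qed.

Lemma coef_set_fdiv_7 : coef_set (fdiv p q 7) =i expected_coefs p q 7.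
Proof.
move=> c; expect; have -> : fdiv p q 7 = ('X^p - 1) * geo q by fdiv_ring.
by rewrite coef_set_Xn1_geo; finish.
Qed.

Lemma coef_set_fdiv_23 : coef_set (fdiv p q 23) =i expected_coefs p q 23.
Proof.
move=> c; expect; have -> : fdiv p q 23 = ('X^(p ^ 2) - 1) * geo q by fdiv_ring.
have ppq : (p ^ 2 != q)%N by apply: contra npq => /eqP <-; rewrite dvdn_exp.
by rewrite coef_set_Xn1_geo; finish.
Qed.

Lemma coef_set_fdiv_8 : coef_set (fdiv p q 8) =i expected_coefs p q 8.
Proof.
move=> c; expect; have -> : fdiv p q 8 = D by fdiv_ring.
by rewrite coef_set_D; finish.
Qed.

Lemma coef_set_fdiv_9 : coef_set (fdiv p q 9) =i expected_coefs p q 9.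
Proof.
move=> c; expect; have -> : fdiv p q 9 = ('X - 1) * D by fdiv_ring.
by rewrite coef_set_AD; finish.
Qed.

(** * Divisors that are products without carries *)

Lemma coef_set_fdiv_10 : coef_set (fdiv p q 10) =i expected_coefs p q 10.
Proof.
move=> c; expect; have -> : fdiv p q 10 = 1 * (geo p \Po 'X^q) by fdiv_ring.
by rewrite kron1; [rewrite !coef_set_geo //; finish | side ..].
Qed.

(** The copies of x - 1 are spaced by q and leave no gap exactly when q = 2, whence the exception.
    The same effect accounts for q = 2 at k = 59 and for p = 2 at k = 13, 17, 29, 33, 61. *)
Lemma coef_set_fdiv_11 : coef_set (fdiv p q 11) =i expected_coefs p q 11.
Proof.
move=> c; expect; have -> : fdiv p q 11 = ('X - 1) * (geo p \Po 'X^q) by fdiv_ring.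
by rewrite kron_pm; [rewrite !coef_set_geo //; finish | side ..].
Qed.

Lemma coef_set_fdiv_12 : coef_set (fdiv p q 12) =i expected_coefs p q 12.
Proof.
move=> c; expect; have -> : fdiv p q 12 = 1 * (geo q \Po 'X^p) by fdiv_ring.
by rewrite kron1; [rewrite !coef_set_geo //; finish | side ..].
Qed.

Lemma coef_set_fdiv_13 : coef_set (fdiv p q 13) =i expected_coefs p q 13.
Proof.
move=> c; expect; have -> : fdiv p q 13 = ('X - 1) * (geo q \Po 'X^p) by fdiv_ring.
by rewrite kron_pm; [rewrite !coef_set_geo //; finish | side ..].
Qed.

Lemma coef_set_fdiv_16 : coef_set (fdiv p q 16) =i expected_coefs p q 16.
Proof.
move=> c; expect; have -> : fdiv p q 16 = 1 * (geo p \Po 'X^p) by fdiv_ring.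
by rewrite kron1; [rewrite !coef_set_geo //; finish | side ..].
Qed.

Lemma coef_set_fdiv_17 : coef_set (fdiv p q 17) =i expected_coefs p q 17.
Proof.
move=> c; expect; have -> : fdiv p q 17 = ('X - 1) * (geo p \Po 'X^p) by fdiv_ring.
by rewrite kron_pm; [rewrite !coef_set_geo //; finish | side ..].
Qed.

Lemma coef_set_fdiv_28 : coef_set (fdiv p q 28) =i expected_coefs p q 28.
Proof.
move=> c; expect; have -> : fdiv p q 28 = 1 * ((geo p * geo q) \Po 'X^p) by fdiv_ring.
by rewrite kron1; [rewrite !coef_set_mul_geo //; finish | side ..].
Qed.

Lemma coef_set_fdiv_29 : coef_set (fdiv p q 29) =i expected_coefs p q 29.
Proof.
move=> c; expect; have -> : fdiv p q 29 = ('X - 1) * ((geo p * geo q) \Po 'X^p) by fdiv_ring.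
by rewrite kron_pm; [rewrite !coef_set_mul_geo //; finish | side ..].
Qed.

Lemma coef_set_fdiv_30 : coef_set (fdiv p q 30) =i expected_coefs p q 30.
Proof.
move=> c; expect; have -> : fdiv p q 30 = geo p * ((geo p * geo q) \Po 'X^p) by fdiv_ring.
by rewrite kron1; [rewrite !coef_set_mul_geo //; finish | side ..].
Qed.

Lemma coef_set_fdiv_31 : coef_set (fdiv p q 31) =i expected_coefs p q 31.
Proof.
move=> c; expect; have -> : fdiv p q 31 = 1 * ((('X^p - 1) * geo q) \Po 'X^p) by fdiv_ring.
by rewrite kron1; [rewrite !coef_set_Xn1_geo //; finish | side ..].
Qed.

Lemma coef_set_fdiv_32 : coef_set (fdiv p q 32) =i expected_coefs p q 32.
Proof.
move=> c; expect; have -> : fdiv p q 32 = 1 * (D \Po 'X^p) by fdiv_ring.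
by rewrite kron1; [rewrite !coef_set_D //; finish | side ..].
Qed.

Lemma coef_set_fdiv_33 : coef_set (fdiv p q 33) =i expected_coefs p q 33.
Proof.
move=> c; expect; have -> : fdiv p q 33 = ('X - 1) * (D \Po 'X^p) by fdiv_ring.
by rewrite kron_pm; [rewrite !coef_set_D //; finish | side ..].
Qed.

Lemma coef_set_fdiv_34 : coef_set (fdiv p q 34) =i expected_coefs p q 34.
Proof.
move=> c; expect; have -> : fdiv p q 34 = geo p * (D \Po 'X^p) by fdiv_ring.
by rewrite kron1; [rewrite !coef_set_D //; finish | side ..].
Qed.

Lemma coef_set_fdiv_35 : coef_set (fdiv p q 35) =i expected_coefs p q 35.
Proof.
move=> c; expect; have -> : fdiv p q 35 = 1 * ((('X - 1) * D) \Po 'X^p) by fdiv_ring.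
by rewrite kron1; [rewrite !coef_set_AD //; finish | side ..].
Qed.

Lemma coef_set_fdiv_44 : coef_set (fdiv p q 44) =i expected_coefs p q 44.
Proof.
move=> c; expect; have -> : fdiv p q 44 = 1 * (geo q \Po 'X^(p ^ 2)) by fdiv_ring.
by rewrite kron1; [rewrite !coef_set_geo //; finish | side ..].
Qed.

Lemma coef_set_fdiv_45 : coef_set (fdiv p q 45) =i expected_coefs p q 45.
Proof.
move=> c; expect; have -> : fdiv p q 45 = ('X - 1) * (geo q \Po 'X^(p ^ 2)) by fdiv_ring.
by rewrite kron_pm; [rewrite !coef_set_geo //; finish | side ..].
Qed.

Lemma coef_set_fdiv_46 : coef_set (fdiv p q 46) =i expected_coefs p q 46.
Proof.
move=> c; expect; have -> : fdiv p q 46 = geo p * (geo q \Po 'X^(p ^ 2)) by fdiv_ring.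
by rewrite kron1; [rewrite !coef_set_geo //; finish | side ..].
Qed.

Lemma coef_set_fdiv_47 : coef_set (fdiv p q 47) =i expected_coefs p q 47.
Proof.
move=> c; expect; have -> : fdiv p q 47 = ('X^p - 1) * (geo q \Po 'X^(p ^ 2)) by fdiv_ring.
by rewrite kron_pm0; [rewrite !coef_set_geo //; finish | side ..].
Qed.

Lemma coef_set_fdiv_48 : coef_set (fdiv p q 48) =i expected_coefs p q 48.
Proof.
move=> c; expect; have -> : fdiv p q 48 = 1 * (geo p \Po 'X^(p * q)) by fdiv_ring.
by rewrite kron1; [rewrite !coef_set_geo //; finish | side ..].
Qed.

Lemma coef_set_fdiv_49 : coef_set (fdiv p q 49) =i expected_coefs p q 49.
Proof.
move=> c; expect; have -> : fdiv p q 49 = ('X - 1) * (geo p \Po 'X^(p * q)) by fdiv_ring.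
by rewrite kron_pm; [rewrite !coef_set_geo //; finish | side ..].
Qed.

Lemma coef_set_fdiv_50 : coef_set (fdiv p q 50) =i expected_coefs p q 50.
Proof.
move=> c; expect; have -> : fdiv p q 50 = geo p * (geo p \Po 'X^(p * q)) by fdiv_ring.
by rewrite kron1; [rewrite !coef_set_geo //; finish | side ..].
Qed.

Lemma coef_set_fdiv_51 : coef_set (fdiv p q 51) =i expected_coefs p q 51.
Proof.
move=> c; expect; have -> : fdiv p q 51 = ('X^p - 1) * (geo p \Po 'X^(p * q)) by fdiv_ring.
by rewrite kron_pm0; [rewrite !coef_set_geo //; finish | side ..].
Qed.

Lemma coef_set_fdiv_52 : coef_set (fdiv p q 52) =i expected_coefs p q 52.
Proof.
move=> c; expect; have -> : fdiv p q 52 = geo q * (geo p \Po 'X^(p * q)) by fdiv_ring.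
by rewrite kron1; [rewrite !coef_set_geo //; finish | side ..].
Qed.

Lemma coef_set_fdiv_53 : coef_set (fdiv p q 53) =i expected_coefs p q 53.
Proof.
move=> c; expect; have -> : fdiv p q 53 = ('X^q - 1) * (geo p \Po 'X^(p * q)) by fdiv_ring.
by rewrite kron_pm0; [rewrite !coef_set_geo //; finish | side ..].
Qed.

Lemma coef_set_fdiv_58 : coef_set (fdiv p q 58) =i expected_coefs p q 58.
Proof.
move=> c; expect; have -> : fdiv p q 58 = 1 * (geo (p ^ 2) \Po 'X^q) by fdiv_ring.
by rewrite kron1; [rewrite !coef_set_geo //; finish | side ..].
Qed.

Lemma coef_set_fdiv_59 : coef_set (fdiv p q 59) =i expected_coefs p q 59.
Proof.
move=> c; expect; have -> : fdiv p q 59 = ('X - 1) * (geo (p ^ 2) \Po 'X^q) by fdiv_ring.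
by rewrite kron_pm; [rewrite !coef_set_geo //; finish | side ..].
Qed.

Lemma coef_set_fdiv_60 : coef_set (fdiv p q 60) =i expected_coefs p q 60.
Proof.
move=> c; expect; have -> : fdiv p q 60 = 1 * (geo (p * q) \Po 'X^p) by fdiv_ring.
by rewrite kron1; [rewrite !coef_set_geo //; finish | side ..].
Qed.

Lemma coef_set_fdiv_61 : coef_set (fdiv p q 61) =i expected_coefs p q 61.
Proof.
move=> c; expect; have -> : fdiv p q 61 = ('X - 1) * (geo (p * q) \Po 'X^p) by fdiv_ring.
by rewrite kron_pm; [rewrite !coef_set_geo //; finish | side ..].
Qed.

Lemma coef_set_fdiv_54 : coef_set (fdiv p q 54) =i expected_coefs p q 54.
Proof.
move=> c; expect; have -> : fdiv p q 54 = geo p * geo q * (geo p \Po 'X^(p * q)) by fdiv_ring.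
by rewrite kron_geo; [rewrite !coef_set_mul_geo //; finish | side ..].
Qed.

Lemma coef_set_fdiv_55 : coef_set (fdiv p q 55) =i expected_coefs p q 55.
Proof.
move=> c; expect; have -> : fdiv p q 55 = (('X^p - 1) * geo q) * (geo p \Po 'X^(p * q)) by fdiv_ring.
by rewrite kron_geo; [rewrite !coef_set_Xn1_geo //; finish | side ..].
Qed.

Lemma coef_set_fdiv_56 : coef_set (fdiv p q 56) =i expected_coefs p q 56.
Proof.
move=> c; expect; have -> : fdiv p q 56 = D * (geo p \Po 'X^(p * q)) by fdiv_ring.
by rewrite kron_geo; [rewrite !coef_set_D //; finish | side ..].
Qed.

Lemma coef_set_fdiv_57 : coef_set (fdiv p q 57) =i expected_coefs p q 57.
Proof.
move=> c; expect; have -> : fdiv p q 57 = ('X - 1) * D * (geo p \Po 'X^(p * q)) by fdiv_ring.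
by rewrite kron_geo; [rewrite !coef_set_AD //; finish | side ..].
Qed.

(** * Two copies in different residue classes *)

Lemma coef_set_fdiv_21 : coef_set (fdiv p q 21) =i expected_coefs p q 21.
Proof.
move=> c; expect; have -> : fdiv p q 21 = ('X^q - 1) * (geo p \Po 'X^p) by fdiv_ring.
by rewrite coef_set_Xn1_comp; [rewrite !coef_set_geo //; finish | side ..].
Qed.

Lemma coef_set_fdiv_37 : coef_set (fdiv p q 37) =i expected_coefs p q 37.
Proof.
move=> c; expect; have -> : fdiv p q 37 = ('X^q - 1) * (D \Po 'X^p) by fdiv_ring.
by rewrite coef_set_Xn1_comp; [rewrite !coef_set_D //; finish | side ..].
Qed.

(** * Differences of semigroup indicators and of their floors: k = 26, 27, 20, 36, 39 *)

Let q_divp : exists c r : nat, [/\ q = (c * p + r)%N, (0 < r < p)%N, (q %/ p = c)%N & (q %% p = r)%N].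
Proof.
exists (q %/ p)%N, (q %% p)%N; split=> //; first exact: divn_eq.
by rewrite ltn_pmod // andbT lt0n -/(dvdn p q).
Qed.

Lemma cz_fdiv_26 (z : int) :
  cz (fdiv p q 26) z = (s z)%:Z - (s (z - (p * p)%N%:Z))%:Z.
Proof.
move: z; apply: (@cz_uniq p) => [//|z z0|z].
  by rewrite !(sg_neg bez) //; lia.
have -> : ('X^p - 1) * fdiv p q 26 = ('X^(p * p) - 1) * (geo p \Po 'X^q).
  have -> : fdiv p q 26 = (geo p \Po 'X^q) * (geo p \Po 'X^p) by fdiv_ring.
  by rewrite mulrCA mul_geo_comp mulrC.
have key (w : int) : cz (geo p \Po 'X^q) w = (s w)%:Z - (s (w - p%:Z))%:Z.
  rewrite (sg_sub_M bez) cz_compXn //; case: dvdzP => [[k ->]|//].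
  rewrite mulzK ?cz_geo; last by lia.
  by rewrite (_ : (0 <= k < p%:Z) = (0 <= k * q%:Z < p%:Z * q%:Z)) //; clear -q0; nia.
by rewrite czXn1M !key [z - p%:Z - (p * p)%N%:Z]addrAC; ring.
Qed.

(** p^2 is a multiple of the generator p, so s(z - p^2) implies s(z) and no coefficient is
    negative. *)
Lemma coef_set_fdiv_26 : coef_set (fdiv p q 26) =i expected_coefs p q 26.
Proof.
move=> c; expect; rewrite in_zs; have s0 := sg0 bez.
have le_ppp : (p < p * p)%N by rewrite ltn_Pmull.
apply/idP/idP => [|hc].
  case/coef_set_cz => z _ <-; rewrite cz_fdiv_26.
  case: (boolP (s (z - _))) => [h|_]; last by case: (s z).
  have := sg_addM bez h (_ : 0 <= p%:Z); rewrite PoszM subrK => -> //.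
have cp : cz (fdiv p q 26) p%:Z = 1.
  rewrite cz_fdiv_26 (sg_neg bez (_ : p%:Z - (p * p)%N%:Z < 0)); last by arith.
  by have := sg_mulM bez 1; rewrite mul1r => ->.
have [->|->] : c = 0 \/ c = 1 by arith.
  apply: (mem0_coef_set 1 p%:Z); [|arith|by rewrite cp].
  by rewrite cz_fdiv_26 (sg_gt0_small bez) ?(sg_neg bez) //; arith.
by apply: (mem_coef_set p%:Z).
Qed.

Lemma coef_set_fdiv_27 : coef_set (fdiv p q 27) =i expected_coefs p q 27.
Proof.
move=> c; expect; rewrite in_zs; have s0 := sg0 bez.
have le_ppp : (p < p * p)%N by rewrite ltn_Pmull.
have EA : fdiv p q 27 = ('X - 1) * fdiv p q 26 by fdiv_ring.
have s_p : s p%:Z by have := sg_mulM bez 1; rewrite mul1r => ->.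
have s_q : s q%:Z by have := @sg_mulB _ _ _ _ bez 1; rewrite mul1r => ->.
have E (z : int) : cz (fdiv p q 27) z = cz (fdiv p q 26) (z - 1) - cz (fdiv p q 26) z.
  by rewrite EA czX1M.
have small (z : int) : z < (p * p)%N%:Z -> cz (fdiv p q 26) z = (s z)%:Z.
  by move=> hz; rewrite cz_fdiv_26 (sg_neg bez (_ : z - (p * p)%N%:Z < 0)) ?subr0 // subr_lt0.
apply/idP/idP => [|hc].
  case/coef_set_cz => z _ <-; rewrite E.
  have bnd w : 0 <= cz (fdiv p q 26) w <= 1.
    have : cz (fdiv p q 26) w \in zitv 0 1.
      case: (eqVneq (cz (fdiv p q 26) w) 0) => [->//|c0].
      by have := coef_set_fdiv_26 (cz (fdiv p q 26) w); expect => <-; exact: mem_coef_set erefl c0.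
    by rewrite in_zs.
  have := bnd z; have := bnd (z - 1); clear; lia.
have e1 : cz (fdiv p q 27) 1 = 1.
  by rewrite E subrr !small ?s0 ?(sg_gt0_small bez) //; arith.
have e0 : cz (fdiv p q 27) 0 = -1.
  by rewrite E !small ?s0 ?(sg_neg bez) //; arith.
case: (bounded1P hc) => [->|[->|->]]; [|exact: mem_coef_set e1 _|exact: mem_coef_set e0 _].
(* (p - 1)(p + q) is the degree of f_26, so this is the leading coefficient of f_27. *)
have etop : cz (fdiv p q 27) ((p%:Z - 1) * (p%:Z + q%:Z) + 1) != 0.
  have h1 : s ((p%:Z - 1) * (p%:Z + q%:Z)) by apply: (sg_large bez); clear -p1 q1; nia.
  have h2 : s ((p%:Z - 1) * (p%:Z + q%:Z) - (p * p)%N%:Z) = false.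
    rewrite PoszM (_ : _ - _ = (p%:Z - 1) * q%:Z + (-1) * p%:Z); last by ring.
    by rewrite (sgE bez) //; clear -p1; lia.
  have h3 : s ((p%:Z - 1) * (p%:Z + q%:Z) + 1) by apply: (sg_large bez); clear -p1 q1; nia.
  have h4 : s ((p%:Z - 1) * (p%:Z + q%:Z) + 1 - (p * p)%N%:Z).
    by apply: (sg_large bez); rewrite PoszM; clear; lia.
  by rewrite E addrK !cz_fdiv_26 h1 h2 h3 h4.
have etop_gt (z : int) : z <= p%:Z + q%:Z -> z < (p%:Z - 1) * (p%:Z + q%:Z) + 1.
  move=> hz; have : 0 <= (p%:Z - 2) * (p%:Z + q%:Z) by rewrite mulr_ge0 //; clear -p1 q1; lia.
  by clear -hz; lia.
(* A zero is a pair of equal consecutive coefficients of f_26: ones at p - 1 and p for q = 2; zeros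
   at 1 and 2 for p, q >= 3; ones at 2 and 3 for p = 2, q = 3; zeros at 3 and 4 for p = 2, q >=
   5. *)
have [q2|q3] : q = 2 \/ (3 <= q)%N by arith.
  have podd : odd p by case: (even_prime p_prime) p_neq_q => // ->; rewrite q2.
  apply: (mem0_coef_set p%:Z _ _ _ etop); last by rewrite etop_gt ?andbT; arith.
  rewrite E !small ?s_p; try by arith.
  rewrite (sg_lt_M bez) ?q2 //; last by arith.
  by have -> : (2 %| p%:Z - 1)%Z by clear -podd; lia.
have [p3|p2] : (3 <= p)%N \/ p = 2 by arith.
  apply: (mem0_coef_set 2 _ _ _ etop); last by rewrite etop_gt //; arith.
  rewrite E !small; try by clear -p3; nia.
  by rewrite !(sg_gt0_small bez) //; arith.
have pZ : p%:Z = 2 by rewrite p2.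
have q4 : q != 4 by apply/eqP => q4; move: q_prime; rewrite q4.
have [q5|q5] : q = 3 \/ (5 <= q)%N by arith.
  apply: (mem0_coef_set 3 _ _ _ etop); last by rewrite etop_gt //; arith.
  have s3 : s 3 by rewrite (_ : 3 = q%:Z) // q5.
  have s2 : s 2 by rewrite -pZ.
  by rewrite E !small ?PoszM ?pZ // (_ : 3 - 1 = 2) // s2 s3.
apply: (mem0_coef_set 4 _ _ _ etop); last by rewrite etop_gt //; arith.
rewrite E small ?PoszM ?pZ // cz_fdiv_26 PoszM pZ (_ : 4 - 2 * 2 = 0) // s0.
rewrite !(sg_lt_B bez) ?pZ //; clear -q5; lia.
Qed.

(** The coefficient at z counts the 0 <= m < p with z - q < mp <= z, and [S] is the summatory
    function of this range of m. A window of length q misses all multiples of p between two of them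
    only if q < p, which decides whether 0 occurs. *)
Lemma coef_set_fdiv_20 : coef_set (fdiv p q 20) =i expected_coefs p q 20.
Proof.
move=> c; expect; rewrite in_zs.
have [c0 [r [Eq r_bnd Ec0 Er]]] := q_divp.
pose S (m : int) : int := Num.min (Num.max (m + 1) 0) p%:Z.
have E (z : int) : cz (fdiv p q 20) z = S (z %/ p%:Z)%Z - S ((z - q%:Z) %/ p%:Z)%Z.
  have -> : fdiv p q 20 = geo q * (geo p \Po 'X^p) by fdiv_ring.
  apply: cz_geo_mul_comp => // m; first by move=> m0; rewrite /S; arith.
  by rewrite cz_geo /S; arith.
have Ed z := divz_subn q z p0; rewrite Ec0 Er in Ed.
have q1p : ((q - 1) %/ p = c0)%N.
  rewrite Eq -addnBA; last by case/andP: r_bnd.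
  by rewrite divnMDl // divn_small ?addn0 //; arith.
rewrite /alpha q1p Ec0.
have pZ : 0 < p%:Z by arith.
apply/idP/idP => [|hc].
  case/(@coef_set_cz_lt _ _ (q%:Z + p%:Z * (p%:Z - 1))) => [z hz|z hz <-]; rewrite E.
    have h1 : p%:Z - 1 <= ((z - q%:Z) %/ p%:Z)%Z by rewrite lez_divRL // mulrC; arith.
    have := Ed z; move: (z %/ _)%Z ((z - _) %/ _)%Z h1; rewrite /S => m m' h1 Em.
    clear -h1 Em; lia.
  have h1 : ((z - q%:Z) %/ p%:Z)%Z < p%:Z - 1 by rewrite ltz_divLR // mulrC; arith.
  have h2 : 0 <= (z %/ p%:Z)%Z by rewrite divz_ge0 //; case/andP: hz.
  have := Ed z; move: (z %/ _)%Z ((z - _) %/ _)%Z h1 h2; rewrite /S => m m' h1 h2 Em.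
  clear -h1 h2 Em p1; lia.
have [v1|v0] : 1 <= c \/ c = 0 by arith.
  apply: (mem_coef_set ((c - 1) * p%:Z)); last by arith.
  rewrite E mulzK; last by arith.
  have h : (((c - 1) * p%:Z - q%:Z) %/ p%:Z)%Z < 0.
    by rewrite ltz_divLR // mul0r Eq; clear -hc r_bnd; nia.
  move: (_ %/ _)%Z h => m' h; rewrite /S; clear -hc h v1; lia.
have c00 : c0 = 0 by clear -v0 hc; lia.
have qp : (q < p)%N by rewrite Eq c00; clear -r_bnd; lia.
rewrite v0; apply: (mem0_coef_set q%:Z p%:Z); rewrite ?E.
- by rewrite subrr div0z divz_nat Ec0 c00 subrr.
- by clear -qp; lia.
- rewrite divzz (divz_unique (m := 0)) /S ?pZ; [clear -p1; lia|arith|].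
  by clear -qp q0; lia.
Qed.

Lemma cz_fdiv_36 (z : int) :
  cz (fdiv p q 36) z = (s (z %/ p%:Z)%Z)%:Z - (s ((z - q%:Z) %/ p%:Z)%Z)%:Z.
Proof.
have -> : fdiv p q 36 = geo q * (D \Po 'X^p) by fdiv_ring.
apply: (@cz_geo_mul_comp D (fun m => (s m)%:Z)) => // m; first by move=> /(sg_neg bez) ->.
exact: (cz_binary bez Phi_pq m).
Qed.

(** Shifting by q must change the quotient by p by an amount [d] prime to p: d is the quotient of q
    by p, with e = 0, or one more, with e = p - 1, if p divides that quotient. For q < p the second
    choice applies, and e > 0 keeps the zero at index q below [q + e]. *)
Let shift_witness : exists d : int, [/\ 0 < d < q%:Z, ~~ (p%:Z %| d)%Z &
  exists2 e : int, 0 <= e < p%:Z & ((q < p)%N -> 0 < e) /\ forall x : int,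
    ((q%:Z + x * p%:Z + e) %/ p%:Z)%Z = x + d /\ ((q%:Z + x * p%:Z + e - q%:Z) %/ p%:Z)%Z = x].
Proof.
have [c0 [r [Eq r_bnd _ _]]] := q_divp.
have [dv|ndv] := boolP (p%:Z %| c0%:Z)%Z.
  exists (c0%:Z + 1); split.
  - by move: q1; rewrite Eq; clear -p1 r_bnd; nia.
  - by rewrite rpredDl // dvdz1; clear -p1; lia.
  exists (p%:Z - 1); first by clear -p1; lia.
  split=> [_|x]; first by clear -p1; lia.
  by split; apply: divz_unique; rewrite ?Eq; clear -p1 r_bnd; lia.
exists c0%:Z; have c00 : (0 < c0)%N by case: (c0) ndv => //; rewrite dvdz0.
split=> //; first by rewrite Eq; clear -p1 r_bnd c00; nia.
exists 0; first by clear -p1; lia.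
split=> [|x]; first by rewrite Eq; clear -r_bnd c00; nia.
by split; apply: divz_unique; rewrite ?Eq; clear -p1 r_bnd; lia.
Qed.

Lemma coef_set_fdiv_36 : coef_set (fdiv p q 36) =i expected_coefs p q 36.
Proof.
move=> c; expect; rewrite in_zs; have s0 := sg0 bez.
have [d [d_bnd ndv [e e_bnd [e0 Edx]]]] := shift_witness.
have p0Z : 0 < p%:Z by clear -p1; lia.
have Em : cz (fdiv p q 36) (q%:Z + e) = -1.
  have [E1 E2] := Edx 0; rewrite mul0r addr0 add0r in E1 E2.
  rewrite cz_fdiv_36 E1 E2 s0 (sg_lt_B bez) ?(negPf ndv) //; clear -d_bnd; lia.
apply/idP/idP => [|hc].
  by case/coef_set_cz => z _ <-; rewrite cz_fdiv_36; do 2 case: (s _).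
case: (bounded1P hc) => [->|[->|->]].
- have [qp|pq] : (q < p)%N \/ (p < q)%N by arith.
    apply: (mem0_coef_set q%:Z (q%:Z + e)); [|have := e0 qp; arith|by rewrite Em].
    by rewrite cz_fdiv_36 subrr div0z divz_nat divn_small ?subrr.
  apply: (mem0_coef_set p%:Z (q%:Z + e)); [|arith|by rewrite Em].
  rewrite cz_fdiv_36 divzz gt_eqF //= (sg_gt0_small bez); try by arith.
  by rewrite (sg_neg bez) // ltz_divLR // mul0r; arith.
- apply: (mem_coef_set 0) => //; rewrite cz_fdiv_36 div0z s0 (sg_neg bez) //.
  by rewrite ltz_divLR // mul0r; arith.
- exact: mem_coef_set Em _.
Qed.

Let a (m : int) : int := (s m)%:Z - (s (m - 1))%:Z.

Lemma cz_fdiv_39 (z : int) :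
  cz (fdiv p q 39) z = a ((z - q%:Z) %/ p%:Z)%Z - a (z %/ p%:Z)%Z.
Proof.
have -> : fdiv p q 39 = ('X^p - 1) * fdiv p q 36 by fdiv_ring.
rewrite czXn1M !cz_fdiv_36 (_ : z - p%:Z - q%:Z = z - q%:Z - p%:Z); last by ring.
have Ep (w : int) : ((w - p%:Z) %/ p%:Z)%Z = (w %/ p%:Z)%Z - 1.
  rewrite divz_subn // divnn p0 modnn (_ : (_ < 0%N%:Z) = false) ?subr0 //.
  by apply/negbTE; rewrite -leNgt modz_ge0 //; clear -p1; lia.
by rewrite !Ep /a; ring.
Qed.

Lemma coef_set_fdiv_39 : coef_set (fdiv p q 39) =i expected_coefs p q 39.
Proof.
move=> c; expect; rewrite in_zs; have s0 := sg0 bez.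
have p0Z : 0 < p%:Z by clear -p1; lia.
have sym c' : c' \in coef_set (fdiv p q 39) -> - c' \in coef_set (fdiv p q 39).
  apply: (@coef_set_opp [:: 1; p ^ 2; p * q]%N [:: p; q; p; p ^ 2 * q]%N); rewrite //= ?muln_gt0 ?expn_gt0 ?p0 ?q0 //.
  rewrite !big_cons big_nil !mulr1 expr1 (_ : fdiv p q 39 = ('X - 1) * geo p * geo q * (D \Po 'X^p)); last by fdiv_ring.
  rewrite (Xn1 p) (Xn1 q) (Xn1 (p * q)%N) (Xn1 (p ^ 2)%N) (Xn1 (p ^ 2 * q)%N) geo_ppq geo_pp geo_pq; ring.
have a_neg m : m < 0 -> a m = 0 by move=> m0; rewrite /a !(sg_neg bez) //; arith.
have a_small m : 1 < m -> m < p%:Z -> m < q%:Z -> a m = 0.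
  by move=> m1 mp mq; rewrite /a !(sg_gt0_small bez) //; arith.
have a_large m : (p%:Z - 1) * (q%:Z - 1) < m -> a m = 0.
  by move=> hm; rewrite /a !(sg_large bez) //; clear -hm; lia.
have a0 : a 0 = 1 by rewrite /a s0 (sg_neg bez).
have mone : -1 \in coef_set (fdiv p q 39).
  apply: (mem_coef_set 0) => //; rewrite cz_fdiv_39 div0z a0 a_neg //.
  by rewrite ltz_divLR // mul0r; arith.
(* 2 arises as a(x) - a(x + d) with a(x) = 1 and a(x + d) = -1: a run of semigroup elements starts
   at [x], and one has just ended before [x + d]. *)
have [d [d_bnd ndv [e e_bnd [e0 Edx]]]] := shift_witness.
have [x x0 [h1 h2 h3 h4]] := sg_start_end bez d_bnd ndv.
have two : 2 \in coef_set (fdiv p q 39).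
  apply: (mem_coef_set (q%:Z + x * p%:Z + e)) => //; have [E1 E2] := Edx x.
  by rewrite cz_fdiv_39 E1 E2 /a h1 h3 (negPf h2) (negPf h4).
apply/idP/idP => [|hc].
  by case/coef_set_cz => z _ <-; rewrite cz_fdiv_39 /a; do 4 case: (s _).
case: (bounded2P hc) => [->|[->|[->|[->|->]]]] //; try by [exact: sym | rewrite -[1]opprK sym].
(* The index is the degree of f_39; it certifies that the zeros found below are inner ones. *)
have ztop : cz (fdiv p q 39) ((p%:Z - 1) * (q%:Z - 1) * p%:Z + q%:Z + (p%:Z - 1)) != 0.
  rewrite cz_fdiv_39 (_ : _ + _ - q%:Z = (p%:Z - 1) * (q%:Z - 1) * p%:Z + (p%:Z - 1)); last by ring.
  rewrite (@divz_unique _ _ ((p%:Z - 1) * (q%:Z - 1))) //; last by clear -p1; lia.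
  rewrite (a_large (_ %/ _)%Z); last first.
    by rewrite -lezD1 lez_divRL // mulrDl mul1r; clear -p1 q1; lia.
  rewrite /a (sg_large bez) // (_ : _ - 1 = p%:Z * q%:Z - p%:Z - q%:Z); last by ring.
  by rewrite (sg_frobenius bez).
have ztop_gt (z : int) : z <= q%:Z + 2 * p%:Z -> (q != 2)%N || (z <= q%:Z + p%:Z - 1) ->
    z < (p%:Z - 1) * (q%:Z - 1) * p%:Z + q%:Z + (p%:Z - 1).
  by clear -p1 q1; nia.
have [qp|pq] : (q < p)%N \/ (p < q)%N by arith.
  apply: (mem0_coef_set q%:Z _ _ _ ztop); last by rewrite ztop_gt //; clear -p1 q1; lia.
  by rewrite cz_fdiv_39 subrr div0z divz_nat divn_small ?subrr.
have q3 : (2 < q)%N by arith.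
have mem0 z : 0 <= z <= q%:Z + 2 * p%:Z -> cz (fdiv p q 39) z = 0 -> 0 \in coef_set (fdiv p q 39).
  case/andP=> z0 z1 Ez; apply: (mem0_coef_set z _ Ez _ ztop).
  by rewrite z0 ztop_gt // gtn_eqF.
have s_q : s q%:Z by have := @sg_mulB _ _ _ _ bez 1; rewrite mul1r => ->.
have s_p : s p%:Z by have := sg_mulM bez 1; rewrite mul1r => ->.
have [p2|p3] : p = 2 \/ (3 <= p)%N by arith.
  have pZ : p%:Z = 2 by rewrite p2.
  (* For p = 2 the zero is a(0) - a(m), where [m] is the even one of the two integers next to q / 2:
     below q the semigroup is the even numbers, so a(m) = 1. *)
  have [m [z [m0 m1 m2 m3 mz]]] : exists m z : int,
      [/\ 0 < m, m < q%:Z, (2 %| m)%Z, q%:Z <= z <= q%:Z + 1 & 2 * m <= z <= 2 * m + 1].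
    have [k Ek] : exists k, q = (2 * k + 1)%N.
      exists q./2; rewrite -[in LHS](odd_double_half q) addnC -mul2n.
      by case: (even_prime q_prime) q3 => [->//|-> _].
    have [dv|dv] : (2 %| k%:Z)%Z \/ (2 %| k%:Z + 1)%Z by clear; lia.
      by exists k%:Z, q%:Z; split=> //; clear -q3 Ek; lia.
    by exists (k%:Z + 1), (q%:Z + 1); split=> //; clear -q3 Ek; lia.
  have Ez1 : (z %/ p%:Z)%Z = m by apply: divz_unique; rewrite pZ //; clear -mz; lia.
  have Ez2 : ((z - q%:Z) %/ p%:Z)%Z = 0 by apply: divz_unique; rewrite pZ //; clear -m3; lia.
  apply: (mem0 z); first by clear -m3 p0; lia.
  rewrite cz_fdiv_39 Ez1 Ez2 a0 /a !(sg_lt_B bez) ?pZ ?m2; [|clear -m0 m1; lia..].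
  by have -> : (2 %| m - 1)%Z = false by clear -m2; lia.
have [q2p|q2p] : (2 * p < q)%N \/ (q < 2 * p)%N.
    have : q != (2 * p)%N by apply: contra npq => /eqP->; rewrite dvdn_mull.
    by clear; lia.
  apply: (mem0 (2 * p%:Z)); first by clear -q2p; lia.
  rewrite cz_fdiv_39 mulzK ?gt_eqF // (a_small 2); [|arith..].
  by rewrite a_neg // ltz_divLR // mul0r; clear -q2p; lia.
have [p5|p5] : (3 < p)%N \/ p = 3 by arith.
  apply: (mem0 (q%:Z + 2 * p%:Z)); first by clear; lia.
  rewrite cz_fdiv_39 (@divz_unique _ _ 2) //; last by clear -p0; lia.
  rewrite (@divz_unique _ _ 3) //; last by clear -pq q2p; lia.
  by rewrite !a_small //; arith.
have q5 : q = 5.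
  have : q != 4 by apply/eqP => q4; move: q_prime; rewrite q4.
  by clear -pq q2p p5; lia.
have pZ : p%:Z = 3 by rewrite p5. have qZ : q%:Z = 5 by rewrite q5.
apply: (mem0_coef_set 15 _ _ _ ztop); last by rewrite pZ qZ.
rewrite cz_fdiv_39 pZ qZ (_ : ((15 - 5) %/ 3)%Z = 3) // (_ : (15 %/ 3)%Z = 5) //.
rewrite /a -[in s 3]pZ s_p -[in s 5]qZ s_q !(sg_lt_B bez) ?pZ ?qZ //.
Qed.

(** * The product of Phi_(pq) and Phi_(p^2), and its multiple by x - 1: k = 24, 25 *)

Local Notation rho := (pstar p q).

Let rho_bnd : (0 < rho < q)%N. Proof. by case/and3P: bez. Qed.
Let sigma_bnd : (0 < sigma < p)%N. Proof. by case/and3P: bez. Qed.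
Let bezout : (p * rho + q * sigma = p * q + 1)%N.
Proof. by case/and3P: bez => _ _ /eqP. Qed.
Let bezoutZ : sigma%:Z * q%:Z = 1 + (q%:Z - rho%:Z) * p%:Z.
Proof. by move: bezout; clear; rewrite mulrBl -!PoszM; lia. Qed.

Let cl (x : int) : int := Num.min (Num.max x 0) p%:Z.

(* The number of 0 <= t < p with z - t p in the semigroup <p, q>. *)
Let G (z : int) : int :=
  let k := ((z * sigma%:Z) %% p%:Z)%Z in cl (((z - k * q%:Z) %/ p%:Z)%Z + 1).

Let GE (k h : int) : 0 <= k < p%:Z -> G (k * q%:Z + h * p%:Z) = cl (h + 1).
Proof.
move=> hk; rewrite /G.
have -> : (k * q%:Z + h * p%:Z) * sigma%:Z = (k * (q%:Z - rho%:Z) + h * sigma%:Z) * p%:Z + k.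
  transitivity (k * (sigma%:Z * q%:Z) + h * p%:Z * sigma%:Z); [ring|rewrite bezoutZ; ring].
rewrite modzMDl modz_small; last by arith.
by rewrite addrAC subrr add0r mulzK // gt_eqF //; arith.
Qed.

(** Since 1 = sigma q - (q - rho) p, passing to z - 1 lowers the class index by [sigma], wrapping
    around modulo p when k < sigma. The constants rho and q - rho of the final bounds enter here. *)
Let G_pred (k h : int) : 0 <= k < p%:Z -> G (k * q%:Z + h * p%:Z - 1) =
  if sigma%:Z <= k then cl (h + 1 + (q%:Z - rho%:Z)) else cl (h + 1 - rho%:Z).
Proof.
move=> hk; case: ifP => hs.
  have -> : k * q%:Z + h * p%:Z - 1 = (k - sigma%:Z) * q%:Z + (h + (q%:Z - rho%:Z)) * p%:Z.
    by rewrite mulrBl bezoutZ; ring.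
  by rewrite GE 1?addrAC //; arith.
have -> : k * q%:Z + h * p%:Z - 1 = (k - sigma%:Z + p%:Z) * q%:Z + (h - rho%:Z) * p%:Z.
  by rewrite !mulrDl mulNr bezoutZ; ring.
rewrite GE 1?addrAC //; move: hs hk sigma_bnd; clear; lia.
Qed.

Let G_neg (z : int) : z < 0 -> G z = 0.
Proof.
have [k [h [hk ->]]] := sg_rep bez z => hz; rewrite GE // /cl.
have : h < 0 by clear -hz hk p0 q0; nia.
by clear; lia.
Qed.

Let G_sub (z : int) : G z - G (z - p%:Z) = (s z)%:Z - (s (z - (p ^ 2)%N%:Z))%:Z.
Proof.
have [k [h [hk ->]]] := sg_rep bez z.
have -> : k * q%:Z + h * p%:Z - p%:Z = k * q%:Z + (h - 1) * p%:Z by ring.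
have -> : k * q%:Z + h * p%:Z - (p ^ 2)%N%:Z = k * q%:Z + (h - p%:Z) * p%:Z.
  by rewrite -mulnn PoszM; ring.
rewrite !GE // !(sgE bez) // /cl; clear; lia.
Qed.

Let G_large (z : int) : (p%:Z - 1) * (q%:Z - 1 + p%:Z) <= z -> G z = p%:Z.
Proof.
have [k [h [hk ->]]] := sg_rep bez z => hz; rewrite GE // /cl.
have : p%:Z - 1 <= h by clear -hz hk p1 q0; nia.
by clear -p0; lia.
Qed.

Let G_small (z : int) : z < p%:Z -> G z = (s z)%:Z.
Proof.
move=> hz; have zp : z - p%:Z < 0 by rewrite subr_lt0.
have := G_sub z; rewrite (G_neg zp) subr0 => ->.
rewrite (sg_neg bez (_ : z - (p ^ 2)%N%:Z < 0)) ?subr0 // -mulnn PoszM; clear -hz p1; nia.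
Qed.

Lemma cz_fdiv_24 (z : int) : cz (fdiv p q 24) z = G z - G (z - 1).
Proof.
move: z; apply: (@cz_uniq p) => [//|z z0|z]; first by rewrite !G_neg //; arith.
have -> : ('X^p - 1) * fdiv p q 24 = ('X^(p ^ 2) - 1) * D.
  have -> : fdiv p q 24 = D * (geo p \Po 'X^p) by fdiv_ring.
  by rewrite mulrCA mul_geo_comp mulnn mulrC.
rewrite czXn1M !(cz_binary bez Phi_pq).
have := G_sub z; have := G_sub (z - 1).
rewrite (_ : z - p%:Z - 1 = z - 1 - p%:Z); last by ring.
rewrite (_ : z - (p ^ 2)%N%:Z - 1 = z - 1 - (p ^ 2)%N%:Z); last by ring.
move: (G _) (G _) (G _) (G _) => g1 g2 g3 g4 E1 E2.
rewrite (_ : g1 - g3 - _ = g4 - g3 - (g2 - g1)); last by ring.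
by rewrite E1 E2; ring.
Qed.

Let cz24 (k h : int) : 0 <= k < p%:Z -> cz (fdiv p q 24) (k * q%:Z + h * p%:Z) =
  cl (h + 1) - if sigma%:Z <= k then cl (h + 1 + (q%:Z - rho%:Z)) else cl (h + 1 - rho%:Z).
Proof. by move=> hk; rewrite cz_fdiv_24 GE // G_pred. Qed.

(** [cl] is nondecreasing, changes by at most the change of its argument, and has values in [0, p];
    the arguments differ by [rho] or by [q - rho]. *)
Let cz24_bnd (z : int) :
  - (minn p (q - rho))%:Z <= cz (fdiv p q 24) z <= (minn p rho)%:Z.
Proof.
have [k [h [hk ->]]] := sg_rep bez z; rewrite cz24 // /cl.
by move: rho_bnd; case: ifP => _; clear; lia.
Qed.

Let cz24_0 (h : int) : cz (fdiv p q 24) (h * p%:Z) = cl (h + 1) - cl (h + 1 - rho%:Z).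
Proof.
rewrite -[h * _]add0r -(mul0r q%:Z) cz24; last by arith.
by rewrite (_ : (sigma%:Z <= 0) = false) //; move: sigma_bnd; clear; lia.
Qed.

Let cz24_1 (h : int) : cz (fdiv p q 24) (h * p%:Z + 1) =
  cl (h + 1 - (q%:Z - rho%:Z)) - cl (h + 1).
Proof.
have -> : h * p%:Z + 1 = sigma%:Z * q%:Z + (h - (q%:Z - rho%:Z)) * p%:Z by rewrite bezoutZ; ring.
rewrite cz24; last by move: sigma_bnd; clear; lia.
by rewrite lexx addrAC subrK addrAC.
Qed.

Let cz24_small (z : int) : z < p%:Z -> cz (fdiv p q 24) z = (s z)%:Z - (s (z - 1))%:Z.
Proof. by move=> hz; rewrite cz_fdiv_24 !G_small //; arith. Qed.

Let cz24_vanish (z : int) : (p%:Z - 1) * (q%:Z - 1 + p%:Z) + 1 <= z -> cz (fdiv p q 24) z = 0.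
Proof. by move=> hz; rewrite cz_fdiv_24 !G_large ?subrr //; arith. Qed.

(** A value v > 0 occurs at (v - 1)p and -v at (v - 1)p + 1, on the initial slope where the second
    clamped term is still 0. Zero is missing only if min(p, q) = 2; otherwise index 2 gives it. *)
Lemma coef_set_fdiv_24 : coef_set (fdiv p q 24) =i expected_coefs p q 24.
Proof.
move=> c; expect.
have nz : c != 0 -> - (minn p (q - rho))%:Z <= c <= (minn p rho)%:Z -> c \in coef_set (fdiv p q 24).
  move=> c0 hc; have [cpos|cneg] : 0 < c \/ c < 0 by arith.
    apply: (mem_coef_set ((c - 1) * p%:Z)) => //; rewrite cz24_0 /cl.
    by move: rho_bnd; clear -cpos hc; lia.
  apply: (mem_coef_set (((- c) - 1) * p%:Z + 1)) => //; rewrite cz24_1 /cl.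
  by move: rho_bnd; clear -cneg hc; lia.
have bnd : c \in coef_set (fdiv p q 24) -> - (minn p (q - rho))%:Z <= c <= (minn p rho)%:Z.
  by case/coef_set_cz => z _ <-; exact: cz24_bnd.
case: ifP => min2; rewrite in_zs; last first.
  apply/idP/idP => // hc; case: (eqVneq c 0) => [->|c0]; last exact: nz.
  have min3 : (2 < minn p q)%N by move: min2 p1 q1; clear; lia.
  apply: (mem0_coef_set 2 (1 * p%:Z)).
  - rewrite cz24_small; last by move: min3; clear; lia.
    by rewrite !(sg_gt0_small bez) //; move: min3; clear; lia.
  - by move: min3; clear; lia.
  - by rewrite cz24_0 /cl; move: rho_bnd p1; clear; lia.
apply/idP/andP => [hc|[c0 hc]]; last exact: nz.
split; last exact: bnd.
case/(@coef_set_cz_lt _ _ ((p%:Z - 1) * (q%:Z - 1 + p%:Z) + 1)): hc => [|z hz <-]; first exact: cz24_vanish.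
have [k [h [hk Ez]]] := sg_rep bez z; rewrite Ez in hz *; rewrite cz24 // /cl.
have [p2|q2] : p = 2 \/ q = 2 by move: min2; clear; lia.
  have pZ : p%:Z = 2 by rewrite p2.
  have sigma1 : sigma%:Z = 1 by move: sigma_bnd; rewrite p2; clear; lia.
  have rhoE : 2 * rho%:Z = q%:Z + 1 by move: bezoutZ; rewrite sigma1 pZ; clear; lia.
  rewrite sigma1; have [k0|k1] : k = 0 \/ k = 1 by move: hk; rewrite pZ; clear; lia.
    by move: hz; rewrite k0 pZ /=; clear -rhoE q1; lia.
  by move: hz; rewrite k1 pZ /=; clear -rhoE q1; lia.
have qZ : q%:Z = 2 by rewrite q2.
have rho1 : rho%:Z = 1 by move: rho_bnd; rewrite q2; clear; lia.
have sigmaE : 2 * sigma%:Z = p%:Z + 1 by move: bezoutZ; rewrite rho1 qZ; clear; lia.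
have h1 : - 1 <= h by move: hz hk; rewrite qZ; clear -p1; nia.
have h2 : h <= p%:Z - 1 by move: hz hk; rewrite qZ; clear -p1; nia.
(* For q = 2 the coefficient is cl(h + 1) - cl(h + 2) or cl(h + 1) - cl(h). Between 0 and the
   degree, h stays in [-1, p - 2] and [0, p - 1] respectively, where these differences are -1 and
   1. *)
rewrite rho1 qZ; move: hz; rewrite qZ; case: ifP => hs hz.
  have h3 : h <= p%:Z - 2 by clear -hz hk hs sigmaE h2 p1; nia.
  by clear -h1 h3 p1; lia.
have h3 : 0 <= h by clear -hz hk hs sigmaE h1 p1; nia.
by clear -h2 h3 p1; lia.
Qed.

(* b(ip) - b(ip + 1) = T_rho(i) + T_(q - rho)(i), where T_L(i) is the coefficient
   of x^i in (1 + ... + x^(p-1)) (1 + ... + x^(L-1)). On the rising side i < p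
   this takes all even values up to gamma, and on the falling side all odd ones. *)
Let fdiv_25_even (L1 L2 v : int) : 0 < L1 -> L1 <= L2 -> 0 < v -> (2 %| v)%Z ->
  v <= Num.min p%:Z L1 + Num.min p%:Z L2 ->
  exists i : int, 2 * cl (i + 1) - cl (i + 1 - L1) - cl (i + 1 - L2) = v.
Proof.
move=> L10 L12 v0 v2 vg; have [vL|vL] : v <= 2 * L1 \/ 2 * L1 < v by clear; lia.
  by exists ((v %/ 2)%Z - 1); rewrite /cl; clear -L10 L12 v0 v2 vg vL p1; lia.
by exists (v - L1 - 1); rewrite /cl; clear -L10 L12 v0 vg vL p1; lia.
Qed.

(** Three regimes of the falling side: the shorter trapezoid has ended and the longer one takes the
    value v; both fall, which needs L1 + L2 - v even; the longer is still on its plateau p while the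
    shorter falls. *)
Let fdiv_25_odd (L1 L2 v : int) : 0 < L1 -> L1 < L2 -> 0 < v -> ~~ (2 %| v)%Z -> ~~ (2 %| L1 + L2)%Z ->
  v <= Num.min p%:Z L1 + Num.min p%:Z L2 ->
  exists i : int, 2 * cl (i + 1) - cl (i + 1 - L1) - cl (i + 1 - L2) = v.
Proof.
move=> L10 L12 v0 v2 L2' vg.
have p0' := p0.
have [vd|vd] : v <= Num.min (L2 - L1) p%:Z \/ Num.min (L2 - L1) p%:Z < v by clear; lia.
  by exists (p%:Z - 1 + (L2 - v)); rewrite /cl; clear -L10 L12 v0 vg vd p0'; lia.
have [vm|vm] : v + (L2 - L1) <= 2 * p%:Z \/ 2 * p%:Z < v + (L2 - L1) by clear; lia.
  exists (p%:Z - 1 + ((L1 + L2 - v) %/ 2)%Z).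
  have : exists u : int, L1 + L2 - v = u * 2.
    by exists ((L1 + L2 - v) %/ 2)%Z; clear -v2 L2'; lia.
  case=> u Eu; rewrite Eu mulzK // /cl; clear -Eu L10 L12 v0 vg vd vm p0'; lia.
by exists (p%:Z - 1 + (L1 + p%:Z - v)); rewrite /cl; clear -L10 L12 v0 vg vd vm p0'; lia.
Qed.

Lemma coef_set_fdiv_25 : coef_set (fdiv p q 25) =i expected_coefs p q 25.
Proof.
move=> c; expect; rewrite /gamma.
have E (z : int) : cz (fdiv p q 25) z = cz (fdiv p q 24) (z - 1) - cz (fdiv p q 24) z.
  by rewrite -czX1M; congr cz; fdiv_ring.
have bnd : c \in coef_set (fdiv p q 25) ->
    - (minn p rho + minn p (q - rho))%N%:Z <= c <= (minn p rho + minn p (q - rho))%N%:Z.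
  case/coef_set_cz => z _ <-; rewrite E; have := cz24_bnd z; have := cz24_bnd (z - 1).
  by clear; lia.
have sym c' : c' \in coef_set (fdiv p q 25) -> - c' \in coef_set (fdiv p q 25).
  apply: (@coef_set_opp [:: p; q; p]%N [:: 1; 1; p * q; p ^ 2]%N); rewrite //= ?p0 ?q0 //.
  rewrite !big_cons big_nil !mulr1 expr1 (_ : fdiv p q 25 = ('X - 1) * D * (geo p \Po 'X^p)); last by fdiv_ring.
  rewrite (Xn1 p) (Xn1 q) (Xn1 (p * q)%N) (Xn1 (p ^ 2)%N) geo_pp geo_pq; ring.
have Ei (i : int) : cz (fdiv p q 25) (i * p%:Z + 1) =
    2 * cl (i + 1) - cl (i + 1 - rho%:Z) - cl (i + 1 - (q%:Z - rho%:Z)).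
  by rewrite E addrK cz24_0 cz24_1; ring.
have pos v : 0 < v -> v <= (minn p rho + minn p (q - rho))%N%:Z -> v \in coef_set (fdiv p q 25).
  move=> v0 vg; have vne0 : v != 0 by clear -v0; lia.
  have rho_le_q : (rho <= q)%N by move: rho_bnd; clear; lia.
  have min_nat L : (minn p L)%:Z = Num.min p%:Z L%:Z by clear; lia.
  rewrite PoszD !min_nat -subzn // in vg.
  have r1 : 0 < rho%:Z by move: rho_bnd; clear; lia.
  have r2 : 0 < q%:Z - rho%:Z by move: rho_bnd; clear; lia.
  have [v2|v2] := boolP (2 %| v)%Z.
    have [i Hi] : exists i : int, 2 * cl (i + 1) - cl (i + 1 - rho%:Z) - cl (i + 1 - (q%:Z - rho%:Z)) = v.
      have [le|le] : rho%:Z <= q%:Z - rho%:Z \/ q%:Z - rho%:Z <= rho%:Z by clear; lia.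
        exact: fdiv_25_even r1 le v0 v2 vg.
      have [|i <-] := fdiv_25_even r2 le v0 v2 _; first by rewrite addrC.
      by exists i; ring.
    by apply: (mem_coef_set (i * p%:Z + 1)); rewrite ?Ei.
  (* For q = 2 both trapezoids have length 1 and L1 + L2 is even. The only odd value left is 1, the
     negative of the constant coefficient. *)
  have [q2|q3] : q = 2 \/ (2 < q)%N by move: q1; clear; lia.
    have -> : v = - (- 1).
      by move: vg v2 r1 r2; rewrite q2; clear -v0; lia.
    apply: sym; apply: (mem_coef_set 0) => //; rewrite E -{2}(mul0r p%:Z) cz24_0 cz_fdiv_24 !G_neg //.
    by rewrite /cl; clear -p0 r1; lia.
  have qodd : ~~ (2 %| rho%:Z + (q%:Z - rho%:Z))%Z.
    by rewrite addrC subrK; case: (even_prime q_prime) q3 => [->//|]; clear; lia.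
  have [i Hi] : exists i : int, 2 * cl (i + 1) - cl (i + 1 - rho%:Z) - cl (i + 1 - (q%:Z - rho%:Z)) = v.
    have [lt|lt] : rho%:Z < q%:Z - rho%:Z \/ q%:Z - rho%:Z < rho%:Z by clear -qodd; lia.
      exact: fdiv_25_odd r1 lt v0 v2 qodd vg.
    have [||i <-] := fdiv_25_odd r2 lt v0 v2 _ _; rewrite 1?addrC //.
    by exists i; ring.
  by apply: (mem_coef_set (i * p%:Z + 1)); rewrite ?Ei.
have nz : c != 0 -> - (minn p rho + minn p (q - rho))%N%:Z <= c <= (minn p rho + minn p (q - rho))%N%:Z ->
    c \in coef_set (fdiv p q 25).
  move=> c0 hc; have [cpos|cneg] : 0 < c \/ c < 0 by clear -c0; lia.
    by apply: pos => //; case/andP: hc.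
  by rewrite -[c]opprK; apply: sym; apply: pos; clear -cneg hc; lia.
case: ifP => small; rewrite in_zs.
  apply/idP/andP => [hc|[]//]; split; last exact: bnd.
  case/(@coef_set_cz_lt _ _ ((p%:Z - 1) * (q%:Z - 1 + p%:Z) + 2)): hc => [z hz|z hz <-].
    by rewrite E !cz24_vanish //; clear -hz; lia.
  move: small => /andP[p3 q2]; have {q2} q3 : (2 < q)%N by move: q1 q2; clear; lia.
  have Ecz : cz (fdiv p q 25) z = G (z - 1) + G (z - 1) - G z - G (z - 1 - 1) by rewrite E !cz_fdiv_24; ring.
  have [k [h [hk Ez]]] := sg_rep bez (z - 1).
  have Ez1 : z = (k * q%:Z + h * p%:Z) + 1 by rewrite -Ez subrK.
  have Gz : G z = if k + sigma%:Z < p%:Z then cl (h + 1 - (q%:Z - rho%:Z)) else cl (h + 1 + rho%:Z).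
    case: ifP => hs.
      have -> : z = (k + sigma%:Z) * q%:Z + (h - (q%:Z - rho%:Z)) * p%:Z by rewrite Ez1 mulrDl bezoutZ; ring.
      by rewrite GE; [rewrite addrAC | move: sigma_bnd; clear -hk hs; lia].
    have -> : z = (k + sigma%:Z - p%:Z) * q%:Z + (h + rho%:Z) * p%:Z by rewrite Ez1 !mulrDl bezoutZ; ring.
    by rewrite GE; [rewrite addrAC | move: sigma_bnd; clear -hk hs; lia].
  rewrite Ecz Gz Ez GE // G_pred //.
  (* For p <= 3 there are few classes [k] and few values of [sigma]; each combination leaves a
     piecewise linear inequality in [h]. *)
  have [pE|pE] : p%:Z = 2 \/ p%:Z = 3 by clear -p1 p3; lia.
    have sigma1 : sigma%:Z = 1 by move: sigma_bnd; clear -pE; lia.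
    have rhoE : 2 * rho%:Z = q%:Z + 1 by move: bezoutZ; rewrite sigma1 pE; clear; lia.
    move: hz; rewrite Ez1 /cl sigma1 pE.
    have [->|->] : k = 0 \/ k = 1 by move: hk; rewrite pE; clear; lia.
      by rewrite /=; clear -rhoE q3; lia.
    by rewrite /=; clear -rhoE q3; lia.
  have q4 : q != 4 by apply/eqP => q4; move: q_prime; rewrite q4.
  have q33 : q != 3 by apply: contra p_neq_q => /eqP->; apply/eqP; move: pE; clear; lia.
  have [sigma1|sigma2] : sigma%:Z = 1 \/ sigma%:Z = 2 by move: sigma_bnd; clear -pE; lia.
    have rhoE : 3 * rho%:Z = 2 * q%:Z + 1 by move: bezoutZ; rewrite sigma1 pE; clear; lia.
    move: hz; rewrite Ez1 /cl sigma1 pE.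
    have [->|[->|->]] : k = 0 \/ k = 1 \/ k = 2 by move: hk; rewrite pE; clear; lia.
    - by rewrite /=; clear -rhoE q3 q4 q33; lia.
    - by rewrite /=; clear -rhoE q3 q4 q33; lia.
    - by rewrite /=; clear -rhoE q3 q4 q33; lia.
  have rhoE : 3 * rho%:Z = q%:Z + 1 by move: bezoutZ; rewrite sigma2 pE; clear; lia.
  move: hz; rewrite Ez1 /cl sigma2 pE.
  have [->|[->|->]] : k = 0 \/ k = 1 \/ k = 2 by move: hk; rewrite pE; clear; lia.
  - by rewrite /=; clear -rhoE q3 q4 q33; lia.
  - by rewrite /=; clear -rhoE q3 q4 q33; lia.
  - by rewrite /=; clear -rhoE q3 q4 q33; lia.
apply/idP/idP => // hc; case: (eqVneq c 0) => [->|c0]; last exact: nz.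
(* What remains is q = 2 or p >= 5. A zero is a pair of equal consecutive coefficients of f_24;
   index 3 serves when p, q > 3, while q = 2 and q = 3 need indices near p. The coefficients at p +
   1 and 2p + 1 lie above these. *)
have top (i : int) : i = 1 \/ i = 2 -> (2 < p)%N -> cz (fdiv p q 25) (i * p%:Z + 1) != 0.
  by rewrite Ei /cl; move: rho_bnd; clear; lia.
have [q2|q3] : q = 2 \/ (2 < q)%N by move: q1; clear; lia.
  have p3 : (2 < p)%N by move: p_neq_q p1; rewrite q2; clear; lia.
  have qZ : q%:Z = 2 by rewrite q2.
  have rho1 : rho%:Z = 1 by move: rho_bnd; rewrite q2; clear; lia.
  have sigmaE : 2 * sigma%:Z = p%:Z + 1 by move: bezoutZ; rewrite rho1 qZ; clear; lia.
  apply: (mem0_coef_set p%:Z (1 * p%:Z + 1)); [|clear; lia|by apply: top; [left|]].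
  rewrite E -[X in _ - cz _ X]mul1r cz24_0.
  have -> : p%:Z - 1 = (sigma%:Z - 1) * q%:Z + 0 * p%:Z by rewrite qZ; clear -sigmaE; lia.
  rewrite cz24; last by move: sigma_bnd; clear; lia.
  by rewrite ifF /cl ?rho1; clear -p1; lia.
have p5 : (4 < p)%N.
  have : p != 4 by apply/eqP => p4; move: p_prime; rewrite p4.
  by move: small q3; clear; lia.
have [q3E|q5] : q = 3 \/ (3 < q)%N by clear -q3; lia.
  have qZ : q%:Z = 3 by rewrite q3E.
  have [rho1|rho2] : rho%:Z = 1 \/ rho%:Z = 2 by move: rho_bnd; rewrite q3E; clear; lia.
    have sigmaE : 3 * sigma%:Z = 2 * p%:Z + 1 by move: bezoutZ; rewrite rho1 qZ; clear; lia.
    apply: (mem0_coef_set p%:Z (1 * p%:Z + 1)); [|clear; lia|by apply: top; [left|move: p5; clear; lia]].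
    rewrite E -[X in _ - cz _ X]mul1r cz24_0.
    have -> : p%:Z - 1 = (p%:Z - sigma%:Z) * q%:Z + 0 * p%:Z by rewrite qZ; clear -sigmaE; lia.
    rewrite cz24; last by move: sigma_bnd; clear; lia.
    by rewrite ifF /cl ?rho1; clear -p5 sigmaE; lia.
  have sigmaE : 3 * sigma%:Z = p%:Z + 1 by move: bezoutZ; rewrite rho2 qZ; clear; lia.
  apply: (mem0_coef_set (p%:Z + 2) (2 * p%:Z + 1)); [|clear -p5; lia|by apply: top; [right|move: p5; clear; lia]].
  rewrite E (_ : p%:Z + 2 - 1 = 1 * p%:Z + 1); last by ring.
  rewrite cz24_1.
  have -> : p%:Z + 2 = (2 * sigma%:Z) * q%:Z + (- 1) * p%:Z by rewrite qZ; clear -sigmaE; lia.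
  rewrite cz24; last by clear -sigmaE p5; lia.
  by rewrite ifT /cl ?rho2 ?qZ; clear -p5 sigmaE; lia.
apply: (mem0_coef_set 3 (1 * p%:Z + 1)); [|clear -p5; lia|by apply: top; [left|move: p5; clear; lia]].
rewrite E !cz24_small; [|clear -p5; lia..].
by rewrite !(sg_gt0_small bez) //; clear -p5 q5; lia.
Qed.

(** * The product of Phi_p, Phi_q and Phi_(p^2 q): k = 38 *)

(* U z is the number of 0 <= i < p for which (z - i) %/ p is in the semigroup. *)
Let U (z : int) : int :=
  ((z %% p%:Z)%Z + 1) * (s (z %/ p%:Z)%Z)%:Z
  + (p%:Z - 1 - (z %% p%:Z)%Z) * (s ((z %/ p%:Z)%Z - 1))%:Z.

Let UE (m e : int) : 0 <= e < p%:Z -> U (m * p%:Z + e) =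
  (e + 1) * (s m)%:Z + (p%:Z - 1 - e) * (s (m - 1))%:Z.
Proof.
move=> he; rewrite /U (@divz_unique _ _ m); [|by clear -p0; lia|by clear -he; lia].
by rewrite modzMDl modz_small //; clear -he; lia.
Qed.

Let U_rep (z : int) : exists m e : int, 0 <= e < p%:Z /\ z = m * p%:Z + e.
Proof.
exists (z %/ p%:Z)%Z, (z %% p%:Z)%Z; split; last exact: divz_eq.
by rewrite modz_ge0 ?ltz_pmod //; clear -p0; lia.
Qed.

Let U_neg (z : int) : z < 0 -> U z = 0.
Proof.
have [m [e [he ->]]] := U_rep z => hz; rewrite UE // !(sg_neg bez) ?mulr0 //.
  by clear -hz he; nia.
by clear -hz he; nia.
Qed.

Let U_bnd (z : int) : 0 <= U z <= p%:Z.
Proof.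
have [m [e [he ->]]] := U_rep z; rewrite UE //.
by case: (s m); case: (s (m - 1)); rewrite /= ?mulr1 ?mulr0; clear -he; lia.
Qed.

(** f_38 is f_36 times 1 + ... + x^(p-1), so the two indicator terms of f_36 are summed over p
    consecutive indices. *)
Lemma cz_fdiv_38 (z : int) : cz (fdiv p q 38) z = U z - U (z - q%:Z).
Proof.
move: z; apply: (@cz_uniq 1) => // [z z0|z]; first by rewrite !U_neg ?subrr //; arith.
have -> : ('X^1 - 1) * fdiv p q 38 = ('X^p - 1) * fdiv p q 36.
  rewrite expr1 (_ : fdiv p q 38 = geo p * fdiv p q 36); last by fdiv_ring.
  by rewrite mulrA mul_geo.
rewrite czXn1M !cz_fdiv_36.
have key (w : int) : U w - U (w - 1) = (s (w %/ p%:Z)%Z)%:Z - (s ((w - p%:Z) %/ p%:Z)%Z)%:Z.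
  have [m [e [he ->]]] := U_rep w.
  have pZ0 : 0 < p%:Z by clear -p0; lia.
  rewrite (@divz_unique _ _ m) //; last by clear -he; lia.
  rewrite (@divz_unique _ (_ - p%:Z) (m - 1)) //; last by rewrite mulrBl; clear -he; lia.
  rewrite UE //; have [e0|e0] : e = 0 \/ 0 < e by clear -he; lia.
    rewrite (_ : _ + e - 1 = (m - 1) * p%:Z + (p%:Z - 1)); last by rewrite e0; ring.
    by rewrite UE; [rewrite e0; ring|clear -p0; lia].
  by rewrite -[m * p%:Z + e - 1]addrA UE; [ring|clear -he e0; lia].
have := key z; have := key (z - q%:Z).
rewrite (_ : z - p%:Z - q%:Z = z - q%:Z - p%:Z); last by ring.
rewrite (_ : z - 1%:Z - q%:Z = z - q%:Z - 1); last by ring.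
move=> E1 E2.
rewrite (_ : _ - _ - (U z - _) = (U (z - q%:Z) - U (z - q%:Z - 1)) - (U z - U (z - 1))); last by ring.
by rewrite E1 E2; ring.
Qed.

Let cz38_small (m e : int) : 0 <= e < p%:Z -> m * p%:Z + e < q%:Z ->
  cz (fdiv p q 38) (m * p%:Z + e) = (e + 1) * (s m)%:Z + (p%:Z - 1 - e) * (s (m - 1))%:Z.
Proof. by move=> he hz; rewrite cz_fdiv_38 UE // U_neg ?subr0 // subr_lt0. Qed.

(** With q = c0 p + r, adding q to mp + e raises the quotient by c0 without a carry. The companion
    [cz38_hi] treats the carry. *)
Let cz38_lo (c0 r : nat) (m e : int) : q = (c0 * p + r)%N -> 0 <= e -> e + r%:Z < p%:Z ->
  cz (fdiv p q 38) (q%:Z + m * p%:Z + e) =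
  (e + r%:Z + 1) * (s (m + c0%:Z))%:Z + (p%:Z - 1 - e - r%:Z) * (s (m + c0%:Z - 1))%:Z
  - ((e + 1) * (s m)%:Z + (p%:Z - 1 - e) * (s (m - 1))%:Z).
Proof.
move=> Eq e0 er; rewrite cz_fdiv_38 (_ : _ - q%:Z = m * p%:Z + e); last by ring.
rewrite UE; last by clear -e0 er; lia.
rewrite (_ : q%:Z + _ + _ = (m + c0%:Z) * p%:Z + (e + r%:Z)); last by rewrite {1}Eq PoszD PoszM; ring.
by rewrite UE; [ring|clear -e0 er; lia].
Qed.

Let cz38_hi (c0 r : nat) (m e : int) : q = (c0 * p + r)%N -> (r < p)%N ->
  e < p%:Z -> p%:Z <= e + r%:Z ->
  cz (fdiv p q 38) (q%:Z + m * p%:Z + e) =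
  (e + r%:Z - p%:Z + 1) * (s (m + c0%:Z + 1))%:Z + (2 * p%:Z - 1 - e - r%:Z) * (s (m + c0%:Z))%:Z
  - ((e + 1) * (s m)%:Z + (p%:Z - 1 - e) * (s (m - 1))%:Z).
Proof.
move=> Eq rp ep er; rewrite cz_fdiv_38 (_ : _ - q%:Z = m * p%:Z + e); last by ring.
rewrite UE; last by clear -ep rp er; lia.
rewrite (_ : q%:Z + _ + _ = (m + c0%:Z + 1) * p%:Z + (e + r%:Z - p%:Z)); last by rewrite {1}Eq PoszD PoszM; ring.
rewrite UE; last by clear -ep rp er; lia.
by rewrite addrK; ring.
Qed.

(** The bound p holds because [U] has values in [0, p]; the bound q because f_38 is a sum of q
    translates of a polynomial with coefficients in [-1, 1]. *)
Let cz38_ub (z : int) : cz (fdiv p q 38) z <= (minn p q)%:Z.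
Proof.
have h1 : cz (fdiv p q 38) z <= p%:Z.
  rewrite cz_fdiv_38; have := U_bnd z; have := U_bnd (z - q%:Z); clear; lia.
suff : cz (fdiv p q 38) z <= q%:Z by move: h1; clear; lia.
have -> : fdiv p q 38 = geo q * (geo p * (D \Po 'X^p)) by fdiv_ring.
have := @cz_geo_mul_bound (geo p * (D \Po 'X^p)) (-1) 1 q _ z.
case/(_ _)/andP => [w|_]; last by rewrite mulr1.
rewrite (@cz_geo_mul_comp D (fun m => (s m)%:Z)) //.
- by do 2 case: (s _).
- by move=> m /(sg_neg bez) ->.
- exact: (cz_binary bez Phi_pq).
Qed.

(* Writing q = H p ^ 2 + r, the products of g with geo (H p ^ 2) and with
   geo ((H + 1) p ^ 2) have nonnegative coefficients, so that only r, respectively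
   p ^ 2 - r, translates of g contribute negatively. *)
Let cz38_lb (z : int) : - (beta p q)%:Z <= cz (fdiv p q 38) z.
Proof.
pose g := geo p * (D \Po 'X^p).
have g_bnd (w : int) : -1 <= cz g w <= 1.
  rewrite (@cz_geo_mul_comp D (fun m => (s m)%:Z)) //.
  - by do 2 case: (s _).
  - by move=> m /(sg_neg bez) ->.
  - exact: (cz_binary bez Phi_pq).
have E : fdiv p q 38 = geo q * g by rewrite /g; fdiv_ring.
have pos H : nonneg_coefs (geo (H * p ^ 2) * g).
  have -> : geo (H * p ^ 2) * g = (geo H \Po 'X^(p ^ 2)) * (geo p * geo p * (geo p \Po 'X^(p * q))).
    by rewrite -geo_mul_comp /g geo_p_comp_pq geo_pp; ring.
  do !apply: nonneg_mul; try apply: nonneg_comp; try exact: nonneg_geo; rewrite ?expn_gt0 ?muln_gt0 ?p0 //.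
have lb_q : - q%:Z <= cz (fdiv p q 38) z.
  by have := cz_geo_mul_bound q g_bnd z; rewrite -E mulrN mulr1 => /andP[].
have lb_p : - p%:Z <= cz (fdiv p q 38) z.
  rewrite cz_fdiv_38; have := U_bnd z; have := U_bnd (z - q%:Z); clear; lia.
have Eq := divn_eq q (p ^ 2); rewrite /beta.
have rp : (q %% p ^ 2 < p ^ 2)%N by rewrite ltn_mod expn_gt0 p0.
move: (q %/ p ^ 2)%N (q %% p ^ 2)%N Eq rp => H r Eq rp.
have lb_r : - r%:Z <= cz (fdiv p q 38) z.
  rewrite E {1}Eq addnC geo_add mulrDl czD -mulrA czXnM.
  have := cz_geo_mul_bound r g_bnd z; have := nonneg_coefs_cz (z - r%:Z) (pos H).
  by clear; lia.
have lb_pr : - (p ^ 2 - r)%N%:Z <= cz (fdiv p q 38) z.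
  have Eg : geo q * g = geo (H.+1 * p ^ 2) * g - 'X^q * (geo (p ^ 2 - r) * g).
    have -> : (H.+1 * p ^ 2 = q + (p ^ 2 - r))%N by rewrite mulSn {1}Eq; clear -rp; lia.
    by rewrite geo_add; ring.
  rewrite E Eg czB czXnM.
  have := cz_geo_mul_bound (p ^ 2 - r) g_bnd (z - q%:Z); have := nonneg_coefs_cz z (pos H.+1).
  by clear; lia.
by move: lb_q lb_p lb_r lb_pr; clear; lia.
Qed.

(** The index is the degree of f_38, above all zeros exhibited later. *)
Let cz38_top : cz (fdiv p q 38) (q%:Z + (p%:Z - 1) * (q%:Z - 1) * p%:Z + (p%:Z - 2)) != 0.
Proof.
have [c0 [r [Eq r_bnd _ _]]] := q_divp.
have rp : (r < p)%N by case/andP: r_bnd.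
have F : s ((p%:Z - 1) * (q%:Z - 1) - 1) = false.
  by rewrite (_ : _ - 1 = p%:Z * q%:Z - p%:Z - q%:Z); [exact: sg_frobenius bez|ring].
have L m : (p%:Z - 1) * (q%:Z - 1) <= m -> s m by exact: (sg_large bez).
have [er|er] : p%:Z - 2 + r%:Z < p%:Z \/ p%:Z <= p%:Z - 2 + r%:Z by clear; lia.
  have r1 : r = 1 by move: er r_bnd; clear; lia.
  rewrite (cz38_lo _ Eq) //; last by clear -p1; lia.
  have c00 : (0 < c0)%N by case: (c0) Eq q1 => // ->; rewrite r1.
  rewrite F !L; [|clear -c00; lia..].
  by rewrite r1; clear -p1; lia.
rewrite (cz38_hi _ Eq) //; last by clear; lia.
rewrite F !L; [|clear; lia..].
by clear -p1; lia.
Qed.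

Let cz38_lt_top (z : int) : z < q%:Z + 2 * p%:Z -> (2 < p)%N \/ (2 < q)%N ->
  z < q%:Z + (p%:Z - 1) * (q%:Z - 1) * p%:Z + (p%:Z - 2).
Proof.
move=> hz h; have : 2 <= (p%:Z - 1) * (q%:Z - 1) by clear -p1 q1 h; case: h => h; nia.
by move: ((p%:Z - 1) * _) => a2 ha; clear -hz ha p1; nia.
Qed.

Let cz38_zero (z : int) : cz (fdiv p q 38) z = 0 -> 0 <= z < q%:Z + 2 * p%:Z -> (2 < p)%N \/ (2 < q)%N ->
  0 \in coef_set (fdiv p q 38).
Proof.
move=> hz /andP[z0 zpq] h; apply: mem0_coef_set hz _ cz38_top.
by rewrite z0 cz38_lt_top.
Qed.

Let mem38_pos (v : int) : 0 < v -> v <= (minn p q)%:Z -> v \in coef_set (fdiv p q 38).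
Proof.
move=> v0 vm; apply: (mem_coef_set (0 * p%:Z + (v - 1))); last by clear -v0; lia.
rewrite cz38_small; [|clear -v0 vm; lia..].
by rewrite (sg0 bez) (sg_neg bez) // mulr0 mulr1 addr0 subrK.
Qed.

(** Here U(z - q) = v comes from s(0) alone, on the falling side of its contribution, while U(z) = 0
    because 1 and 2 are gaps. For v = q there is no carry, hence the separate case. *)
Let cz38_lt (v : int) : (q < p)%N -> (2 < q)%N -> 0 <= v <= q%:Z ->
  cz (fdiv p q 38) (q%:Z + 1 * p%:Z + (p%:Z - 1 - v)) = - v.
Proof.
move=> qp q3 hv; have Eq : q = (0 * p + q)%N by [].
have s1 : s 1 = false by apply: (sg_gt0_small bez); arith.
have s2 : s 2 = false by apply: (sg_gt0_small bez); arith.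
have [vq|vq] : v = q%:Z \/ v < q%:Z by clear -hv; lia.
  rewrite (cz38_lo _ Eq); [|clear -qp vq; lia..].
  by rewrite addr0 subrr (sg0 bez) s1 vq; clear; lia.
rewrite (cz38_hi _ Eq); [|clear -hv qp vq; lia..].
by rewrite addr0 subrr (sg0 bez) s1 s2; clear; lia.
Qed.

(** In most cases z - q is v - 1 or 2p - 1 - v, on the rising or falling side of the contribution of
    s(0), so that U(z - q) = v; it remains to have U(z) = 0. This depends on which integers near c0
    are multiples of p, hence the cases on c1 = c0 mod p; the remainder of q modulo p^2 is c1 p +
    r. *)
Let mem38_gt (v : int) : (p < q)%N -> (4 < q)%N -> 0 < v <= (beta p q)%:Z ->
  - v \in coef_set (fdiv p q 38).
Proof.
move=> pq q5 hv.
have [c0 [r [Eq r_bnd _ _]]] := q_divp.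
have rp : (r < p)%N by case/andP: r_bnd.
pose H := (c0 %/ p)%N; pose c1 := (c0 %% p)%N.
have Ec0 : c0 = (H * p + c1)%N by exact: divn_eq.
have c1p : (c1 < p)%N by rewrite ltn_mod.
have Er : (q %% p ^ 2 = c1 * p + r)%N.
  rewrite Eq Ec0 mulnDl -mulnA mulnn -addnA modnMDl modn_small //.
  by rewrite -mulnn; clear -c1p rp; nia.
(* These arguments are below q, where membership is divisibility by p, and c0 + i is congruent to c1
   + i. *)
have S (i : int) : -1 <= i <= 2 -> (i = 2 -> 2 < p)%N ->
    s (c0%:Z + i) = (c1%:Z + i == 0) || (c1%:Z + i == p%:Z).
  move=> hi hp; have c1lt : c1%:Z < p%:Z by [].
  rewrite (sg_lt_B bez); last first.
    move: pq q5; rewrite Eq; clear -p1 r_bnd hi.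
    by have [->|[->|]] : c0 = 0 \/ c0 = 1 \/ (1 < c0)%N; [lia..|nia].
  rewrite (_ : c0%:Z + i = c1%:Z + i + H%:Z * p%:Z); last by rewrite {1}Ec0 PoszD PoszM; ring.
  rewrite rpredDr ?dvdz_mull //.
  apply/idP/idP => [/dvdzP[k Ek]|/orP[]/eqP-> //]; last exact: dvdz0.
  rewrite Ek; have [->|->] : k = 0 \/ k = 1 by clear -Ek hi hp c1lt p1; nia.
    by rewrite mul0r.
  by rewrite mul1r eqxx orbT.
have s0 := sg0 bez.
have sm1 : s (-1) = false by apply: (sg_neg bez).
have s1 : s 1 = false by apply: (sg_gt0_small bez).
have lo0 := cz38_lo 0 Eq; have hi0 := cz38_hi 0 Eq rp.
have lo1 := cz38_lo 1 Eq; have hi1 := cz38_hi 1 Eq rp.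
move: hv; rewrite /beta Er => hv.
have mem m e : cz (fdiv p q 38) (q%:Z + m * p%:Z + e) = - v -> - v \in coef_set (fdiv p q 38).
  by move=> E; apply: mem_coef_set E _; clear -hv; lia.
have hvZ : [/\ v <= p%:Z, v <= (c1 * p + r)%N%:Z & v <= p%:Z * p%:Z - (c1 * p + r)%N%:Z].
  by rewrite -PoszM mulnn; split; move: hv; clear -c1p rp; nia.
case: hvZ => vp; rewrite PoszD PoszM => vr vpr.
rewrite !add0r sm1 s0 in lo0 hi0; rewrite subrr s1 s0 [1 + c0%:Z]addrC in lo1 hi1.
rewrite addrK in lo1; rewrite -[c0%:Z + 1 + 1]addrA in hi1.
have {}S (i : int) : -1 <= i <= 2 -> (i = 2 -> 2 < p)%N -> c1%:Z + i != 0 -> c1%:Z + i != p%:Z ->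
    s (c0%:Z + i) = false.
  by move=> hi hp /negPf h0 /negPf hp'; rewrite S // h0 hp'.
have S0 : (0 < c1)%N -> s c0%:Z = false.
  by move=> h; rewrite -[c0%:Z]addr0 S //; move: c1p h; clear; lia.
have [c10|c1_gt0] := posnP c1.
  have sc : s c0%:Z.
    by rewrite Ec0 c10 addn0 PoszM (sg_mulM bez).
  have S1 : s (c0%:Z + 1) = false by rewrite S // c10; clear -p1; lia.
  (* For c1 = 0 the remainder modulo p^2 is r, so v <= r. If v < r, a carry moves the quotients past
     c0; if v = r, index q + p gives (p - 1 - r) - (p - 1). *)
  have [vr'|vr'] : v = r%:Z \/ v < r%:Z by move: vr; rewrite c10; clear; lia.
    by apply: (mem 1 0); rewrite lo1 // S1 sc vr'; clear; lia.
  apply: (mem 1 (p%:Z - 1 - v)); rewrite hi1; [|by clear -hv vr'; lia..].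
  have p3 : (2 < p)%N by clear -hv vr' rp; lia.
  rewrite S1 S //; [|by rewrite c10; clear -p3; lia..].
  by clear; lia.
have S0f := S0 c1_gt0.
have [c1E|c1_lt] : (c1%:Z = p%:Z - 1) \/ (c1.+1 < p)%N by move: c1p; clear; lia.
  have er : v - 1 + r%:Z < p%:Z by clear -vpr c1E; nia.
  apply: (mem 0 (v - 1)); rewrite lo0 //; last by clear -hv; lia.
  rewrite S0f; have [p2|p3] : p = 2 \/ (2 < p)%N by clear -p1; lia.
    rewrite (_ : p%:Z - 1 - (v - 1) - r%:Z = 0); last by clear -hv er p2 r_bnd; lia.
    by clear; lia.
  by rewrite S //; [clear; lia|clear -c1E p3; lia..].
have S1 : s (c0%:Z + 1) = false by rewrite S //; clear -c1_lt; lia.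
have p3 : (2 < p)%N by clear -c1_lt c1_gt0; lia.
have [er|er] : p%:Z - r%:Z < v \/ v <= p%:Z - r%:Z by clear; lia.
  apply: (mem 0 (v - 1)); rewrite hi0; [|clear -er vp; lia..].
  by rewrite S1 S0f; clear; lia.
have [c11|c1_gt1] : c1%:Z = 1 \/ (1 < c1)%N by clear -c1_gt0; lia.
  have [vr'|vr'] : r%:Z <= v \/ v < r%:Z by clear; lia.
    apply: (mem 1 (p%:Z - 1 - v)); rewrite lo1; [|clear -hv vr' er r_bnd; lia..].
    by rewrite S1 S0f; clear; lia.
  have [p4|p3E] : (3 < p)%N \/ p%:Z = 3 by clear -p3; lia.
    apply: (mem 1 (p%:Z - 1 - v)); rewrite hi1; [|clear -hv vr'; lia..].
    by rewrite S1 S //; [clear; lia|rewrite c11; clear -p4; lia..].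
  apply: (mem 0 0); rewrite lo0 //.
  rewrite S0f (_ : p%:Z - 1 - 0 - r%:Z = 0); last by clear -hv vr' rp p3E; lia.
  by clear -hv vr' rp p3E; lia.
apply: (mem 0 (v - 1)); rewrite lo0; [|clear -hv er; lia..].
by rewrite S0f S //; [clear; lia|clear -c1_gt1 c1_lt; lia..].
Qed.

(** For q >= 2p, U vanishes at 2p - 1 because 1 is a gap; for p < q < 2p and p > 3 both terms vanish
    at q + 2p - 1. Only p = 3, q = 5 needs an actual cancellation, at index 9. *)
Let mem38_gt0 : (p < q)%N -> (4 < q)%N -> 0 \in coef_set (fdiv p q 38).
Proof.
move=> pq q5; have s0 := sg0 bez; have s1 : s 1 = false by apply: (sg_gt0_small bez).
have [q2p|q2p] : (2 * p <= q)%N \/ (q < 2 * p)%N by clear; lia.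
  apply: (cz38_zero (z := 1 * p%:Z + (p%:Z - 1))); [|clear -q2p p1; lia|by right; clear -q5; lia].
  rewrite cz38_small; [|clear -q2p p1; lia..].
  by rewrite s1 subrr s0; clear; lia.
have Eq : q = (1 * p + (q - p))%N by clear -pq; lia.
have p3 : (2 < p)%N by clear -q5 q2p; lia.
have s2 : s 2 = false by apply: (sg_gt0_small bez); clear -p3 q5; lia.
have [p4|p3E] : (3 < p)%N \/ p = 3 by clear -p3; lia.
  have s3 : s 3 = false by apply: (sg_gt0_small bez); clear -p4 q5; lia.
  apply: (cz38_zero (z := q%:Z + 1 * p%:Z + (p%:Z - 1))); [|clear -p1; lia|by right; clear -q5; lia].
  rewrite (cz38_hi _ Eq); [|clear -q2p pq; lia..].
  rewrite (_ : 1 + 1%:Z + 1 = 3) // (_ : 1 + 1%:Z = 2) // s1 s2 s3.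
  by clear; lia.
have q5E : q = 5.
  have [q5E|q4E] : q = 5 \/ q = 4 by clear -q2p q5 p3E; lia.
    by [].
  by move: q5; rewrite q4E.
have s3 : s 3 by rewrite (_ : 3 = 1 * p%:Z) ?(sg_mulM bez) // mul1r p3E.
apply: (cz38_zero (z := q%:Z + 1 * p%:Z + 1)); [|clear -p1; lia|by right; clear -q5; lia].
rewrite (cz38_hi _ Eq); [|clear -q5E p3E; lia..].
rewrite (_ : 1 + 1%:Z + 1 = 3) // (_ : 1 + 1%:Z = 2) // s1 s2 s3 subrr s0.
by clear -q5E p3E; lia.
Qed.

Let s23 (m : int) : p = 2 -> q = 3 -> s m = (0 <= m) && (m != 1).
Proof.
move=> p2 q3; have [m0|[m0|[m1|m2]]] : m < 0 \/ m = 0 \/ m = 1 \/ 2 <= m by clear; lia.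
- by rewrite (sg_neg bez) // leNgt m0.
- by rewrite m0 (sg0 bez).
- by rewrite m1; apply: (sg_gt0_small bez); rewrite ?p2 ?q3.
- by rewrite (sg_large bez) ?p2 ?q3 //; clear -m2; lia.
Qed.

Let nz38_23 : p = 2 -> q = 3 -> 0 \notin coef_set (fdiv p q 38).
Proof.
move=> p2 q3; have pZ : p%:Z = 2 by rewrite p2.
have qZ : q%:Z = 3 by rewrite q3.
have E (m : int) : cz (fdiv p q 38) (m * p%:Z + 0) =
    (s m)%:Z + (s (m - 1))%:Z - 2 * (s (m - 2))%:Z.
  rewrite cz_fdiv_38 (_ : _ - q%:Z = (m - 2) * p%:Z + 1); last by rewrite pZ qZ; ring.
  by rewrite !UE ?pZ //; clear; lia.
have E' (m : int) : cz (fdiv p q 38) (m * p%:Z + 1) =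
    2 * (s m)%:Z - (s (m - 1))%:Z - (s (m - 2))%:Z.
  rewrite cz_fdiv_38 (_ : _ - q%:Z = (m - 1) * p%:Z + 0); last by rewrite pZ qZ; ring.
  rewrite (@UE m) ?(@UE (m - 1)) ?pZ // (_ : m - 1 - 1 = m - 2); last by ring.
  by clear; lia.
have val (z : int) : exists m : int, z = m * p%:Z + 0 \/ z = m * p%:Z + 1.
  have [m [e [he ->]]] := U_rep z; exists m.
  have [->|->] : e = 0 \/ e = 1 by move: he; rewrite pZ; clear; lia.
    by left.
  by right.
(* For p = 2 and q = 3 the degree is 7. *)
apply/negP => /(@coef_set_cz_lt _ _ 8)[z|z].
  have [m [->|->]] := val z; rewrite pZ => hz; rewrite -pZ ?E ?E' !s23 //.
    by clear -hz; lia.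
  by clear -hz; lia.
have [m [->|->]] := val z; rewrite pZ => hz; rewrite -pZ ?E ?E' !s23 //.
  by clear -hz; lia.
by clear -hz; lia.
Qed.

(** For q = 2 the coefficient is U(z) - U(z - 2). It is even unless z is a multiple of p; there it
    equals s(m + 1) - s(m - 1), which is nonnegative since 2 is a generator. *)
Let nm1_38_q2 : q = 2 -> -1 \notin coef_set (fdiv p q 38).
Proof.
move=> q2; have qZ : q%:Z = 2 by rewrite q2.
apply/negP => /coef_set_cz[z _]; rewrite cz_fdiv_38 qZ.
have [m [e [he E]]] := U_rep (z - 2); rewrite E.
have pgt : 2 < p%:Z by move: p1 p_neq_q; rewrite q2; clear; lia.
have -> : z = m * p%:Z + (e + 2) by clear -E; lia.
have [e1|[e1|e1]] : e + 2 < p%:Z \/ e = p%:Z - 2 \/ e = p%:Z - 1 by clear -he; lia.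
- by rewrite !UE //; [clear; lia|clear -he e1; lia].
- rewrite (_ : _ + (e + 2) = (m + 1) * p%:Z + 0); last by rewrite e1; ring.
  rewrite !UE; [|clear -he pgt; lia..].
  have : s (m - 1) -> s (m + 1).
    by move=> h; have := @sg_addB _ _ _ _ bez _ 1 h isT; rewrite qZ mul1r -addrA.
  rewrite addrK e1; case: (s (m - 1)) => [->//|_]; first by clear; lia.
  by case: (s _); clear; lia.
- rewrite (_ : _ + (e + 2) = (m + 1) * p%:Z + 1); last by rewrite e1; ring.
  rewrite !UE; [|clear -he pgt; lia..].
  by rewrite addrK e1; clear; lia.
Qed.

Lemma coef_set_fdiv_38 : coef_set (fdiv p q 38) =i expected_coefs p q 38.
Proof.
move=> c; expect.
have bnd : c \in coef_set (fdiv p q 38) -> - (beta p q)%:Z <= c <= (minn p q)%:Z.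
  by case/coef_set_cz => z _ <-; rewrite cz38_lb cz38_ub.
have [q2|q3] : q = 2 \/ (2 < q)%N by clear -q1; lia.
  have p3 : (2 < p)%N by move: p1 p_neq_q; rewrite q2; clear; lia.
  have Eq : q = (0 * p + q)%N by [].
  have qp : (q < p)%N by rewrite q2.
  have s1 : s 1 = false.
    by rewrite (sg_lt_M bez) ?q2 //; clear -p3; lia.
  have E (e : int) : e < p%:Z -> p%:Z <= e + q%:Z -> cz (fdiv p q 38) (q%:Z + 0 * p%:Z + e) = 2 * p%:Z - 4 - 2 * e.
    move=> e1 e2; rewrite (cz38_hi _ Eq) // !add0r s1 (sg0 bez) (sg_neg bez) //.
    by clear -q2; lia.
  have beta2 : beta p q = 2.
    by rewrite /beta q2 modn_small; clear -p3; nia.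
  rewrite [q == 2%N](introT eqP q2) /= in_zs; apply/idP/idP => [hc|].
    have := bnd hc; rewrite beta2.
    have : c != -1 by apply: contraL hc => /eqP->; exact: nm1_38_q2.
    by rewrite q2; clear; lia.
  case/or4P => /eqP->.
  - by apply: (mem_coef_set (q%:Z + 0 * p%:Z + (p%:Z - 1))); rewrite // E; clear -q2; lia.
  - apply: (cz38_zero (z := q%:Z + 0 * p%:Z + (p%:Z - 2))); [|clear -p3; lia|by left].
    by rewrite E; clear -q2; lia.
  - by rewrite mem38_pos //; clear -p3 q2; lia.
  - by rewrite mem38_pos //; clear -p3 q2; lia.
have -> : (q == 2%N) = false by clear -q3; lia.
have q4 : q != 4 by apply/eqP => q4; move: q_prime; rewrite q4.
have [qp|pq] : (q < p)%N \/ (p < q)%N by clear -p_neq_q; lia.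
  have -> : (p == 2%N) = false by clear -q3 qp; lia.
  rewrite /= in_zs; apply/idP/idP => [/bnd //|hc].
  have [c0|c0] : 0 < c \/ c <= 0 by clear; lia.
    by apply: mem38_pos => //; case/andP: hc.
  have cq : 0 <= - c <= q%:Z by move: hc; rewrite /beta; clear -c0; lia.
  have := cz38_lt qp q3 cq; rewrite opprK.
  have [->|cn0] := eqVneq c 0; last by move/mem_coef_set; apply.
  by move=> h; apply: (cz38_zero h); [clear -qp; lia|right].
have [q3E|q5] : q = 3 \/ (4 < q)%N by clear -q3 q4; lia.
  have p2 : p = 2 by clear -p1 pq q3E; lia.
  have -> : (p == 2%N) && (q == 3%N) by rewrite p2 q3E.
  rewrite /= in_zs; have beta1 : beta p q = 1 by rewrite /beta p2 q3E.
  apply/idP/idP => [hc|].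
    have := bnd hc; rewrite beta1.
    have : c != 0 by apply: contraL hc => /eqP->; exact: nz38_23.
    by rewrite p2 q3E; clear; lia.
  case/or3P => /eqP->.
  - have Eq : q = (1 * p + 1)%N by rewrite p2 q3E.
    apply: (mem_coef_set (q%:Z + 0 * p%:Z + 0)) => //; rewrite (cz38_lo _ Eq) //.
    have s1 : s 1 = false by apply: (sg_gt0_small bez); rewrite ?p2 ?q3E.
    by rewrite !add0r s1 (sg0 bez) (sg_neg bez) //; clear -p2; lia.
  - by rewrite mem38_pos //; clear -p2 q3E; lia.
  - by rewrite mem38_pos //; clear -p2 q3E; lia.
have -> : (p == 2%N) && (q == 3%N) = false by clear -q5; lia.
rewrite /= in_zs; apply/idP/idP => [/bnd //|hc].
have [c0|[->|c0]] : 0 < c \/ c = 0 \/ c < 0 by clear; lia.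
- by apply: mem38_pos => //; case/andP: hc.
- exact: mem38_gt0.
- by rewrite -[c]opprK mem38_gt //; move: hc; clear -c0; lia.
Qed.

(** * Divisors governed by the semigroup of q and p^2: k = 40, 41, 42, 43 *)

Variables tau upsilon : nat.
Hypothesis bez2 : bezout_pair q (p ^ 2) tau upsilon.
Local Notation t := (sg q (p ^ 2) upsilon).

(** As p^2 >= 4, a generator at most 3 can only be q; this is why the exceptions at k = 40 and 41
    mention q alone. *)
Lemma coef_set_fdiv_40 : coef_set (fdiv p q 40) =i expected_coefs p q 40.
Proof.
move=> c; expect; have -> : fdiv p q 40 = D * (D \Po 'X^p) by fdiv_ring.
rewrite (coef_set_binary bez2); last first.
  rewrite (mulnC q) (Xn1 q) (Xn1 (p ^ 2)%N) (Xn1 (p ^ 2 * q)%N) geo_ppq geo_pp; ring.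
have p4 : (4 <= p ^ 2)%N by rewrite -mulnn; nia.
finish.
Qed.

Lemma coef_set_fdiv_41 : coef_set (fdiv p q 41) =i expected_coefs p q 41.
Proof.
move=> c; expect; have -> : fdiv p q 41 = ('X - 1) * (D * (D \Po 'X^p)) by fdiv_ring.
rewrite (coef_set_X1_binary bez2); last first.
  rewrite (mulnC q) (Xn1 q) (Xn1 (p ^ 2)%N) (Xn1 (p ^ 2 * q)%N) geo_ppq geo_pp; ring.
have p4 : (4 <= p ^ 2)%N by rewrite -mulnn; nia.
finish.
Qed.

Lemma cz_fdiv_42 (z : int) : cz (fdiv p q 42) z = (t z)%:Z - (t (z - p%:Z))%:Z.
Proof.
apply: (cz_sg_quotient bez2).
have -> : fdiv p q 42 = geo p * D * (D \Po 'X^p) by fdiv_ring.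
rewrite (mulnC q) (Xn1 p) (Xn1 q) (Xn1 (p ^ 2)%N) (Xn1 (p ^ 2 * q)%N) geo_ppq geo_pp; ring.
Qed.

Let pp_int : (p ^ 2)%N%:Z = p%:Z * p%:Z. Proof. by rewrite -mulnn PoszM. Qed.

Lemma coef_set_fdiv_42 : coef_set (fdiv p q 42) =i expected_coefs p q 42.
Proof.
move=> c; expect; rewrite in_zs.
have t0 := sg0 bez2.
have cp : cz (fdiv p q 42) p = -1.
  rewrite cz_fdiv_42 subrr t0 (sg_lt_B bez2); last by rewrite pp_int; nia.
  by rewrite (_ : (q%:Z %| p%:Z)%Z = (q %| p)%N) // dvdn_prime2 // eq_sym (negPf p_neq_q).
apply/idP/idP => [|hc].
  by case/coef_set_cz => z _ <-; rewrite cz_fdiv_42; do 2 case: (t _).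
case: (bounded1P hc) => [->|[->|->]].
- apply: (mem0_coef_set 1 p%:Z); [|lia|by rewrite cp].
  by rewrite cz_fdiv_42 (sg_gt0_small bez2) ?(sg_neg bez2) //; rewrite ?pp_int; nia.
- by apply: (mem_coef_set 0); rewrite // cz_fdiv_42 t0 (sg_neg bez2) //; lia.
- exact: mem_coef_set cp _.
Qed.

Lemma sg_q2 : q = 2 ->
  forall z : int, t z = (0 <= z) && ((2 %| z)%Z || ((p ^ 2)%N%:Z <= z)).
Proof.
move=> q2 z; case: (ltP z 0) => z0; first exact: (sg_neg bez2).
case: (leP (p ^ 2)%N%:Z z) => zp.
  rewrite (sg_large bez2) ?orbT //; move: zp; rewrite q2; clear; lia.
by rewrite (sg_lt_B bez2); [rewrite q2 orbF | rewrite z0 zp].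
Qed.

Lemma coef_set_fdiv_43 : coef_set (fdiv p q 43) =i expected_coefs p q 43.
Proof.
move=> c; expect.
have E42 : fdiv p q 43 = ('X - 1) * fdiv p q 42 by fdiv_ring.
have E (z : int) : cz (fdiv p q 43) z =
    (t (z - 1))%:Z - (t (z - 1 - p%:Z))%:Z - (t z)%:Z + (t (z - p%:Z))%:Z.
  by rewrite E42 czX1M !cz_fdiv_42; ring.
have t0 := sg0 bez2.
have p4 : p%:Z < (p ^ 2)%N%:Z by rewrite pp_int; nia.
have p5 : 2 < (p ^ 2)%N%:Z by rewrite pp_int; nia.
have sym c' : c' \in coef_set (fdiv p q 43) -> - c' \in coef_set (fdiv p q 43).
  apply: (@coef_set_opp [:: q; p ^ 2]%N [:: 1; p; p ^ 2 * q]%N); rewrite //= ?q0 ?expn_gt0 ?p0 //.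
  rewrite !big_cons big_nil !mulr1 expr1 (_ : fdiv p q 43 = ('X - 1) * geo p * D * (D \Po 'X^p)); last by fdiv_ring.
  rewrite (Xn1 p) (Xn1 q) (Xn1 (p ^ 2)%N) (Xn1 (p ^ 2 * q)%N) geo_ppq geo_pp; ring.
have mone : -1 \in coef_set (fdiv p q 43).
  by apply: (mem_coef_set 0) => //; rewrite E t0 !(sg_neg bez2) //; lia.
(* At x + p all four terms contribute favourably: t(x) and t(x + p - 1) hold, while t(x - 1) and t(x
   + p) fail. *)
have [x x0 Ex] : exists2 x : int, 0 <= x & cz (fdiv p q 43) (x + p%:Z) = 2.
  have [||x x0 [h1 h2 h3 h4]] := @sg_start_end _ _ _ _ bez2 p.
  - by lia.
  - by rewrite (_ : (q%:Z %| p%:Z)%Z = (q %| p)%N) // dvdn_prime2 // eq_sym.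
  exists x => //; rewrite E addrK (_ : x + p%:Z - 1 - p%:Z = x - 1); last by ring.
  by rewrite h1 h3 (negPf h2) (negPf h4).
have two : 2 \in coef_set (fdiv p q 43) by exact: mem_coef_set Ex _.
have bnd : c \in coef_set (fdiv p q 43) -> -2 <= c <= 2.
  by case/coef_set_cz => z _ <-; rewrite E; do 4 case: (t _).
have one := sym _ mone; have mtwo := sym _ two; rewrite opprK in one.
case: ifP => q2; rewrite in_zs.
  move/eqP: q2 => q2; have p3 : (3 <= p)%N by move: p_neq_q p1; rewrite q2; clear; lia.
  have podd : odd p by case: (even_prime p_prime) => // p2; move: p3; rewrite p2.
  have ppodd : odd (p ^ 2) by rewrite oddX podd orbT.
  have tE := sg_q2 q2.
  apply/idP/or4P => [hc|[]/eqP->//].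
  suff : c != 0 by move/(between2 (bnd hc))/or4P.
  case/(@coef_set_cz_lt _ _ ((p ^ 2)%N%:Z + p%:Z)): hc => [z hz|z hz <-]; last first.
    by rewrite E !tE; apply: second_difference_parity => //; clear -podd ppodd p0; lia.
  have large w : (p ^ 2)%N%:Z - 1 <= w -> t w.
    by move=> hw; rewrite (sg_large bez2) // q2; clear -hw; lia.
  by rewrite E !large ?subrr //; clear -hz p0; lia.
apply/idP/idP => // hc.
case: (bounded2P hc) => [->|[->|[->|[->|->]]]] //.
have q3 : (2 < q)%N by move: q1 q2; clear; lia.
have [p3|p2] : (3 <= p)%N \/ p = 2 by arith.
  apply: (mem0_coef_set 2 (x + p%:Z)); [|arith|by rewrite Ex].
  have t1 : t 1 = false by apply: (sg_gt0_small bez2); arith.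
  have t2 : t 2 = false by apply: (sg_gt0_small bez2); arith.
  by rewrite E (_ : 2 - 1 = 1) // t1 t2 !(sg_neg bez2) //; arith.
have qodd : odd q by case: (even_prime q_prime) q2 => // ->.
have tE (z : int) : 0 <= z < q%:Z -> t z = (4 %| z)%Z by move=> hz; rewrite (sg_lt_M bez2) // p2.
have tlarge (z : int) : 3 * q%:Z - 3 <= z -> t z by move=> hz; rewrite (sg_large bez2) // p2; arith.
have tF : t (3 * q%:Z - 4) = false.
  have -> : 3 * q%:Z - 4 = q%:Z * (p ^ 2)%N%:Z - q%:Z - (p ^ 2)%N%:Z by rewrite p2; clear; lia.
  exact: sg_frobenius bez2.
have tq : t q%:Z by have := sg_mulM bez2 1; rewrite mul1r.
have pZ : p%:Z = 2 by rewrite p2.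
(* For p = 2 the generators are q and 4 and the degree is 3q - 1. At index q or q + 1, according to
   q modulo 4, both q and the neighbouring multiple of 4 are elements; their contributions cancel,
   and the other two arguments are gaps. *)
have q4 : (4 %| q%:Z - 1)%Z \/ (4 %| q%:Z + 1)%Z by clear -qodd; lia.
have ctop : cz (fdiv p q 43) (3 * q%:Z - 1) != 0.
  rewrite E pZ (_ : 3 * q%:Z - 1 - 1 - 2 = 3 * q%:Z - 4) ?tF; last by arith.
  by rewrite !tlarge //; arith.
case: q4 => q4.
  apply: (mem0_coef_set q%:Z _ _ _ ctop); last by arith.
  rewrite E pZ tq !tE; clear -q4 q3; lia.
have tq1 : t (q%:Z + 1).
  case/dvdzP: q4 => k Ek; have -> : q%:Z + 1 = k * (p ^ 2)%N%:Z by rewrite Ek p2.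
  by apply: (sg_mulB bez2); clear -Ek; lia.
apply: (mem0_coef_set (q%:Z + 1) _ _ _ ctop); last by arith.
rewrite E tq1 pZ addrK tq !tE; clear -q4 q3; lia.
Qed.

Lemma coef_set_fdiv (k : nat) : (k <= 63)%N -> coef_set (fdiv p q k) =i expected_coefs p q k.
Proof.
Ltac next lem := case => [_|]; [exact: lem|].
move: k;
next coef_set_fdiv_0; next coef_set_fdiv_1; next coef_set_fdiv_2; next coef_set_fdiv_3;
next coef_set_fdiv_4; next coef_set_fdiv_5; next coef_set_fdiv_6; next coef_set_fdiv_7;
next coef_set_fdiv_8; next coef_set_fdiv_9; next coef_set_fdiv_10; next coef_set_fdiv_11;
next coef_set_fdiv_12; next coef_set_fdiv_13; next coef_set_fdiv_14; next coef_set_fdiv_15;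
next coef_set_fdiv_16; next coef_set_fdiv_17; next coef_set_fdiv_18; next coef_set_fdiv_19;
next coef_set_fdiv_20; next coef_set_fdiv_21; next coef_set_fdiv_22; next coef_set_fdiv_23;
next coef_set_fdiv_24; next coef_set_fdiv_25; next coef_set_fdiv_26; next coef_set_fdiv_27;
next coef_set_fdiv_28; next coef_set_fdiv_29; next coef_set_fdiv_30; next coef_set_fdiv_31;
next coef_set_fdiv_32; next coef_set_fdiv_33; next coef_set_fdiv_34; next coef_set_fdiv_35;
next coef_set_fdiv_36; next coef_set_fdiv_37; next coef_set_fdiv_38; next coef_set_fdiv_39;
next coef_set_fdiv_40; next coef_set_fdiv_41; next coef_set_fdiv_42; next coef_set_fdiv_43;
next coef_set_fdiv_44; next coef_set_fdiv_45; next coef_set_fdiv_46; next coef_set_fdiv_47;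
next coef_set_fdiv_48; next coef_set_fdiv_49; next coef_set_fdiv_50; next coef_set_fdiv_51;
next coef_set_fdiv_52; next coef_set_fdiv_53; next coef_set_fdiv_54; next coef_set_fdiv_55;
next coef_set_fdiv_56; next coef_set_fdiv_57; next coef_set_fdiv_58; next coef_set_fdiv_59;
next coef_set_fdiv_60; next coef_set_fdiv_61; next coef_set_fdiv_62; next coef_set_fdiv_63.
by [].
Qed.

End Coefficients.

(** * Bezout pairs and the list of monic divisors *)

Lemma exists_bezout_pstar (p q : nat) : prime p -> prime q -> p != q ->
  exists sigma, bezout_pair p q (pstar p q) sigma.
Proof.
move=> p_prime q_prime p_neq_q.
have co : coprime p q by rewrite prime_coprime // dvdn_prime2.
have [rho [sigma bez]] := exists_bezout co (prime_gt1 p_prime) (prime_gt1 q_prime).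
exists sigma; rewrite -(@pstar_uniq p q rho) //; first by case/and3P: bez.
have /and3P[_ _ /eqP E] := bez.
by rewrite -(modnMDl sigma) [(sigma * q)%N]mulnC addnC E modnMDl.
Qed.

Lemma fdiv_divisor (p q : nat) (f : {poly int}) : prime p -> prime q -> p != q -> f \is monic ->
  (exists g : {poly int}, 'X^(p ^ 2 * q) - 1 = g * f) ->
  exists k : nat, (k <= 63)%N /\ f = fdiv p q k.
Proof.
move=> p_prime q_prime p_neq_q f_monic [g Eg].
have n0 : (0 < p ^ 2 * q)%N by rewrite muln_gt0 expn_gt0 !prime_gt0.
have [P ->] := Cyclotomic_divisor n0 f_monic Eg.
rewrite (perm_big _ (perm_divisors_p2q p_prime q_prime p_neq_q)) !big_cons big_nil.
pose k := (P 1 + P p * 2 + P q * 4 + P (p * q) * 8 + P (p ^ 2) * 16 + P (p ^ 2 * q) * 32)%N.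
exists k; rewrite /fdiv /k.
by case: (P 1); case: (P p); case: (P q); case: (P (p * q)%N); case: (P (p ^ 2)%N); case: (P (p ^ 2 * q)%N);
   split; rewrite // /bit /= ?expr0 ?expr1 ?mulr1 ?mul1r ?mulrA.
Qed.

Theorem theorem5 (p q : nat) (p_prime : prime p) (q_prime : prime q)
    (p_neq_q : p != q) :
  (forall f : {poly int}, f \is monic ->
     (exists g : {poly int}, 'X^(p ^ 2 * q) - 1 = g * f) ->
     exists k : nat, (k <= 63)%N /\ f = fdiv p q k)
  /\
  (forall k : nat, (k <= 63)%N ->
     coef_set (fdiv p q k) =i expected_coefs p q k).
Proof.
split=> [f|k hk]; first exact: fdiv_divisor.
have [sigma bez] := exists_bezout_pstar p_prime q_prime p_neq_q.
have co : coprime q (p ^ 2) by rewrite coprimeXr // coprime_sym prime_coprime // dvdn_prime2.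
have [|tau [upsilon bez2]] := exists_bezout co (prime_gt1 q_prime).
  by rewrite -(exp1n 2) ltn_exp2r ?prime_gt1.
exact: (coef_set_fdiv p_prime q_prime p_neq_q bez bez2 hk).
Qed.
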